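(* Let $N\ge 2$, let $k\ge 2$, fix $\mu\neq 0$, and let $\mathcal S=\mathcal S[l,m,n]$ be a rotational symbol sequence with $d$ the multiplicative inverse of $m$ modulo $n$. Suppose that the piecewise-affine map $f_\mu$ on $\mathbb R^N$ is a $C^{k+1}$ function of two real parameters $\eta$ and $\nu$ (so that its coefficients are $C^k$ functions of $(\eta,\nu)$), and that it has a (terminating or non-terminating) shrinking point, with associated sequence $\mathcal S$, when $\eta=\nu=0$. Let $\check{\mathcal S}=\mathcal S^{\overline{0}}$ and $\hat{\mathcal S}=\mathcal S^{\overline{ld}}$. For small $(\eta,\nu)$ let $\check x(\eta,\nu)$ be the unique solution of the $n$-cycle solution system of $\check{\mathcal S}$, let $\check x_i$ be its $i$-th iterate via $\check{\mathcal S}$, and let $\check s_i$ be the first component of $\check x_i$ (with $\check s=\check s_0$). Suppose that $$\check s(\eta,\nu)=\eta\,(1+O(1)),\qquad \check s_{ld}(\eta,\nu)=\nu\,(1+O(1)).$$ Write $$\det(I-M_{\mathcal S}(\eta,\nu))=k_1\eta+k_2\nu+O(2)$$ and assume $k_1,k_2\ne 0$. Let $\Psi_1=\{(\eta,\nu): \eta,\nu\ge 0\}$. Then for small $\eta$ and $\nu$, the $\mathcal S$- and $\check{\mathcal S}$-cycles are admissible in $\Psi_1$ and collide in border-collision fold bifurcations at the boundaries $\eta=0$ and $\nu=0$. If the shrinking point is non-terminating, then there exist $C^k$ functions $g_1,g_2:\mathbb R\to\mathbb R$ such that for small $\eta$ and $\nu$ the $\mathcal S$- and $\hat{\mathcal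 S}$-cycles are admissible in $$\Psi_2=\{(\eta,\nu): \eta\le g_1(\nu),\ \nu\le g_2(\eta)\}$$ and collide in border-collision fold bifurcations at the boundaries $\eta=g_1(\nu)$ and $\nu=g_2(\eta)$. Furthermore, the lowest-order nonzero terms of $g_1$ and $g_2$ are the quadratic ones, with negative coefficients: $g_1(0)=g_1'(0)=0$, $g_2(0)=g_2'(0)=0$, $g_1''(0)<0$ and $g_2''(0)<0$.
   Context: **The map.** For $x\in\mathbb R^N$ write $s=e_1^{\mathsf T}x$ for the first component. The map is $f_\mu(x)=f_\mu^{\mathsf L}(x)$ for $s\le 0$ and $f_\mu(x)=f_\mu^{\mathsf R}(x)$ for $s\ge 0$, where $f_\mu^{i}(x)=\mu b+A_ix$ ($i=\mathsf L,\mathsf R$), $\mu\in\mathbb R$, $b\in\mathbb R^N$, and $A_{\mathsf L},A_{\mathsf R}$ are real $N\times N$ matrices that are identical in all but possibly their first columns (so $f_\mu$ is continuous). The switching manifold is $\{s=0\}$. Let $\varrho^{\mathsf T}=e_1^{\mathsf T}\mathrm{adj}(I-A_{\mathsf L})=e_1^{\mathsf T}\mathrm{adj}(I-A_{\mathsf R})$, where adj is the adjugate. **Symbol sequences.** A symbol sequence of length $n$ is $\mathcal S\in\{\mathsf L,\mathsf R\}^n$, indexed $0,\dots,n-1$; indices are taken modulo $n$. $\mathcal S^{(i)}$ is the $i$-th left cyclic permutation, $(\mathcal S^{(i)})_j=\mathcal S_{i+j}$. $\mathcal S^{\overline{i}}$ is $\mathcal S$ with its $i$-th element flipped ($\mathsf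 L\leftrightarrow\mathsf R$). For $l,m,n\in\mathbb N$ with $l,m<n$, $\gcd(m,n)=1$, and $d$ the inverse of $m$ modulo $n$, the rotational symbol sequence $\mathcal S[l,m,n]$ is defined by $\mathcal S_{id}=\mathsf L$ for $i=0,\dots,l-1$ and $\mathcal S_{id}=\mathsf R$ for $i=l,\dots,n-1$. **Cycles.** Given $x=x_0$ and $\mathcal S$, the iterates of $x$ via $\mathcal S$ are $x_{i+1}=f_\mu^{\mathcal S_i}(x_i)$, with $s_i=e_1^{\mathsf T}x_i$. Put $M_{\mathcal S}=A_{\mathcal S_{n-1}}\cdots A_{\mathcal S_0}$ and $P_{\mathcal S}=I+A_{\mathcal S_{n-1}}+A_{\mathcal S_{n-1}}A_{\mathcal S_{n-2}}+\cdots+A_{\mathcal S_{n-1}}\cdots A_{\mathcal S_1}$. The $n$-cycle solution system of $\mathcal S$ is $(I-M_{\mathcal S})x_0=\mu P_{\mathcal S}b$ (equivalently $x_n=x_0$); if $x_0$ solves it, $\{x_0,\dots,x_{n-1}\}$ is an $\mathcal S$-cycle. It is admissible if for every $i$: $\mathcal S_i=\mathsf L$ whenever $s_i<0$ and $\mathcal S_i=\mathsf R$ whenever $s_i>0$ (no restriction if $s_i=0$); otherwise it is virtual. **Non-terminating shrinking point.** $f_\mu$ ($N\ge2$, $\mu\ne0$, $\varrho^{\mathsf T}b\ne0$) is at a non-terminating shrinking point, with $\mathcal S=\mathcal S[l,m,n]$, $1<l<n-1$, if: $P_{\mathcal S}$ and $P_{\mathcal S^{((l-1)d)}}$ are singular;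 $I-M_{\check{\mathcal S}}$ and $I-M_{\hat{\mathcal S}}$ are nonsingular, where $\check{\mathcal S}=\mathcal S^{\overline 0}$, $\hat{\mathcal S}=\mathcal S^{\overline{ld}}$; and the orbit $\{p_i\}$ of $p=p_0=\mu(I-M_{\check{\mathcal S}})^{-1}P_{\check{\mathcal S}}b$ iterated via $\check{\mathcal S}$ is admissible. **Terminating shrinking point.** $f_\mu$ ($N\ge2$) is at a terminating shrinking point, with $\mathcal S=\mathcal S[l,m,n]$, $l=n-1$, $n\ge3$, if: $I-A_{\mathsf L}$ is nonsingular and $\mu\varrho^{\mathsf T}b/\det(I-A_{\mathsf L})<0$; $I-M_{\check{\mathcal S}}$ is nonsingular, where $\check{\mathcal S}=\mathcal S^{\overline0}$; and $e^{\pm 2\pi \mathrm i m/n}$ are multipliers (eigenvalues) of $A_{\mathsf L}$. **Other conventions.** $O(j)$ denotes terms of order $j$ or larger in all variables and parameters (so $O(1)$ vanishes at $\eta=\nu=0$). A border-collision fold bifurcation of two $n$-cycles at a boundary curve means: the two cycles, which coexist as admissible cycles on one side of the curve, coincide on the curve with a point on the switching manifold, and annihilate there (they are not admissible on the other side).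
   Formalization: In the non-terminating case it is additionally assumed that at η=ν=0 only the points with index 0 and ld (mod n) of the Š-cycle lie on the switching manifold; otherwise a third point there can make the Š-cycle virtual inside Ψ1 and the claim fails. *)

(* Defs.v *)
From HB Require Import structures.
From mathcomp Require Export all_boot all_order all_algebra.
From mathcomp Require Export all_classical all_reals all_analysis.
From mathcomp Require Export complex.
Export Order.TTheory GRing.Theory Num.Theory.
Export numFieldNormedType.Exports.

Set Implicit Arguments.
Unset Strict Implicit.
Unset Printing Implicit Defensive.

Local Open Scope classical_set_scope.
Local Open Scope ring_scope.

(* Continuously differentiable functions of order k on U; U is meant to be
   open. On a finite-dimensional V this is the usual class C^k. *)
Fixpoint Ck_on (R : realType) (V : normedModType R) (k : nat) (U : set V)
    (h : V -> R^o) : Prop :=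
  match k with
  | 0 => forall p, U p -> {for p, continuous h}
  | k'.+1 => (forall p, U p -> differentiable h p) /\
             (forall v : V, Ck_on k' U ('D_v h))
  end.

Definition Ck_near (R : realType) (V : normedModType R) (k : nat) (p : V)
    (h : V -> R^o) : Prop :=
  exists2 U : set V, open_nbhs p U & Ck_on k U h.

Inductive symbol := symL | symR.

Definition flip_symbol (a : symbol) : symbol :=
  match a with symL => symR | symR => symL end.

(* Every index is read modulo n, so that any representative (for instance
   l * d) may be used. *)
Definition symb (n : nat) (S : n.-tuple symbol) (i : nat) : symbol :=
  nth symL S (i %% n).

Definition cyclic_shift (n : nat) (S : n.-tuple symbol) (i : nat) :
    n.-tuple symbol :=
  [tuple symb S (i + j) | j < n].

Definition flip_at (n : nat) (S : n.-tuple symbol) (i : nat) :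
    n.-tuple symbol :=
  [tuple if (j == i %[mod n])%N then flip_symbol (symb S j) else symb S j
  | j < n].

(* S = S[l, m, n], where d is an inverse of m modulo n. *)
Definition is_rotational (n : nat) (S : n.-tuple symbol) (l m d : nat) : Prop :=
  [/\ (l < n)%N, (m < n)%N, coprime m n, d * m = 1 %[mod n] &
      forall i, ((i < l)%N -> symb S (i * d) = symL) /\
                ((l <= i < n)%N -> symb S (i * d) = symR)].

(* Coefficients of the two pieces x |-> mu b + A_i x; the last field says that
   A_L and A_R agree except possibly in their first columns. *)
Record pwl_map (R : realType) (N : nat) := PWLMap {
  coef_b : 'cV[R]_N;
  coef_L : 'M[R]_N;
  coef_R : 'M[R]_N;
  coef_LR : forall i j : 'I_N, (j != 0 :> nat) -> coef_L i j = coef_R i j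
}.

Section Cycles.
Variables (R : realType) (N : nat).
Implicit Types (f : pwl_map R N) (mu : R) (x : 'cV[R]_N).

Definition e1 : 'cV[R]_N := \col_i (i == 0 :> nat)%:R.

Definition fst_comp x : R := (e1^T *m x) 0 0.

Definition coef f (a : symbol) : 'M[R]_N :=
  match a with symL => coef_L f | symR => coef_R f end.

Definition piece f mu (a : symbol) x : 'cV[R]_N :=
  mu *: coef_b f + coef f a *m x.

Definition pwl_eval f mu x : 'cV[R]_N :=
  piece f mu (if fst_comp x <= 0 then symL else symR) x.

Definition rho f : 'rV[R]_N := e1^T *m \adj (1%:M - coef_L f).

Definition rho_b f : R := (rho f *m coef_b f) 0 0.

Variable n : nat.
Implicit Type S : n.-tuple symbol.

Fixpoint iterate f mu S x (i : nat) : 'cV[R]_N :=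
  match i with
  | 0 => x
  | i'.+1 => piece f mu (symb S i') (iterate f mu S x i')
  end.

(* A_{S_{n-1}} ... A_{S_i}, the identity when i = n. *)
Definition tail_prod f S (i : nat) : 'M[R]_N :=
  \big[@mulmx R N N N / 1%:M]_(j <- rev (index_iota i n)) coef f (symb S j).

Definition M_ f S : 'M[R]_N := tail_prod f S 0.

Definition P_ f S : 'M[R]_N := \sum_(1 <= i < n.+1) tail_prod f S i.

Definition is_cycle f mu S x : Prop :=
  (1%:M - M_ f S) *m x = mu *: (P_ f S *m coef_b f).

Definition is_admissible f mu S x : Prop :=
  forall i, (i < n)%N ->
    (fst_comp (iterate f mu S x i) < 0 -> symb S i = symL) /\
    (0 < fst_comp (iterate f mu S x i) -> symb S i = symR).

Definition has_admissible_cycle f mu S : Prop :=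
  exists x, is_cycle f mu S x /\ is_admissible f mu S x.

Definition nonsingular_cycle f S : Prop := 1%:M - M_ f S \in unitmx.

(* The unique solution of the n-cycle solution system; only meaningful when
   that system is nonsingular. *)
Definition cycle_point f mu S : 'cV[R]_N :=
  mu *: (invmx (1%:M - M_ f S) *m (P_ f S *m coef_b f)).

Definition cycle_s f mu S (i : nat) : R :=
  fst_comp (iterate f mu S (cycle_point f mu S) i).

Definition cycle_set f mu S : set 'cV[R]_N :=
  [set y | exists2 i, (i < n)%N & y = iterate f mu S (cycle_point f mu S) i].

Definition nonterminating_shrinking_point f mu S (l m d : nat) : Prop :=
  [/\ [/\ (2 <= N)%N, mu != 0 & rho_b f != 0],
      is_rotational S l m d /\ (1 < l < n.-1)%N,
      P_ f S \notin unitmx /\ P_ f (cyclic_shift S (l.-1 * d)) \notin unitmx,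
      nonsingular_cycle f (flip_at S 0) /\
      nonsingular_cycle f (flip_at S (l * d)) &
      is_admissible f mu (flip_at S 0) (cycle_point f mu (flip_at S 0))].

Definition terminating_shrinking_point f mu S (l m d : nat) : Prop :=
  [/\ (2 <= N)%N,
      [/\ is_rotational S l m d, l = n.-1 & (3 <= n)%N],
      1%:M - coef_L f \in unitmx /\
      mu * rho_b f / \det (1%:M - coef_L f) < 0,
      nonsingular_cycle f (flip_at S 0) &
      let A := map_mx (real_complex R) (coef_L f) in
      let theta : R := 2 * pi * m%:R / n%:R in
      eigenvalue A (Complex (cos theta) (sin theta)) /\
      eigenvalue A (Complex (cos theta) (- sin theta))].

End Cycles.

(* The continuity condition makes the choice of piece on the switching
   manifold irrelevant, and admissible cycles are orbits of the map. *)
Lemma piece_eq_on_switching (R : realType) (N : nat) (f : pwl_map R N) (mu : R)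
    (x : 'cV[R]_N) :
  fst_comp x = 0 -> piece f mu symL x = piece f mu symR x.
Proof.
case: N f x => [|N] f x; first by move=> _; apply/matrixP => -[].
rewrite /fst_comp !mxE big_ord_recl !mxE /= mul1r big1 ?addr0; last first.
  by move=> i _; rewrite !mxE /= mul0r.
move=> x0; rewrite /piece; congr (_ + _); apply/matrixP => i j.
rewrite !mxE; apply: eq_bigr => k _; have [k0|k0] := eqVneq (k : nat) 0%N.
  have -> : k = ord0 by apply: val_inj.
  by rewrite (ord1 j) x0 !mulr0.
by rewrite /= (coef_LR f i k0).
Qed.

Lemma admissible_iterate (R : realType) (N n : nat) (f : pwl_map R N) (mu : R)
    (S : n.-tuple symbol) (x : 'cV[R]_N) :
  is_admissible f mu S x -> forall i, (i < n)%N ->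
  iterate f mu S x i.+1 = pwl_eval f mu (iterate f mu S x i).
Proof.
move=> adm i /adm []; rewrite /pwl_eval /=.
set y := iterate _ _ _ _ _ => HL HR.
have [y0|y0|y0] := ltgtP (fst_comp y) 0.
- by rewrite HL.
- by rewrite HR.
- by case: (symb S i) => //; rewrite piece_eq_on_switching.
Qed.

(* At the parameter value q on the curve phi = 0, the S1- and S2-cycles of the
   family F undergo a border-collision fold bifurcation, both being admissible
   on the side phi > 0. *)
Definition border_collision_fold (R : realType) (N n : nat)
    (F : R^o * R^o -> pwl_map R N) (mu : R) (S1 S2 : n.-tuple symbol)
    (phi : R^o * R^o -> R) (q : R^o * R^o) : Prop :=
  let adm p S := is_admissible (F p) mu S (cycle_point (F p) mu S) in
  [/\ phi q = 0,
      \forall p \near q,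
        nonsingular_cycle (F p) S1 /\ nonsingular_cycle (F p) S2,
      [/\ adm q S1, adm q S2,
          cycle_set (F q) mu S1 = cycle_set (F q) mu S2 &
          exists2 x, cycle_set (F q) mu S1 x & fst_comp x = 0],
      \forall p \near q, 0 < phi p ->
        [/\ adm p S1, adm p S2 &
            cycle_set (F p) mu S1 <> cycle_set (F p) mu S2] &
      \forall p \near q, phi p < 0 -> ~ adm p S1 /\ ~ adm p S2].

(* In the region Psi, near the origin, the S- and S'-cycles are admissible, and
   they collide in border-collision folds on the boundary curves phi1 = 0 and
   phi2 = 0. The S-cycle system is singular at the origin, where the S-cycle is
   not unique and the two boundaries meet. *)
Definition admissible_with_folds (R : realType) (N n : nat)
    (F : R^o * R^o -> pwl_map R N) (mu : R) (S S' : n.-tuple symbol)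
    (phi1 phi2 : R^o * R^o -> R) : Prop :=
  let Psi p := 0 <= phi1 p /\ 0 <= phi2 p in
  \forall p \near (0 : R^o * R^o), Psi p ->
    [/\ has_admissible_cycle (F p) mu S,
        has_admissible_cycle (F p) mu S',
        nonsingular_cycle (F p) S' /\ (p <> 0 -> nonsingular_cycle (F p) S),
        p <> 0 -> phi1 p = 0 -> border_collision_fold F mu S S' phi1 p &
        p <> 0 -> phi2 p = 0 -> border_collision_fold F mu S S' phi2 p].

Definition smooth_family (R : realType) (N k : nat)
    (F : R^o * R^o -> pwl_map R N) : Prop :=
  forall i j : 'I_N,
    [/\ Ck_near k 0 (fun p : R^o * R^o => coef_b (F p) i 0),
        Ck_near k 0 (fun p : R^o * R^o => coef_L (F p) i j) &
        Ck_near k 0 (fun p : R^o * R^o => coef_R (F p) i j)].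

(* Main.v *)
(* Write [D_T = det (I - M_T)] and let [s^T_i] be the first components of the
   T-cycle. Flipping the j-th symbol of [T] changes the cycle by a multiple of a
   response [chi_i] depending smoothly on the parameters, and changes [I - M_T]
   by a matrix of rank one. If [S] is the flip of [T] at [j], this gives
   [s^S_i = s^T_i + s^S_j chi_i] and [D_S = D_T (1 - chi_j)], so that
   [D_S s^S_j = D_T s^T_j] stays regular although [D_S] vanishes at the shrinking
   point.

   For a rotational sequence the flips of [S] at [0] and at [(l-1)d] are shifts
   of each other, and so are the flips at [ld] and at [(n-1)d]. Let [t_i] be the
   first components of the cycle of the flip at [0]. The two resulting formulas
   for [D_S s^S_i], compared on the axes, yield the first-order terms of all the
   [D_S s^S_i], and in particular [k1 t_d = k2 t_{(l-1)d} = D_chk] at the origin.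
   With the signs of the [t_i] this gives admissibility on [Psi_1], the folds
   being the zeros of [t_0] and [t_{ld}].

   On the other side [D_hat s^hat_{ld} = D_S t_{ld} + D_chk t_0 chi_{ld}], and the
   implicit function theorem solves [s^hat_{ld} = 0] as [eta = g1(nu)]; there
   [D_S ~ k2 nu], so the right-hand side shows that [g1] is quadratic with a
   negative coefficient. Exchanging the axes gives [g2].

   If [l = n - 1] the point is terminating and [s^S_{ld}] is no longer controlled
   to first order: with [sigma] the first component of the fixed point of the
   left piece, [sigma D_S s^S_{ld} = sigma D_S (t_0 + t_{ld}) - D_chk t_0 t_{ld}].
   The orbit being a rotation of angle [2 pi m / n], one has [k1 = k2] and
   [t_d = 4 sin^2(pi/n) sigma], and the sign follows from
   [4 sin^2(pi/n) < 4] and [4 a b <= (a + b)^2]. *)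

Require Import Defs.
From mathcomp Require Import zify ring lra.

Set Implicit Arguments.
Unset Strict Implicit.
Unset Printing Implicit Defensive.

Local Open Scope classical_set_scope.
Local Open Scope ring_scope.

(** * Cycles and flips of symbols *)

(** The signs of the determinants decide which cycles meet where. If [S] and [T] differ at [j], then
    [D_S s^S_j = D_T s^T_j] with opposite letters at [j], so the two cycles are admissible on the
    same side of a collision exactly when [D_S D_T < 0]. As [k1] and [k2] have the same sign, [D_S]
    has the sign of [k1] on the first quadrant and of [- k1] on the third. Moreover [k1 D_chk < 0],
    and a comparison on the axis [nu = 0] gives [D_hat D_chk = - k1 k2 t_{(n-1)d} t_{(l+1)d} < 0].
    Hence [S] folds with the first flip near the first quadrant and with the second one inside the
    third.

    The [S]-cycle has different limits along the two axes, so its components cannot be expanded at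
    the origin. The identities for [D_S s^S_i] hold only where [D_S] is nonzero; their coefficients
    are obtained as limits along the punctured axes, where [D_S] is asymptotic to [k1 eta] or
    [k2 nu]. Off the axes it is enough to know expansions whose two coefficients have the same sign,
    since these fix the sign of a function on a whole closed quadrant. *)

Lemma det_sylvester (R : comNzRingType) m n (A : 'M[R]_(m, n)) (B : 'M[R]_(n, m)) :
  \det (1%:M + A *m B) = \det (1%:M + B *m A).
Proof.
(* Both determinants are Schur complements in this one block matrix, which factors in two ways. *)
have <- : \det (block_mx 1%:M (- A) B 1%:M) = \det (1%:M + A *m B).
  rewrite -[RHS](_ : \det (block_mx (1%:M + A *m B) (- A) 0 1%:M *m
                           block_mx 1%:M 0 B 1%:M) = _); last first.
    by rewrite det_mulmx det_ublock det_lblock !det1 !mulr1.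
  rewrite mulmx_block ?mulmx1 ?mul1mx ?mulmx0 ?mul0mx ?add0r ?addr0.
  by rewrite mulNmx addrK.
rewrite (_ : block_mx _ _ _ _ = block_mx 1%:M 0 B 1%:M *m
                        block_mx 1%:M (- A) 0 (1%:M + B *m A)).
  by rewrite det_mulmx det_ublock det_lblock !det1 !mul1r.
rewrite mulmx_block ?mulmx1 ?mul1mx ?mulmx0 ?mul0mx ?add0r ?addr0.
by rewrite mulmxN addrCA addNr addr0.
Qed.

Section Symbols.
Variable n : nat.
Implicit Type S : n.-tuple symbol.

Lemma symb_mod S i : symb S (i %% n) = symb S i.
Proof. by rewrite /symb modn_mod. Qed.

Lemma symb_eq S i j : (i = j %[mod n])%N -> symb S i = symb S j.
Proof. by rewrite /symb => ->. Qed.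

Lemma symb_tuple (g : nat -> symbol) i : (0 < n)%N ->
  symb [tuple g j | j < n] i = g (i %% n)%N.
Proof.
move=> n0; have lt_in := ltn_pmod i n0.
by rewrite /symb -(tnth_nth _ _ (Ordinal lt_in)) tnth_mktuple.
Qed.

Lemma symb_shift S k i : (0 < n)%N -> symb (cyclic_shift S k) i = symb S (k + i).
Proof. by move=> n0; rewrite (symb_tuple (fun j => symb S (k + j))) //; apply: symb_eq; rewrite modnDmr. Qed.

Lemma symb_flip S j i : (0 < n)%N ->
  symb (flip_at S j) i =
  if (i == j %[mod n])%N then flip_symbol (symb S i) else symb S i.
Proof.
by move=> n0; rewrite /flip_at (symb_tuple (fun i => if (i == j %[mod n])%N
  then flip_symbol (symb S i) else symb S i)) // modn_mod symb_mod.
Qed.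

Lemma symb_inj S T : (0 < n)%N ->
  (forall i, symb S i = symb T i) -> S = T.
Proof.
move=> n0 ST; apply: eq_from_tnth => i; rewrite !(tnth_nth symL).
by have := ST i; rewrite /symb modn_small.
Qed.

Lemma flip_symbolK : involutive flip_symbol.
Proof. by case. Qed.

Lemma flip_atK S j : (0 < n)%N -> flip_at (flip_at S j) j = S.
Proof.
move=> n0; apply: symb_inj => // i; rewrite !symb_flip //.
by case: eqP => // _; rewrite flip_symbolK.
Qed.

End Symbols.

(** * Orbits as forced linear recursions *)

Section Orbits.
Variables (R : realType) (N : nat) (f : pwl_map R N) (n : nat).
Implicit Types (S T : n.-tuple symbol) (g h : nat -> 'cV[R]_N) (x y : 'cV[R]_N).

(** With these signs the two clauses of admissibility merge into one weak inequality, and flipping a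
    letter is a change of sign. *)
Definition sgn_symb (a : symbol) : R := if a is symL then -1 else 1.

Lemma sgn_symb_flip a : sgn_symb (flip_symbol a) = - sgn_symb a.
Proof. by case: a; rewrite /= ?opprK. Qed.

(** Continuity of the map confines [coef_R f - coef_L f] to this column, so exchanging the two
    pieces moves the image along [jump] in proportion to the first component. *)
Definition jump : 'cV[R]_N := (coef_R f - coef_L f) *m e1 R N.

Lemma jumpE : coef_R f - coef_L f = jump *m (e1 R N)^T.
Proof.
apply/matrixP => i j; rewrite !mxE big_ord1 !mxE.
under eq_bigr do rewrite !mxE.
have [j0|j0] := eqVneq (nat_of_ord j) 0%N.
  rewrite mulr1 (bigD1 j) //= j0 eqxx mulr1 big1 ?addr0 // => k kj.
  have -> : (nat_of_ord k == 0%N) = false.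
    by apply/negbTE; apply: contraNneq kj => k0; apply/eqP/val_inj; rewrite /= k0 j0.
  by rewrite mulr0.
by rewrite (coef_LR f i j0) subrr mulr0.
Qed.

Lemma coef_flip a :
  coef f (flip_symbol a) = coef f a - sgn_symb a *: (jump *m (e1 R N)^T).
Proof.
by rewrite -jumpE; case: a; rewrite /= ?scaleN1r ?scale1r ?opprK;
  [rewrite addrC subrK | rewrite opprB addrC subrK].
Qed.

Lemma mul_jump_e1 x : jump *m (e1 R N)^T *m x = fst_comp x *: jump.
Proof.
rewrite -mulmxA /fst_comp [(e1 R N)^T *m x]mx11_scalar mul_mx_scalar.
by rewrite -mx11_scalar.
Qed.

Lemma fst_compD x y : fst_comp (x + y) = fst_comp x + fst_comp y.
Proof. by rewrite /fst_comp mulmxDr mxE. Qed.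

Lemma fst_compZ a x : fst_comp (a *: x) = a * fst_comp x.
Proof. by rewrite /fst_comp -scalemxAr mxE. Qed.

Lemma fst_compB x y : fst_comp (x - y) = fst_comp x - fst_comp y.
Proof. by rewrite -scaleN1r fst_compD fst_compZ mulN1r. Qed.

(** Orbits of the map are the case of constant forcing. Leaving the forcing free makes the orbit
    linear in the forcing and the initial point together, so that a flip can be treated as one more
    source term. *)
Fixpoint forced T g y (i : nat) : 'cV[R]_N :=
  if i is i'.+1 then g i' + coef f (symb T i') *m forced T g y i' else y.

Lemma iterate_forced mu T x i :
  iterate f mu T x i = forced T (fun=> mu *: coef_b f) x i.
Proof. by elim: i => //= i ->. Qed.

Lemma forced_lin T g h y x a i :
  forced T (fun k => g k + a *: h k) (y + a *: x) i =
  forced T g y i + a *: forced T h x i.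
Proof.
elim: i => //= i ->; rewrite mulmxDr scalerDr -scalemxAr.
by rewrite addrACA.
Qed.

Lemma eq_forced T g h y m :
  (forall i, (i < m)%N -> g i = h i) -> forced T g y m = forced T h y m.
Proof.
elim: m => //= m IH gh; rewrite gh // IH // => i im.
by apply: gh; apply: leqW.
Qed.

Lemma eq_forced_symb T S g y m :
  (forall i, (i < m)%N -> symb T i = symb S i) -> forced T g y m = forced S g y m.
Proof.
elim: m => //= m IH gh; rewrite gh // IH // => i im.
by apply: gh; apply: leqW.
Qed.

(** [tail_prod] with a free upper end, which allows induction on the length. *)
Definition prod_coef T (a b : nat) : 'M[R]_N :=
  \big[@mulmx R N N N / 1%:M]_(j <- rev (index_iota a b)) coef f (symb T j).

Lemma prod_coefxx T a : prod_coef T a a = 1%:M.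
Proof. by rewrite /prod_coef /index_iota subnn big_nil. Qed.

Lemma prod_coefS T a b : (a <= b)%N ->
  prod_coef T a b.+1 = coef f (symb T b) *m prod_coef T a b.
Proof.
move=> ab; rewrite /prod_coef /index_iota subSn // -addn1 iotaD rev_cat.
by rewrite subnKC //= big_cons.
Qed.

Lemma forcedE T g y m :
  forced T g y m =
  prod_coef T 0 m *m y + \sum_(i < m) prod_coef T i.+1 m *m g i.
Proof.
elim: m => [|m IH] /=; first by rewrite prod_coefxx mul1mx big_ord0 addr0.
rewrite IH big_ord_recr /= prod_coefxx mul1mx mulmxDr mulmxA -prod_coefS //.
rewrite addrCA; congr (_ + _); rewrite addrC; congr (_ + _).
rewrite mulmx_sumr; apply: eq_bigr => i _.
by rewrite mulmxA prod_coefS.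
Qed.

Lemma forced_M T g y : forced T g y n = M_ f T *m y + forced T g 0 n.
Proof. by rewrite !forcedE mulmx0 add0r. Qed.

Lemma iterate_P mu T x :
  iterate f mu T x n = M_ f T *m x + mu *: (P_ f T *m coef_b f).
Proof.
rewrite iterate_forced forced_M; congr (_ + _).
rewrite forcedE mulmx0 add0r /P_ big_add1 /= big_mkord mulmx_suml scaler_sumr.
by apply: eq_bigr => i _; rewrite -scalemxAr.
Qed.

Lemma is_cycleE mu T x : is_cycle f mu T x <-> iterate f mu T x n = x.
Proof.
rewrite /is_cycle iterate_P mulmxBl mul1mx; split=> [<-|h].
  by rewrite addrC subrK.
by rewrite -{1}h addrAC subrr add0r.
Qed.

Lemma nonsingular_det T : nonsingular_cycle f T <-> \det (1%:M - M_ f T) != 0.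
Proof. by rewrite /nonsingular_cycle unitmxE unitfE. Qed.

Lemma cycle_pointP mu T : nonsingular_cycle f T ->
  is_cycle f mu T (cycle_point f mu T).
Proof.
by move=> nsT; rewrite /is_cycle /cycle_point -scalemxAr mulKVmx.
Qed.

Lemma cycle_point_unique mu T x : nonsingular_cycle f T ->
  is_cycle f mu T x -> x = cycle_point f mu T.
Proof.
by move=> nsT; rewrite /is_cycle /cycle_point => h; rewrite scalemxAr -h mulKmx.
Qed.

Lemma cycle_point_iterate mu T : nonsingular_cycle f T ->
  iterate f mu T (cycle_point f mu T) n = cycle_point f mu T.
Proof. by move=> /(cycle_pointP mu) /is_cycleE. Qed.

Lemma iterate_addn mu T x i :
  iterate f mu T x n = x -> iterate f mu T x (n + i) = iterate f mu T x i.
Proof.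
move=> xn; elim: i => [|i IH]; first by rewrite addn0.
by rewrite addnS /= IH; congr piece; apply: symb_eq; rewrite modnDl.
Qed.

Lemma iterate_mod mu T x i :
  iterate f mu T x n = x -> iterate f mu T x (i %% n) = iterate f mu T x i.
Proof.
move=> xn; rewrite [in RHS](divn_eq i n); elim: (i %/ n)%N => [|k IH].
  by rewrite mul0n add0n.
by rewrite mulSn -addnA iterate_addn.
Qed.

Lemma cycle_s_mod mu T i : nonsingular_cycle f T ->
  cycle_s f mu T (i %% n) = cycle_s f mu T i.
Proof. by move=> nsT; rewrite /cycle_s iterate_mod // cycle_point_iterate. Qed.

Lemma cycle_s_eq mu T i j : nonsingular_cycle f T -> (i = j %[mod n])%N ->
  cycle_s f mu T i = cycle_s f mu T j.
Proof. by move=> nsT ij; rewrite -cycle_s_mod // ij cycle_s_mod. Qed.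

Lemma is_admissibleP mu T x : is_admissible f mu T x <->
  forall i, (i < n)%N ->
  0 <= sgn_symb (symb T i) * fst_comp (iterate f mu T x i).
Proof.
split=> adm i /adm.
  case: (symb T i) => -[hL hR] /=.
    by rewrite mulN1r oppr_ge0 leNgt; apply/negP => /hR.
  by rewrite mul1r leNgt; apply/negP => /hL.
by case: (symb T i) => /=; rewrite ?mulN1r ?mul1r ?oppr_ge0 => h;
  split=> // h'; move: (lt_le_trans h' h); rewrite ltxx.
Qed.

End Orbits.

(** * Invariance under cyclic shifts *)

Section Shift.
Variables (R : realType) (N : nat) (f : pwl_map R N) (n : nat) (n0 : (0 < n)%N).
Variables (mu : R) (S : n.-tuple symbol).

Lemma iterate_shift x k i :
  iterate f mu (cyclic_shift S k) (iterate f mu S x k) i =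
  iterate f mu S x (k + i).
Proof.
elim: i => [|i IH]; first by rewrite addn0.
by rewrite /= IH symb_shift // addnS.
Qed.

(** A shift carries the first factor of the product to the other end, and
    [det (1 - X Y) = det (1 - Y X)]. *)
Lemma det_M_shift1 (T : n.-tuple symbol) :
  \det (1%:M - M_ f (cyclic_shift T 1)) = \det (1%:M - M_ f T).
Proof.
have prodS (m : nat) : prod_coef f T 0 m.+1 = prod_coef f T 1 m.+1 *m coef f (symb T 0).
  elim: m => [|m IH]; first by rewrite prod_coefS // !prod_coefxx mulmx1 mul1mx.
  by rewrite prod_coefS // IH mulmxA -prod_coefS.
have prodSh (m : nat) : prod_coef f (cyclic_shift T 1) 0 m = prod_coef f T 1 m.+1.
  elim: m => [|m IH]; first by rewrite !prod_coefxx.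
  by rewrite prod_coefS // IH symb_shift // -prod_coefS.
have := prodSh n; have := prodS n.-1; rewrite !prednK // => hM hS.
rewrite /M_ /tail_prod -!/(prod_coef _ _ _ _) hM hS prod_coefS //.
have -> : symb T n = symb T 0 by apply: symb_eq; rewrite modnn mod0n.
by rewrite -mulmxN det_sylvester mulNmx.
Qed.

Lemma det_M_shift k : \det (1%:M - M_ f (cyclic_shift S k)) = \det (1%:M - M_ f S).
Proof.
elim: k => [|k <-]; last rewrite -(det_M_shift1 (cyclic_shift S k)).
  congr (\det (1%:M - M_ f _)); apply: symb_inj => // i.
  by rewrite symb_shift.
congr (\det (1%:M - M_ f _)); apply: symb_inj => // i.
by rewrite !symb_shift // addSn add1n addnS.
Qed.

Lemma nonsingular_shift k :
  nonsingular_cycle f (cyclic_shift S k) <-> nonsingular_cycle f S.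
Proof. by rewrite !nonsingular_det det_M_shift. Qed.

Lemma cycle_point_shift k : nonsingular_cycle f S ->
  cycle_point f mu (cyclic_shift S k) =
  iterate f mu S (cycle_point f mu S) k.
Proof.
move=> nsS; symmetry; apply: cycle_point_unique.
  by apply/nonsingular_shift.
apply/is_cycleE; rewrite iterate_shift addnC iterate_addn //.
exact: cycle_point_iterate.
Qed.

Lemma cycle_s_shift k i : nonsingular_cycle f S ->
  cycle_s f mu (cyclic_shift S k) i = cycle_s f mu S (k + i).
Proof. by move=> nsS; rewrite /cycle_s cycle_point_shift // iterate_shift. Qed.

Lemma is_admissible_cycleP : nonsingular_cycle f S ->
  is_admissible f mu S (cycle_point f mu S) <->
  forall i, 0 <= sgn_symb R (symb S i) * cycle_s f mu S i.
Proof.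
move=> nsS; split=> [/is_admissibleP adm i|h]; last first.
  by apply/is_admissibleP => i _; apply: h.
rewrite -cycle_s_mod // -symb_mod; apply: adm.
by rewrite ltn_mod.
Qed.

Lemma cycle_set_shift k : nonsingular_cycle f S ->
  cycle_set f mu (cyclic_shift S k) = cycle_set f mu S.
Proof.
move=> nsS; have per := cycle_point_iterate mu nsS.
rewrite /cycle_set cycle_point_shift //; apply/seteqP; split=> y /= [i lt_in ->].
  exists ((k + i) %% n)%N; first by rewrite ltn_mod.
  by rewrite iterate_shift iterate_mod.
(* Adding [k * n.-1] undoes the shift by [k] modulo [n]. *)
exists ((i + k * n.-1) %% n)%N; first by rewrite ltn_mod.
rewrite iterate_shift -[LHS](iterate_mod _ per) -[RHS](iterate_mod _ per).
congr iterate; rewrite modnDmr addnCA -mulnS prednK //.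
by rewrite addnC modnMDl.
Qed.

End Shift.

(** * Flipping one symbol *)

Section Flip.
Variables (R : realType) (N : nat) (f : pwl_map R N) (n : nat) (n0 : (0 < n)%N).
Variable (mu : R).
Implicit Types S T : n.-tuple symbol.

(* Flipping the [j]-th symbol of [T] amounts to forcing the orbit, at times
   congruent to [j], by this vector times the [j]-th first component. *)
Definition impulse T (j i : nat) : 'cV[R]_N :=
  if (i == j %[mod n])%N then - sgn_symb R (symb T j) *: jump f else 0.

(** Initial point of the periodic orbit of the linear recursion driven by the impulse alone;
    [forced_resp] is its periodicity. *)
Definition resp_point T j : 'cV[R]_N :=
  invmx (1%:M - M_ f T) *m forced f T (impulse T j) 0 n.

Definition resp T j i : R :=
  fst_comp (forced f T (impulse T j) (resp_point T j) (i %% n)).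

(** Within one period the pieces are exchanged only at time [j %% n], and their difference sees only
    the first component there. Hence a single number, read off the flipped orbit itself, multiplies
    the impulse. *)
Lemma forced_flip T j g y i : (i <= n)%N ->
  forced f (flip_at T j) g y i =
  forced f T (fun k => g k +
    fst_comp (forced f (flip_at T j) g y (j %% n)) *: impulse T j k) y i.
Proof.
elim: i => //= i IH lt_in; rewrite -IH 1?ltnW // -addrA; congr (_ + _).
rewrite symb_flip // /impulse; case: ifP => ij; last by rewrite scaler0 add0r.
rewrite coef_flip mulmxBl addrC; congr (_ + _).
rewrite -scalemxAl mul_jump_e1 scalerA mulrC -scalerA scaleNr.
by rewrite scalerN -(eqP ij) modn_small // (symb_eq T (eqP ij)).
Qed.

Lemma impulse_flip T j k : (j != k %[mod n])%N ->
  impulse (flip_at T j) k =1 impulse T k.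
Proof.
by rewrite eq_sym => /negbTE jk i; rewrite /impulse symb_flip // jk.
Qed.

Lemma forced_resp T j : nonsingular_cycle f T ->
  forced f T (impulse T j) (resp_point T j) n = resp_point T j.
Proof.
move=> nsT; rewrite forced_M.
have : (1%:M - M_ f T) *m resp_point T j = forced f T (impulse T j) 0 n.
  by rewrite /resp_point mulKVmx.
by rewrite mulmxBl mul1mx => <-; rewrite addrC subrK.
Qed.

Lemma forced_unique T g x y : nonsingular_cycle f T ->
  forced f T g x n = x -> forced f T g y n = y -> x = y.
Proof.
move=> nsT; rewrite [forced f T g x n]forced_M [forced f T g y n]forced_M => gx gy.
have eqQ z : M_ f T *m z + forced f T g 0 n = z ->
    z = invmx (1%:M - M_ f T) *m forced f T g 0 n.
  by move=> gz; rewrite -[LHS](mulKmx nsT) mulmxBl mul1mx -{1}gz addrAC subrr add0r.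
by rewrite (eqQ _ gx) (eqQ _ gy).
Qed.

(** The multiplier of the response is taken from the flipped orbit itself, so uniqueness for [T]
    settles the matter for any cycle [x] of [S]. *)
Lemma flip_orbit T j S x : nonsingular_cycle f T -> S = flip_at T j ->
  is_cycle f mu S x -> forall i, (i < n)%N ->
  fst_comp (iterate f mu S x i) =
  cycle_s f mu T i + fst_comp (iterate f mu S x (j %% n)) * resp T j i.
Proof.
move=> nsT -> /is_cycleE; rewrite !iterate_forced forced_flip //.
set s := fst_comp _ => xn i lt_in.
have xE : x = cycle_point f mu T + s *: resp_point T j.
  apply: (forced_unique nsT xn).
  by rewrite forced_lin -iterate_forced cycle_point_iterate // forced_resp.
rewrite iterate_forced forced_flip 1?ltnW // -/s xE forced_lin.
by rewrite fst_compD fst_compZ -iterate_forced /resp modn_small.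
Qed.

Lemma cycle_s_flip T j i :
  nonsingular_cycle f T -> nonsingular_cycle f (flip_at T j) ->
  cycle_s f mu (flip_at T j) i =
  cycle_s f mu T i + cycle_s f mu (flip_at T j) j * resp T j i.
Proof.
move=> nsT nsS; have respE : resp T j i = resp T j (i %% n).
  by rewrite /resp modn_mod.
rewrite -(cycle_s_mod mu i nsS) -(cycle_s_mod mu i nsT) respE.
rewrite -(cycle_s_mod mu j nsS) /cycle_s.
rewrite (flip_orbit nsT (erefl _)) ?ltn_mod //.
exact: cycle_pointP.
Qed.

(** Meant for a doubly flipped sequence whose cycle is known explicitly: the constant sequence L and
    its fixed point. As the positions differ, the flip at [j] leaves the impulse at [k]
    unchanged. *)
Lemma flip2_orbit T j k S x : nonsingular_cycle f T -> (j != k %[mod n])%N ->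
  S = flip_at (flip_at T j) k -> is_cycle f mu S x -> forall i, (i < n)%N ->
  fst_comp (iterate f mu S x i) =
  cycle_s f mu T i + fst_comp (iterate f mu S x (j %% n)) * resp T j i
                   + fst_comp (iterate f mu S x (k %% n)) * resp T k i.
Proof.
move=> nsT jk -> /is_cycleE.
have E i : (i <= n)%N -> forced f (flip_at (flip_at T j) k)
      (fun=> mu *: coef_b f) x i = forced f T (fun l => (mu *: coef_b f +
      fst_comp (iterate f mu (flip_at (flip_at T j) k) x (j %% n)) *: impulse T j l)
      + fst_comp (iterate f mu (flip_at (flip_at T j) k) x (k %% n)) *: impulse T k l) x i.
  have E' m : (m <= n)%N -> forced f (flip_at T j) (fun l => mu *: coef_b f +
        fst_comp (iterate f mu (flip_at (flip_at T j) k) x (k %% n)) *: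
        impulse (flip_at T j) k l) x m =
      iterate f mu (flip_at (flip_at T j) k) x m.
    by move=> le_mn; rewrite !iterate_forced [RHS]forced_flip.
  move=> le_in; rewrite -iterate_forced -E' // forced_flip // E' 1?ltnW ?ltn_mod //.
  apply: eq_forced => l _; rewrite impulse_flip // addrAC; congr (_ + _ *: _ + _).
set s := fst_comp _; set t := fst_comp _ => xn i lt_in.
move: E; rewrite -/s -/t => E; rewrite iterate_forced E // in xn.
have xE : x = (cycle_point f mu T + s *: resp_point T j) + t *: resp_point T k.
  apply: (forced_unique nsT xn).
  by rewrite !forced_lin -iterate_forced cycle_point_iterate // !forced_resp.
rewrite iterate_forced E 1?ltnW // {1}xE !forced_lin !fst_compD !fst_compZ.
by rewrite -iterate_forced /resp modn_small.
Qed.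

(** The flipped product is [M_ f T + u *m h]: the row [h] reads the first component at time [j], and
    the column [u] is what the impulse has become after one period. [det_sylvester] then reduces the
    extra factor to a scalar. *)
Lemma det_flip T j : nonsingular_cycle f T ->
  \det (1%:M - M_ f (flip_at T j)) = \det (1%:M - M_ f T) * (1 - resp T j j).
Proof.
move=> nsT; pose j' := (j %% n)%N; have lt_jn : (j' < n)%N by rewrite ltn_mod.
have before i : (i < j')%N -> (i == j %[mod n])%N = false.
  move=> ij; apply/negbTE; rewrite modn_small ?(ltn_trans ij) //.
  by rewrite neq_ltn ij.
pose h := (e1 R N)^T *m prod_coef f T 0 j'.
pose u := forced f T (impulse T j) 0 n.
have forced0 (T' : n.-tuple symbol) y m : forced f T' (fun=> 0) y m = prod_coef f T' 0 m *m y.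
  by rewrite forcedE big1 ?addr0 // => i _; rewrite mulmx0.
have MS : M_ f (flip_at T j) = M_ f T + u *m h.
  apply/trmx_inj/row_matrixP => i; apply: trmx_inj; rewrite -!tr_col !trmxK.
  rewrite !colE; set y := delta_mx _ _.
  transitivity (forced f (flip_at T j) (fun=> 0) y n).
    by rewrite forced0.
  have hy : forced f (flip_at T j) (fun=> 0) y j' = prod_coef f T 0 j' *m y.
    rewrite (@eq_forced_symb _ _ _ _ _ T) ?forced0 //.
    by move=> k /before kj; rewrite symb_flip // kj.
  rewrite forced_flip // -/j' hy; set s := fst_comp _.
  transitivity (forced f T (fun=> 0) y n + s *: u).
    by rewrite /u -forced_lin scaler0 addr0.
  rewrite forced0 mulmxDl.
  congr (_ + _); rewrite -mulmxA [h *m y]mx11_scalar mul_mx_scalar.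
  by rewrite /s /fst_comp mulmxA.
rewrite MS opprD addrA.
have -> : 1%:M - M_ f T - u *m h =
    (1%:M - M_ f T) *m (1%:M + resp_point T j *m (- h)).
  by rewrite mulmxDr mulmx1 /resp_point -/u !mulmxA (mulmxV nsT) mul1mx mulmxN /h ?mulmxA.
rewrite det_mulmx det_sylvester; congr (_ * _).
rewrite mulNmx [X in \det X]mx11_scalar det_scalar1 mxE [X in _ + X]mxE.
rewrite [X in X + _]mxE; congr (1 - _).
(* The impulse has not acted before time [j'], so up to there the response is the bare product
   applied to [resp_point]. *)
rewrite /resp -/j' (@eq_forced _ _ _ _ _ _ (fun=> 0)); last first.
  by move=> i /before; rewrite /impulse => ->.
by rewrite forced0 /fst_comp mulmxA.
Qed.

Lemma det_cycle_s_flip T j :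
  nonsingular_cycle f T -> nonsingular_cycle f (flip_at T j) ->
  \det (1%:M - M_ f (flip_at T j)) * cycle_s f mu (flip_at T j) j =
  \det (1%:M - M_ f T) * cycle_s f mu T j.
Proof.
move=> nsT nsS; rewrite det_flip // -mulrA; congr (_ * _).
by rewrite mulrBl mul1r {1}(cycle_s_flip j nsT nsS); ring.
Qed.

(** On the switching manifold a flip is invisible, because the multiplier of the impulse is zero. *)
Lemma iterate_flip0 T j x i : fst_comp (iterate f mu T x (j %% n)) = 0 ->
  (i <= n)%N -> iterate f mu (flip_at T j) x i = iterate f mu T x i.
Proof.
move=> xj le_in; rewrite [LHS]iterate_forced [RHS]iterate_forced.
rewrite -[T in RHS](flip_atK T j n0) [RHS]forced_flip // flip_atK //.
rewrite -[forced f T _ _ _]iterate_forced xj; apply: eq_forced => k _.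
by rewrite scale0r addr0.
Qed.

End Flip.

(** * Rotational symbol sequences *)

Section Rotational.
Variables (n : nat) (S : n.-tuple symbol) (l m d : nat).
Hypothesis rotS : is_rotational S l m d.

Lemma rot_gt0 : (0 < n)%N.
Proof. by case: rotS => /(leq_ltn_trans (leq0n _)). Qed.

Lemma rot_inv : (d * m = 1 %[mod n])%N.
Proof. by case: rotS. Qed.

(** [d] is a unit modulo [n], so positions can be listed as [0, d, 2d, ...], an order in which the
    letters of [S] form two blocks. *)
Lemma rot_index i : exists2 j, (j < n)%N & (i = j * d %[mod n])%N.
Proof.
exists (i * m %% n)%N; first by rewrite ltn_mod rot_gt0.
by rewrite modnMml -mulnA (mulnC m) -modnMmr rot_inv modnMmr muln1.
Qed.

Lemma rot_eq i j : (i * d == j * d %[mod n])%N = (i == j %[mod n])%N.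
Proof.
apply/idP/idP => /eqP ij; apply/eqP; last by rewrite -modnMml ij modnMml.
have h k : (k = k * d * m %[mod n])%N.
  by rewrite -mulnA -modnMmr rot_inv modnMmr muln1.
by rewrite (h i) (h j) -modnMml ij modnMml.
Qed.

Lemma rot_eq_lt i j : (i < n)%N -> (j < n)%N ->
  (i * d == j * d %[mod n])%N = (i == j).
Proof. by move=> lt_in lt_jn; rewrite rot_eq !modn_small. Qed.

Lemma symb_rot j : (j < n)%N -> symb S (j * d) = if (j < l)%N then symL else symR.
Proof.
case: rotS => _ _ _ _ /(_ j) [hL hR] lt_jn.
by case: ltnP => jl; [apply: hL | apply: hR; rewrite jl].
Qed.

Lemma rot_ext (T T' : n.-tuple symbol) :
  (forall j, (j < n)%N -> symb T (j * d) = symb T' (j * d)) -> T = T'.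
Proof.
move=> TT'; apply: (symb_inj rot_gt0) => i.
have [j lt_jn ij] := rot_index i.
by rewrite (symb_eq T ij) (symb_eq T' ij) TT'.
Qed.

Lemma rot_succ j : (d + j * d = j.+1 * d %[mod n])%N.
Proof. by rewrite mulSn. Qed.

Lemma rot_last : (d + n.-1 * d = 0 %[mod n])%N.
Proof. by rewrite -mulSn prednK ?rot_gt0 // modnMr mod0n. Qed.

(** In the order of the multiples of [d], removing the first or the last letter from the block of L
    leaves two blocks of equal length, one step apart. *)
Lemma flip_rot_shift0 : (1 < l)%N ->
  flip_at S (l.-1 * d) = cyclic_shift (flip_at S 0) d.
Proof.
move=> l1; have n0 := rot_gt0; case: (rotS) => ln _ _ _ _.
apply: rot_ext => j lt_jn; rewrite symb_shift // !symb_flip //.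
rewrite rot_eq_lt //; last by apply: leq_ltn_trans ln; apply: leq_pred.
have [->|jn] := eqVneq j n.-1.
  rewrite rot_last eqxx (symb_eq S rot_last) -[0%N](mul0n d).
  rewrite !symb_rot ?ltn_predL // (ltnW l1).
  have -> : (n.-1 < l)%N = false by apply/negbTE; lia.
  by have -> : (n.-1 == l.-1)%N = false by apply/negbTE; lia.
have lt_j1n : (j.+1 < n)%N by lia.
rewrite (symb_eq S (rot_succ j)) (_ : 0%N = 0 * d)%N // rot_succ rot_eq_lt //=.
rewrite !symb_rot //; case: eqVneq => [->|jl]; case: ltnP => ?; case: ltnP => ? //=; exfalso; lia.
Qed.

(** Here the block of L is lengthened by one letter, at its end or just before its beginning; the
    position before [0] is [n.-1]. *)
Lemma flip_rot_shiftl : (l < n.-1)%N ->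
  flip_at S (n.-1 * d) = cyclic_shift (flip_at S (l * d)) d.
Proof.
move=> l1; have n0 := rot_gt0; case: (rotS) => ln _ _ _ _.
apply: rot_ext => j lt_jn; rewrite symb_shift // !symb_flip //.
rewrite rot_eq_lt //; last lia.
have [->|jn] := eqVneq j n.-1.
  rewrite (symb_eq S rot_last) rot_last -[0%N](mul0n d) !symb_rot ?ltn_predL //=.
  rewrite rot_eq_lt //.
  have -> : (n.-1 < l)%N = false by apply/negbTE; lia.
  by case: (l).
have lt_j1n : (j.+1 < n)%N by lia.
rewrite (symb_eq S (rot_succ j)) rot_succ rot_eq_lt //=.
rewrite !symb_rot //; case: eqVneq => [<-|?]; rewrite ?ltnSn ?ltnn ?leqnn //=.
by congr (if _ then _ else _); apply/idP/idP; lia.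
Qed.

End Rotational.

(** * Border-collision folds read off from signs *)

Section Folds.
Variables (R : realType) (N n : nat) (n0 : (0 < n)%N).
Implicit Types (f : pwl_map R N) (S T : n.-tuple symbol) (mu : R).

Lemma sum_periodic (g : nat -> nat) k : (forall i, g (i %% n)%N = g i) ->
  (\sum_(i < n) g (k + i) = \sum_(i < n) g i)%N.
Proof.
move=> per; elim: k => [|k <-]; first by apply: eq_bigr => i _; rewrite add0n.
case: n n0 per => // n' _ per.
rewrite big_ord_recr [RHS]big_ord_recl /= addnC addn0; congr (_ + _)%N.
  by rewrite addSnnS -per modnDr per.
by apply: eq_bigr => i _; rewrite addSnnS.
Qed.

(** A shift preserves the number of letters L, a flip changes it by one. *)
Lemma flip_not_shift S j k :
  ~ (forall i, symb S i = symb (flip_at S j) (k + i)).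
Proof.
move=> eqS; pose isL (a : symbol) : nat := if a is symL then 1%N else 0%N.
have : (\sum_(i < n) isL (symb S i) = \sum_(i < n) isL (symb (flip_at S j) i))%N.
  rewrite -(sum_periodic k (g := fun i => isL (symb (flip_at S j) i))).
    by apply: eq_bigr => i _; rewrite eqS.
  by move=> i; rewrite symb_mod.
have lt_jn : (j %% n < n)%N by rewrite ltn_mod.
rewrite (bigD1 (Ordinal lt_jn)) // [RHS](bigD1 (Ordinal lt_jn)) //=.
rewrite [X in _ = (_ + X)%N -> _](eq_bigr (fun i : 'I_n => isL (symb S i))).
  by move/addIn; rewrite symb_flip // modn_mod eqxx; case: (symb S _).
move=> i; rewrite -val_eqE /= symb_flip // => /negbTE ij.
by rewrite (modn_small (ltn_ord i)) ij.
Qed.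

(** If the sets agreed, the first point of one cycle would be the [k]-th point of the other. Strict
    signs then force equal letters, hence equal next points, and by induction [S] would be a shift
    of its own flip. *)
Lemma cycle_set_neq f mu S j :
  (forall i, 0 < sgn_symb R (symb S i) * cycle_s f mu S i) ->
  (forall i, 0 <= sgn_symb R (symb (flip_at S j) i) * cycle_s f mu (flip_at S j) i) ->
  cycle_set f mu S <> cycle_set f mu (flip_at S j).
Proof.
move=> posS posT eqST.
have : cycle_set f mu (flip_at S j) (cycle_point f mu S).
  by rewrite -eqST; exists 0%N.
move=> [k _ xk]; apply: (@flip_not_shift S j k).
have sym i : iterate f mu S (cycle_point f mu S) i =
      iterate f mu (flip_at S j) (cycle_point f mu (flip_at S j)) (k + i) ->
    symb S i = symb (flip_at S j) (k + i).
  move=> eqi; have := posS i; have := posT (k + i)%N.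
  rewrite /cycle_s -eqi.
  by case: (symb S i); case: (symb (flip_at S j) (k + i)) => //= h1 h2;
    exfalso; clear -h1 h2; lra.
move=> i; apply: (sym); elim: i => [|i IH]; first by rewrite addn0.
by rewrite addnS /= -(sym i IH) -IH.
Qed.

Lemma det_lt0_nonsingular f S T :
  \det (1%:M - M_ f S) * \det (1%:M - M_ f T) < 0 ->
  nonsingular_cycle f S /\ nonsingular_cycle f T.
Proof.
move=> DD; split; apply/nonsingular_det; apply: contraTneq DD => ->;
  by rewrite ?mul0r ?mulr0 ltxx.
Qed.

(** The letters at [j] are opposite and so are the signs of the determinants; the two changes of
    sign cancel in [det_cycle_s_flip]. This distinguishes a fold from a crossing at which one cycle
    replaces the other. *)
Lemma sgn_cycle_s_flip f mu S j :
  \det (1%:M - M_ f S) * \det (1%:M - M_ f (flip_at S j)) < 0 ->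
  Num.sg (sgn_symb R (symb S j) * cycle_s f mu S j) =
  Num.sg (sgn_symb R (symb (flip_at S j) j) * cycle_s f mu (flip_at S j) j).
Proof.
set T := flip_at S j => DD; have [nsS nsT] := det_lt0_nonsingular DD.
have := det_cycle_s_flip n0 mu (T := T) (j := j) nsT.
rewrite flip_atK // => /(_ nsS); move: DD (nsS) => + /nonsingular_det.
move: (\det (_ - M_ f S)) (\det (_ - M_ f T)) => DS DT DD DS0 eqD.
have symTj : symb T j = flip_symbol (symb S j) by rewrite symb_flip // eqxx.
have : DS * (sgn_symb R (symb S j) * cycle_s f mu S j) =
       - DT * (sgn_symb R (symb T j) * cycle_s f mu T j).
  by rewrite symTj sgn_symb_flip mulrCA eqD; ring.
move/(congr1 (fun z => Num.sg DS * Num.sg z)).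
rewrite sgrM [in RHS]sgrM sgrN mulrA -expr2 sqr_sg DS0 mul1r => ->.
by rewrite mulrA mulrN -sgrM ltr0_sg // opprK mul1r.
Qed.

Variables (F : R^o * R^o -> pwl_map R N) (mu : R) (S : n.-tuple symbol) (j : nat).
Let T := flip_at S j.
Let D (T : n.-tuple symbol) p := \det (1%:M - M_ (F p) T).

(** One index carries the collision, and the signs at all others are strict even on the curve. On
    the curve the [j]-th point of the [T]-cycle lies on the switching manifold, so this cycle is an
    [S]-cycle as well. *)
Lemma fold_of_signs (phi : R^o * R^o -> R) q :
  (\forall p \near q, D S p * D T p < 0) ->
  phi q = 0 ->
  (\forall p \near q, Num.sg (sgn_symb R (symb T j) * cycle_s (F p) mu T j) =
                      Num.sg (phi p)) ->
  (\forall p \near q, 0 <= phi p -> forall i, (i != j %[mod n])%N ->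
     0 < sgn_symb R (symb S i) * cycle_s (F p) mu S i /\
     0 < sgn_symb R (symb T i) * cycle_s (F p) mu T i) ->
  border_collision_fold F mu S T phi q.
Proof.
move=> nearD phiq nearT nearpos.
have ns p : D S p * D T p < 0 ->
    nonsingular_cycle (F p) S /\ nonsingular_cycle (F p) T.
  exact: det_lt0_nonsingular.
have sgS p : D S p * D T p < 0 ->
    Num.sg (sgn_symb R (symb T j) * cycle_s (F p) mu T j) = Num.sg (phi p) ->
    Num.sg (sgn_symb R (symb S j) * cycle_s (F p) mu S j) = Num.sg (phi p).
  by move=> DD <-; apply: sgn_cycle_s_flip.
have admP p i : (i == j %[mod n])%N -> D S p * D T p < 0 ->
    [/\ cycle_s (F p) mu S i = cycle_s (F p) mu S j,
     cycle_s (F p) mu T i = cycle_s (F p) mu T j,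
     symb S i = symb S j & symb T i = symb T j].
  move=> /eqP ij DD; have [nsS nsT] := ns p DD.
  by rewrite (cycle_s_eq mu nsS ij) (cycle_s_eq mu nsT ij) (symb_eq S ij) (symb_eq T ij).
have adm p : 0 <= phi p -> D S p * D T p < 0 ->
    Num.sg (sgn_symb R (symb T j) * cycle_s (F p) mu T j) = Num.sg (phi p) ->
    (forall i, (i != j %[mod n])%N ->
     0 < sgn_symb R (symb S i) * cycle_s (F p) mu S i /\
     0 < sgn_symb R (symb T i) * cycle_s (F p) mu T i) ->
    (forall i, 0 <= sgn_symb R (symb S i) * cycle_s (F p) mu S i) /\
    (forall i, 0 <= sgn_symb R (symb T i) * cycle_s (F p) mu T i).
  move=> phip DD sgT pos; have sgSp := sgS p DD sgT.
  split=> i; have [ij|/pos[]] := boolP (i == j %[mod n])%N; try by move=> *; apply: ltW.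
    by have [-> _ -> _] := admP p i ij DD; rewrite -sgr_ge0 sgSp sgr_ge0.
  by have [_ -> _ ->] := admP p i ij DD; rewrite -sgr_ge0 sgT sgr_ge0.
have Dq := nbhs_singleton nearD; have sgTq := nbhs_singleton nearT.
have posq := nbhs_singleton nearpos; have [nsSq nsTq] := ns q Dq.
split=> //.
- by apply: filterS nearD => p; apply: ns.
- have [||admS admT] := adm q _ Dq sgTq; first by rewrite phiq.
    by apply: posq; rewrite phiq.
  have Tq0 : cycle_s (F q) mu T j = 0.
    move: sgTq; rewrite phiq sgr0 => /eqP; rewrite sgr_eq0 mulf_eq0.
    by case: (symb T j); rewrite /= ?oppr_eq0 oner_eq0 /= => /eqP.
  have it i : (i <= n)%N -> iterate (F q) mu S (cycle_point (F q) mu T) i =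
              iterate (F q) mu T (cycle_point (F q) mu T) i.
    move=> le_in; rewrite -{1}(flip_atK S j n0) -/T iterate_flip0 //.
    by rewrite -Tq0 -(cycle_s_mod mu j nsTq).
  have cpE : cycle_point (F q) mu T = cycle_point (F q) mu S.
    apply: cycle_point_unique => //; apply/is_cycleE; rewrite it //.
    exact: cycle_point_iterate.
  split; [by apply/is_admissible_cycleP|by apply/is_admissible_cycleP| |].
  + rewrite /cycle_set -cpE; apply/seteqP; split=> y /= [i lt_in ->].
      by exists i => //; rewrite it // ltnW.
    by exists i => //; rewrite it // ltnW.
  + exists (iterate (F q) mu S (cycle_point (F q) mu S) (j %% n)).
      by exists (j %% n)%N => //; rewrite ltn_mod.
    rewrite -cpE it; last by rewrite ltnW // ltn_mod.
    by rewrite -Tq0 -(cycle_s_mod mu j nsTq).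
- apply: filterS3 nearD nearT nearpos => p DD sgT pos phip.
  have [admS admT] := adm p (ltW phip) DD sgT (pos (ltW phip)).
  have [nsS nsT] := ns p DD.
  split; [by apply/is_admissible_cycleP|by apply/is_admissible_cycleP|].
  apply: cycle_set_neq => // i.
  have [ij|ij] := boolP (i == j %[mod n])%N; last by have [] := pos (ltW phip) i ij.
  by have [-> _ -> _] := admP p i ij DD; rewrite -sgr_gt0 sgS // sgr_gt0.
- apply: filterS2 nearD nearT => p DD sgT phip.
  have [nsS nsT] := ns p DD; have sgSp := sgS p DD sgT.
  split=> /(is_admissible_cycleP n0 mu) - /(_ _)/(_ j).
    by move=> /(_ nsS); rewrite -sgr_ge0 sgSp sgr_ge0 leNgt phip.
  by move=> /(_ nsT); rewrite -sgr_ge0 sgT sgr_ge0 leNgt phip.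
Qed.

(** Needed because the second flip of [S] yields only a shift of the sequence with which it
    collides. *)
Lemma fold_shift (S' : n.-tuple symbol) k phi q :
  border_collision_fold F mu S (cyclic_shift S' k) phi q ->
  border_collision_fold F mu S S' phi q.
Proof.
have adms p : nonsingular_cycle (F p) S' ->
   is_admissible (F p) mu (cyclic_shift S' k) (cycle_point (F p) mu (cyclic_shift S' k)) <->
   is_admissible (F p) mu S' (cycle_point (F p) mu S').
  move=> ns; have ns' : nonsingular_cycle (F p) (cyclic_shift S' k).
    by apply/nonsingular_shift.
  rewrite !is_admissible_cycleP //; split=> h i; last first.
    by rewrite symb_shift // cycle_s_shift.
  have := h (i + k * n.-1)%N.
  rewrite symb_shift // cycle_s_shift //.
  have e : (k + (i + k * n.-1) = i %[mod n])%N.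
    by rewrite addnCA -mulnS prednK // addnC modnMDl.
  by rewrite (symb_eq _ e) (cycle_s_eq mu ns e).
move=> [phiq nsq [admS admT csq zero] pos neg].
have ns0 : \forall p \near q, nonsingular_cycle (F p) S'.
  by apply: filterS nsq => p [_ /nonsingular_shift]; apply.
have ns0q := nbhs_singleton ns0.
split=> //.
- by apply: filterS2 nsq ns0 => p [].
- split=> //; first by apply/adms.
  by rewrite csq cycle_set_shift.
- apply: filterS2 pos ns0 => p + nsp phip => /(_ phip)[].
  by rewrite cycle_set_shift // adms.
- apply: filterS2 neg ns0 => p + nsp phip => /(_ phip)[].
  by rewrite adms.
Qed.

End Folds.

Lemma near_gt0 (R : realType) (V : topologicalType) (f : V -> R^o) p :
  {for p, continuous f} -> 0 < f p -> \forall q \near p, 0 < f q.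
Proof.
by move=> cf fp; apply: (cf [set z | 0 < z]); apply: open_nbhs_nbhs; split=> //;
  apply: open_gt.
Qed.

Lemma near_lt0 (R : realType) (V : topologicalType) (f : V -> R^o) p :
  {for p, continuous f} -> f p < 0 -> \forall q \near p, f q < 0.
Proof.
by move=> cf fp; apply: (cf [set z | z < 0]); apply: open_nbhs_nbhs; split=> //;
  apply: open_lt.
Qed.

Section FoldRegion.
Variables (R : realType) (N n : nat) (n0 : (0 < n)%N).
Variables (F : R^o * R^o -> pwl_map R N) (mu : R) (S : n.-tuple symbol) (j : nat).
Let D (T : n.-tuple symbol) p := \det (1%:M - M_ (F p) T).
Variables (S' : n.-tuple symbol) (d b : nat).
Hypothesis (flipj : flip_at S j = S') (flipb : flip_at S b = cyclic_shift S' d).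
Hypothesis jb : (j != b %[mod n])%N.
Variables phi1 phi2 : R^o * R^o -> R.

(* [S] differs from [S'] by its [j]-th symbol, and from a shift of [S'] by its
   [b]-th one: the first flip gives the fold on [phi1 = 0], the second one that
   on [phi2 = 0]. *)
Lemma admissible_with_folds_of_signs :
  phi1 0 = 0 -> phi2 0 = 0 ->
  (\forall p \near (0 : R^o * R^o), [/\ {for p, continuous (D S : _ -> R^o)},
     {for p, continuous (D S' : _ -> R^o)}, {for p, continuous (phi1 : _ -> R^o)}
     & {for p, continuous (phi2 : _ -> R^o)}]) ->
  (\forall p \near (0 : R^o * R^o), D S' p != 0) ->
  (\forall p \near (0 : R^o * R^o), 0 <= phi1 p -> 0 <= phi2 p -> p != 0 ->
     D S p * D S' p < 0 /\
     forall i, (i != j %[mod n])%N -> (i != b %[mod n])%N ->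
     0 < sgn_symb R (symb S i) * cycle_s (F p) mu S i) ->
  (\forall p \near (0 : R^o * R^o),
     forall i, (i != j %[mod n])%N -> (i != d + b %[mod n])%N ->
     0 < sgn_symb R (symb S' i) * cycle_s (F p) mu S' i) ->
  (\forall p \near (0 : R^o * R^o),
     Num.sg (sgn_symb R (symb S' j) * cycle_s (F p) mu S' j) = Num.sg (phi1 p) /\
     Num.sg (sgn_symb R (symb S' (d + b)) * cycle_s (F p) mu S' (d + b)) =
     Num.sg (phi2 p)) ->
  (\forall p \near (0 : R^o * R^o), p != 0 ->
     (phi1 p = 0 -> 0 <= phi2 p -> 0 < phi2 p) /\
     (phi2 p = 0 -> 0 <= phi1 p -> 0 < phi1 p)) ->
  admissible_with_folds F mu S S' phi1 phi2.
Proof.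
move=> phi10 phi20 cont nD' signS signS' signjb corner.
pose W := cyclic_shift S' d.
have DW p : D W p = D S' p by rewrite /D det_M_shift.
have sgTi p i : D S' p != 0 ->
    sgn_symb R (symb W i) * cycle_s (F p) mu W i =
    sgn_symb R (symb S' (d + i)) * cycle_s (F p) mu S' (d + i).
  by move=> /nonsingular_det ns'; rewrite symb_shift // cycle_s_shift.
have nbj (i : nat) : (d + i == d + b %[mod n])%N = (i == b %[mod n])%N by rewrite eqn_modDl.
have cong p (V : n.-tuple symbol) i k : D V p != 0 -> (i == k %[mod n])%N ->
    sgn_symb R (symb V i) * cycle_s (F p) mu V i =
    sgn_symb R (symb V k) * cycle_s (F p) mu V k.
  by move=> /nonsingular_det ns' /eqP e; rewrite (symb_eq _ e) (cycle_s_eq mu ns' e).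
have ne0 p : D S p * D S' p < 0 -> D S p != 0.
  by move=> DD; apply: contraTneq DD => ->; rewrite mul0r ltxx.
pose good p := [/\ D S' p != 0, (0 <= phi1 p -> 0 <= phi2 p -> p != 0 ->
     D S p * D S' p < 0 /\
     forall i, (i != j %[mod n])%N -> (i != b %[mod n])%N ->
     0 < sgn_symb R (symb S i) * cycle_s (F p) mu S i),
   (forall i, (i != j %[mod n])%N -> (i != d + b %[mod n])%N ->
     0 < sgn_symb R (symb S' i) * cycle_s (F p) mu S' i) &
   Num.sg (sgn_symb R (symb S' j) * cycle_s (F p) mu S' j) = Num.sg (phi1 p) /\
     Num.sg (sgn_symb R (symb S' (d + b)) * cycle_s (F p) mu S' (d + b)) =
     Num.sg (phi2 p)].
have nearg : \forall p \near (0 : R^o * R^o), good p.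
  by near=> p; split; near: p.
have sgSj p : good p -> D S p * D S' p < 0 ->
    Num.sg (sgn_symb R (symb S j) * cycle_s (F p) mu S j) = Num.sg (phi1 p).
  by move=> [_ _ _ [<- _]] DD; rewrite -flipj; apply: (sgn_cycle_s_flip n0); rewrite flipj.
have sgSb p : good p -> D S p * D S' p < 0 ->
    Num.sg (sgn_symb R (symb S b) * cycle_s (F p) mu S b) = Num.sg (phi2 p).
  move=> [ns' _ _ [_ <-]] DD; rewrite -sgTi // /W -flipb; apply: (sgn_cycle_s_flip n0).
  by rewrite flipb -/W -/(D S p) -/(D W p) DW.
have admS' p : good p -> 0 <= phi1 p -> 0 <= phi2 p ->
    forall i, 0 <= sgn_symb R (symb S' i) * cycle_s (F p) mu S' i.
  move=> [ns' _ pos [s1 s2]] p1 p2 i.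
  have [ij|ij] := boolP (i == j %[mod n])%N.
    by rewrite (cong _ _ _ _ ns' ij) -sgr_ge0 s1 sgr_ge0.
  have [ib|ib] := boolP (i == d + b %[mod n])%N.
    by rewrite (cong _ _ _ _ ns' ib) -sgr_ge0 s2 sgr_ge0.
  by apply: ltW; apply: pos.
have strict p : good p -> 0 <= phi1 p -> 0 <= phi2 p -> p != 0 ->
    D S p * D S' p < 0 /\
    ((0 < phi2 p -> forall i, (i != j %[mod n])%N ->
      0 < sgn_symb R (symb S i) * cycle_s (F p) mu S i /\
      0 < sgn_symb R (symb S' i) * cycle_s (F p) mu S' i) /\
     (0 < phi1 p -> forall i, (i != b %[mod n])%N ->
      0 < sgn_symb R (symb S i) * cycle_s (F p) mu S i /\
      0 < sgn_symb R (symb W i) * cycle_s (F p) mu W i)).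
  move=> gp p1 p2 pn0; have [ns' posS pos [s1 s2]] := gp.
  have [DD {}posS] := posS p1 p2 pn0; split=> //; have nsS := ne0 _ DD.
  split=> ph i ij; split.
  - have [ib|ib] := boolP (i == b %[mod n])%N; last by apply: posS.
    by rewrite (cong _ _ _ _ nsS ib) -sgr_gt0 sgSb // sgr_gt0.
  - have [ib|ib] := boolP (i == d + b %[mod n])%N; last by apply: pos.
    by rewrite (cong _ _ _ _ ns' ib) -sgr_gt0 s2 sgr_gt0.
  - have [ib|ib] := boolP (i == j %[mod n])%N; last by apply: posS.
    by rewrite (cong _ _ _ _ nsS ib) -sgr_gt0 sgSj // sgr_gt0.
  - rewrite sgTi //; have [ib|ib] := boolP (d + i == j %[mod n])%N.
      by rewrite (cong _ _ _ _ ns' ib) -sgr_gt0 s1 sgr_gt0.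
    by apply: pos => //; rewrite nbj.
rewrite /admissible_with_folds.
(* A fold at [q] is a statement about a neighbourhood of [q], so the sign data must hold around
   every [q] close to the origin. *)
have nearg2 := near_join nearg.
near=> q => -[q1 q2].
have gq : good q by near: q.
have gqn : \forall p \near q, good p by near: q.
have [cS cS' c1 c2] : [/\ {for q, continuous (D S : _ -> R^o)},
     {for q, continuous (D S' : _ -> R^o)}, {for q, continuous (phi1 : _ -> R^o)}
     & {for q, continuous (phi2 : _ -> R^o)}] by near: q.
have cor : q != 0 ->
     (phi1 q = 0 -> 0 <= phi2 q -> 0 < phi2 q) /\
     (phi2 q = 0 -> 0 <= phi1 q -> 0 < phi1 q) by near: q.
have [ns' posS pos [s1 s2]] := gq; have admq := admS' q gq q1 q2.
have nsq' : nonsingular_cycle (F q) S' by apply/nonsingular_det.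
have nearDD : q != 0 -> \forall p \near q, D S p * D S' p < 0.
  move=> qn0; have [DD _] := posS q1 q2 qn0.
  by apply: (near_lt0 (f := fun p => D S p * D S' p)) => //; apply: cvgM.
have nzphi (phi : R^o * R^o -> R) p : phi 0 = 0 -> 0 < phi p -> p != 0.
  by move=> ph0 php; apply: contraTneq php => ->; rewrite ph0 ltxx.
split.
- have [->|qn0] := eqVneq q 0; last first.
    have [DD posSq] := posS q1 q2 qn0.
    have nsS : nonsingular_cycle (F q) S by apply/nonsingular_det/ne0.
    exists (cycle_point (F q) mu S); split; first exact: cycle_pointP.
    apply/is_admissible_cycleP => // i.
    have [ij|ij] := boolP (i == j %[mod n])%N.
      by rewrite (cong _ _ _ _ (ne0 _ DD) ij) -sgr_ge0 sgSj // sgr_ge0.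
    have [ib|ib] := boolP (i == b %[mod n])%N.
      by rewrite (cong _ _ _ _ (ne0 _ DD) ib) -sgr_ge0 sgSb // sgr_ge0.
    by apply: ltW; apply: posSq.
  (* At the origin the [S]-cycle is not unique; the [S']-cycle serves, since its [j]-th point lies
     on the switching manifold. *)
  have g0 := nbhs_singleton nearg; have [ns0 _ _ [s10 _]] := g0.
  have nsc : nonsingular_cycle (F 0) S' by apply/nonsingular_det.
  have s0 : cycle_s (F 0) mu S' j = 0.
    move: s10; rewrite phi10 sgr0 => /eqP; rewrite sgr_eq0 mulf_eq0.
    by case: (symb S' j); rewrite /= ?oppr_eq0 oner_eq0 /= => /eqP.
  have it i : (i <= n)%N -> iterate (F 0) mu S (cycle_point (F 0) mu S') i =
              iterate (F 0) mu S' (cycle_point (F 0) mu S') i.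
    move=> le_in; rewrite -{1}(flip_atK S j n0) flipj iterate_flip0 //.
    by rewrite -s0 -(cycle_s_mod mu j nsc).
  exists (cycle_point (F 0) mu S'); split.
    by apply/is_cycleE; rewrite it // cycle_point_iterate.
  apply/is_admissibleP => i lt_in; rewrite it ?(ltnW lt_in) // -/(cycle_s _ _ _ _).
  have [ij|ij] := boolP (i == j %[mod n])%N.
    by rewrite (cycle_s_eq mu nsc (eqP ij)) s0 mulr0.
  have -> : symb S i = symb S' i by rewrite -flipj symb_flip // (negbTE ij).
  by apply: admS' => //; rewrite ?phi10 ?phi20.
- exists (cycle_point (F q) mu S'); split; first exact: cycle_pointP.
  exact/is_admissible_cycleP.
- split=> // /eqP qn0; apply/nonsingular_det.
  by have [/ne0] := posS q1 q2 qn0.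
- move=> /eqP qn0 q10; have phi2q := (cor qn0).1 q10 q2.
  rewrite -flipj; apply: (fold_of_signs n0); rewrite ?flipj //.
  + exact: nearDD.
  + by apply: filterS gqn => p [_ _ _ []].
  + apply: filterS2 gqn (near_gt0 c2 phi2q) => p gp php p1.
    by have [_ [+ _]] := strict p gp p1 (ltW php) (nzphi _ _ phi20 php); apply.
- move=> /eqP qn0 q20; have phi1q := (cor qn0).2 q20 q1.
  apply: (fold_shift n0 (k := d)); rewrite -flipb; apply: (fold_of_signs n0); rewrite ?flipb //.
  + by apply: filterS (nearDD qn0) => p; rewrite -(DW p).
  + by apply: filterS gqn => p [ns _ _ []]; rewrite -/W sgTi.
  + apply: filterS2 gqn (near_gt0 c1 phi1q) => p gp php p2.
    by have [_ [_ +]] := strict p gp (ltW php) p2 (nzphi _ _ phi10 php); apply.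
Unshelve. all: by end_near.
Qed.

End FoldRegion.

(** * Functions of class C^k *)

Section Ck.
Variables (R : realType).
Implicit Types (V : normedModType R) (k : nat).

Lemma nbhs_eq_derive V (U : set V) (f g : V -> R^o) v p : open U -> U p ->
  {in U, f =1 g} -> 'D_v f p = 'D_v g p.
Proof.
move=> oU Up fg; have [->|v0] := eqVneq v 0; first by rewrite !derive0.
apply: near_eq_derive => //; have : nbhs p U by apply: open_nbhs_nbhs.
by apply: filterS => q Uq; apply: fg; rewrite inE.
Qed.

Lemma nbhs_eq_differentiable V (U : set V) (f g : V -> R^o) p : open U -> U p ->
  {in U, f =1 g} -> differentiable f p -> differentiable g p.
Proof.
move=> oU Up fg df; have nU : nbhs p U by apply: open_nbhs_nbhs.
have /diffP [dfc dfE] := df; apply/diffP => /=.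
(* The differential is a chosen value: it has the required property as soon as some linear map has
   it, here ['d f p]. *)
apply: (@getPex _ (fun (dg : {linear V -> R^o}) => continuous dg /\
  forall y, g y = g (lim (nbhs p)) + dg (y - lim (nbhs p))
                  +o_(y \near p) (y - lim (nbhs p)))).
exists ('d f p); split=> //.
have {}dfE : f = cst (f (lim (nbhs p))) + 'd f p \o center (lim (nbhs p))
    +o_p (center (lim (nbhs p))) by rewrite funeqE; exact: dfE.
suff : g = cst (g (lim (nbhs p))) + 'd f p \o center (lim (nbhs p))
    +o_p (center (lim (nbhs p))) by rewrite funeqE.
move: dfE; rewrite !lim_id // => /eqaddoP dfE; apply/eqaddoP => eps eps0.
have /= := dfE eps eps0; apply: filterS2 nU => y Uy.
by rewrite !fctE /= !fg ?inE.
Qed.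

Lemma Ck_on_eq V k (U : set V) (f g : V -> R^o) : open U ->
  {in U, f =1 g} -> Ck_on k U f -> Ck_on k U g.
Proof.
move=> oU; elim: k f g => [|k IH] f g fg /=.
  move=> cf p Up; have nU : \forall q \near p, f q = g q.
    have : nbhs p U by apply: open_nbhs_nbhs.
    by apply: filterS => q Uq; apply: fg; rewrite inE.
  rewrite /prop_for /continuous_at -(nbhs_singleton nU).
  by apply: cvg_trans (cf p Up); apply: near_eq_cvg.
move=> [df Df]; split=> [p Up|v].
  exact: nbhs_eq_differentiable oU Up fg (df p Up).
apply: IH (Df v) => p; rewrite inE => Up.
exact: nbhs_eq_derive oU Up fg.
Qed.

Lemma Ck_on_sub V k (U W : set V) (f : V -> R^o) :
  W `<=` U -> Ck_on k U f -> Ck_on k W f.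
Proof.
move=> WU; elim: k f => [|k IH] f /=; first by move=> cf p /WU; apply: cf.
by move=> [df Df]; split=> [p /WU|v]; [apply: df | apply: IH].
Qed.

Lemma Ck_onW V k (U : set V) (f : V -> R^o) : Ck_on k.+1 U f -> Ck_on k U f.
Proof.
elim: k f => [|k IH] f [df Df].
  by move=> p Up; apply: differentiable_continuous; apply: df.
by split=> // v; apply: IH.
Qed.

Lemma Ck_on_le V j k (U : set V) (f : V -> R^o) : (j <= k)%N ->
  Ck_on k U f -> Ck_on j U f.
Proof.
elim: k => [|k IH]; first by rewrite leqn0 => /eqP ->.
by rewrite leq_eqVlt => /predU1P[-> //|jk] /Ck_onW; apply: IH.
Qed.

Lemma Ck_on_continuous V k (U : set V) (f : V -> R^o) p : Ck_on k U f -> U p ->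
  {for p, continuous f}.
Proof. by move=> /(Ck_on_le (leq0n k)) cf; apply: cf. Qed.

Lemma Ck_on_cst V k (U : set V) (c : R^o) : Ck_on k U (fun=> c).
Proof.
elim: k c => [|k IH] c /=; first by move=> p _; apply: cst_continuous.
split=> [p _|v]; first exact: differentiable_cst.
rewrite (_ : 'D_v _ = fun=> 0) //.
by apply/funext => p; apply: derive_cst.
Qed.

Lemma Ck_onU V k (U W : set V) (f : V -> R^o) :
  Ck_on k U f -> Ck_on k W f -> Ck_on k (U `|` W) f.
Proof.
elim: k f => [|k IH] f /=.
  by move=> cU cW p [/cU|/cW].
by move=> [dU DU] [dW DW]; split=> [p [/dU|/dW]//|v]; apply: IH.
Qed.

Section Ops.
Variables (V : normedModType R) (U : set V).
Hypothesis oU : open U.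
Implicit Types f g : V -> R^o.

Lemma Ck_onD k f g : Ck_on k U f -> Ck_on k U g ->
  Ck_on k U (fun p => f p + g p).
Proof.
elim: k f g => [|k IH] f g /=.
  by move=> cf cg p Up; apply: cvgD; [apply: cf|apply: cg].
move=> [df Df] [dg Dg]; split=> [p Up|v].
  by apply: differentiableD; [apply: df|apply: dg].
apply: (Ck_on_eq oU) (IH _ _ (Df v) (Dg v)) => p; rewrite inE => Up.
by rewrite deriveD //; apply: diff_derivable; [apply: df|apply: dg].
Qed.

Lemma Ck_onM k f g : Ck_on k U f -> Ck_on k U g ->
  Ck_on k U (fun p => f p * g p).
Proof.
elim: k f g => [|k IH] f g /=.
  by move=> cf cg p Up; apply: cvgM; [apply: cf|apply: cg].
move=> Cf Cg; have [df Df] := Cf; have [dg Dg] := Cg; split=> [p Up|v].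
  by apply: differentiableM; [apply: df|apply: dg].
apply: (Ck_on_eq oU _ (Ck_onD (IH _ _ (Ck_onW Cf) (Dg v))
                              (IH _ _ (Ck_onW Cg) (Df v)))) => p; rewrite inE => Up.
by rewrite deriveM //; apply: diff_derivable; [apply: df|apply: dg].
Qed.

Lemma Ck_onN k f : Ck_on k U f -> Ck_on k U (fun p => - f p).
Proof.
move=> Cf; apply: (Ck_on_eq oU _ (Ck_onM (Ck_on_cst k U (-1)) Cf)) => p _.
by rewrite mulN1r.
Qed.

Lemma Ck_onV k f : (forall p, U p -> f p != 0) -> Ck_on k U f ->
  Ck_on k U (fun p => (f p)^-1).
Proof.
move=> f0; elim: k => [|k IH] /=.
  by move=> cf p Up; apply: cvgV; [apply: f0|apply: cf].
move=> Cf; have [df Df] := Cf; split=> [p Up|v].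
  by apply: differentiableV; [apply: df|apply: f0].
have CV := IH (Ck_onW Cf).
apply: (Ck_on_eq oU _ (Ck_onN (Ck_onM (Ck_onM CV CV) (Df v)))) => p; rewrite inE => Up.
rewrite deriveV ?f0 //; last by apply: diff_derivable; apply: df.
by rewrite scaleNr /= -exprVn expr2.
Qed.

Lemma Ck_on_sum k (I : Type) (r : seq I) (P : pred I) (f : I -> V -> R^o) :
  (forall i, P i -> Ck_on k U (f i)) ->
  Ck_on k U (fun p => \sum_(i <- r | P i) f i p).
Proof.
move=> Cf; elim: r => [|i r IH].
  apply: (Ck_on_eq oU _ (Ck_on_cst k U 0)) => p _; by rewrite big_nil.
have [Pi|Pi] := boolP (P i).
  by apply: (Ck_on_eq oU _ (Ck_onD (Cf i Pi) IH)) => p _; rewrite big_cons Pi.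
by apply: (Ck_on_eq oU _ IH) => p _; rewrite big_cons (negbTE Pi).
Qed.

Lemma Ck_on_prod k (I : Type) (r : seq I) (P : pred I) (f : I -> V -> R^o) :
  (forall i, P i -> Ck_on k U (f i)) ->
  Ck_on k U (fun p => \prod_(i <- r | P i) (f i p : R)).
Proof.
move=> Cf; elim: r => [|i r IH].
  apply: (Ck_on_eq oU _ (Ck_on_cst k U 1)) => p _; by rewrite big_nil.
have [Pi|Pi] := boolP (P i).
  by apply: (Ck_on_eq oU _ (Ck_onM (Cf i Pi) IH)) => p _; rewrite big_cons Pi.
by apply: (Ck_on_eq oU _ IH) => p _; rewrite big_cons (negbTE Pi).
Qed.

Lemma continuous_pair (g1 g2 : V -> R^o) p : {for p, continuous g1} ->
  {for p, continuous g2} -> {for p, continuous (fun x => (g1 x, g2 x))}.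
Proof.
move=> c1 c2; rewrite /prop_for /continuous_at.
exact: (@cvg_pair _ _ _ (nbhs p) (nbhs (g1 p)) (nbhs (g2 p)) _ _ _ g1 g2 c1 c2).
Qed.

(** The induction runs over all [h] at once: by the chain rule a derivative of the composite
    involves the partial derivatives of [h] composed with the same inner functions. *)
Lemma Ck_on_comp2 k (g1 g2 : V -> R^o) (W : set (R^o * R^o)) (h : R^o * R^o -> R^o) :
  Ck_on k U g1 -> Ck_on k U g2 -> Ck_on k W h ->
  (forall p, U p -> W (g1 p, g2 p)) -> Ck_on k U (fun p => h (g1 p, g2 p)).
Proof.
move=> + + + UW; elim: k g1 g2 h UW => [|k IH] g1 g2 h UW /=.
  move=> c1 c2 ch p Up.
  apply: (@continuous_comp _ _ _ (fun p => (g1 p, g2 p)) h).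
    by apply: continuous_pair; [apply: c1|apply: c2].
  exact: (ch _ (UW p Up)).
move=> C1 C2 Ch; have [d1 D1] := C1; have [d2 D2] := C2; have [dh Dh] := Ch.
have dp p : U p -> differentiable (fun p => (g1 p, g2 p)) p.
  by move=> Up; apply: differentiable_pair; [apply: d1|apply: d2].
split=> [p Up|v].
  apply: (@differentiable_comp _ _ _ _ (fun p => (g1 p, g2 p)) h); first exact: dp.
  exact: (dh _ (UW p Up)).
have IH' u := IH g1 g2 _ UW (Ck_onW C1) (Ck_onW C2) (Dh u).
apply: (Ck_on_eq oU _ (Ck_onD (Ck_onM (D1 v) (IH' (1, 0)))
                              (Ck_onM (D2 v) (IH' (0, 1))))) => p; rewrite inE => Up.
have dcomp : differentiable (fun p => h (g1 p, g2 p)) p.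
  apply: (@differentiable_comp _ _ _ _ (fun p => (g1 p, g2 p)) h); first exact: dp.
  exact: (dh _ (UW p Up)).
have dgp := dp p Up; have dhp := dh _ (UW p Up); have d1p := d1 p Up; have d2p := d2 p Up.
rewrite [RHS]deriveE // (@diff_comp _ _ _ _ (fun p => (g1 p, g2 p)) h) //=.
rewrite diff_pair // !deriveE //=.
rewrite (_ : ('d g1 p v, 'd g2 p v) = ('d g1 p v : R) *: (1, 0) + ('d g2 p v : R) *: ((0, 1) : R^o * R^o)).
  by rewrite linearD !linearZ.
by congr pair => /=; rewrite /GRing.scale /= ?mulr1 ?mulr0 ?addr0 ?add0r.
Qed.

End Ops.

End Ck.

Section Slices.
Variables (R : realType) (Phi : R^o * R^o -> R^o).

Lemma is_derive_slice1 (x y : R^o) : differentiable Phi (x, y) ->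
  is_derive x 1 (fun t : R^o => Phi (t, y)) ('D_(1, 0) Phi (x, y)).
Proof.
move=> dPhi; have := @diff_derivable _ _ _ Phi (x, y) (1, 0) dPhi.
rewrite /derivable /derive.
have -> : (fun h : R => h^-1 *: ((Phi \o shift (x, y)) (h *: ((1, 0) : R^o * R^o)) - Phi (x, y))) =
   (fun h : R => h^-1 *: (((fun t : R^o => Phi (t, y)) \o shift x) (h *: 1) - Phi (x, y))).
  apply/funext => h; congr (_ *: (Phi _ - _)).
  by congr pair => /=; rewrite scaler0 add0r.
by move=> dx; split.
Qed.

Lemma is_derive_slice2 (x y : R^o) : differentiable Phi (x, y) ->
  is_derive y 1 (fun t : R^o => Phi (x, t)) ('D_(0, 1) Phi (x, y)).
Proof.
move=> dPhi; have := @diff_derivable _ _ _ Phi (x, y) (0, 1) dPhi.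
rewrite /derivable /derive.
have -> : (fun h : R => h^-1 *: ((Phi \o shift (x, y)) (h *: ((0, 1) : R^o * R^o)) - Phi (x, y))) =
   (fun h : R => h^-1 *: (((fun t : R^o => Phi (x, t)) \o shift y) (h *: 1) - Phi (x, y))).
  apply/funext => h; congr (_ *: (Phi _ - _)).
  by congr pair => /=; rewrite scaler0 add0r.
by move=> dx; split.
Qed.

(** The bound on [xi - x1] makes the mean value point converge to [x1] when [x2] does, which is used
    to differentiate the implicit function. *)
Lemma mvt_slice1 (a x1 x2 y : R) :
  (forall x, `|x| <= a -> differentiable Phi (x, y)) ->
  `|x1| <= a -> `|x2| <= a -> exists xi : R, [/\ `|xi| <= a, `|xi - x1| <= `|x2 - x1| &
    Phi (x2, y) - Phi (x1, y) = 'D_(1, 0) Phi (xi, y) * (x2 - x1)].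
Proof.
move=> dPhi.
have mvt (u v : R) : u < v -> `|u| <= a -> `|v| <= a -> exists2 xi, u <= xi <= v &
    Phi (v, y) - Phi (u, y) = 'D_(1, 0) Phi (xi, y) * (v - u).
  move=> uv ua va.
  have der x : u <= x <= v ->
      is_derive x 1 (fun t : R^o => Phi (t, y)) ('D_(1, 0) Phi (x, y)).
    move=> xuv; apply: is_derive_slice1; apply: dPhi.
    by move: xuv ua va; rewrite !ler_norml; lra.
  have [||c] := @MVT R (fun t => Phi (t, y)) (fun t => 'D_(1, 0) Phi (t, y)) u v uv.
  - by move=> x; rewrite in_itv /= => /andP[ux xv]; apply: der; rewrite !ltW.
  - apply: derivable_within_continuous => x; rewrite in_itv /= => xuv.
    exact: (@ex_derive _ _ _ _ _ _ _ (der x xuv)).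
  rewrite in_itv /= => /andP[uc cv] eqc; exists c => //.
  by rewrite !ltW.
move=> x1a x2a; have [x12|x21|<-] := ltgtP x1 x2; last first.
- by exists x1; split => //; rewrite ?subrr ?mulr0.
- have [xi xi12 eqxi] := mvt _ _ x21 x2a x1a; exists xi; split.
  + by move: xi12 x1a x2a; rewrite !ler_norml; lra.
  + by move: xi12; rewrite (@ltr0_norm _ (x2 - x1)) ?subr_lt0 // ler_norml; lra.
  + by rewrite -opprB eqxi -mulrN opprB.
- have [xi xi12 eqxi] := mvt _ _ x12 x1a x2a; exists xi; split => //.
  + by move: xi12 x1a x2a; rewrite !ler_norml; lra.
  + by move: xi12; rewrite (@gtr0_norm _ (x2 - x1)) ?subr_gt0 // ler_norml; lra.
Qed.

End Slices.

Lemma near0_box (R : realType) (P : R^o * R^o -> Prop) :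
  (\forall p \near (0 : R^o * R^o), P p) ->
  exists2 a : R, 0 < a & forall x y : R^o, `|x| <= a -> `|y| <= a -> P (x, y).
Proof.
move=> /nbhs_norm0P[e /= e0 he]; exists (e / 2); first by rewrite divr_gt0.
move=> x y xe ye; apply: he; rewrite /= prod_normE /= gt_max.
by rewrite !(le_lt_trans xe, le_lt_trans ye) // gtr_pMr // invf_lt1 // ltr1n.
Qed.

Lemma derive_line (R : realType) (g : R^o -> R^o) (v y : R^o) :
  derivable g y 1 -> 'D_v g y = v * 'D_1 g y.
Proof.
move=> /derivable1_diffP dg; rewrite !deriveE //.
by rewrite -{1}[v]mulr1 -[v * 1]/(v *: (1 : R^o)) linearZ.
Qed.

Lemma Ck_on_linear (R : realType) (V : normedModType R) k (U : set V)
    (f : {linear V -> R^o}) : continuous f -> Ck_on k U f.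
Proof.
move=> cf; have df p : differentiable f p by apply: linear_differentiable.
case: k => [|k]; first by move=> p _; apply: cf.
split=> // v; rewrite (_ : 'D_v f = fun=> f v); first exact: Ck_on_cst.
by apply/funext => p; rewrite deriveE ?diff_lin.
Qed.

Lemma Ck_on_id (R : realType) k (U : set R^o) : Ck_on k U (fun x : R^o => x).
Proof. by apply: (Ck_on_linear (f := (idfun : {linear R^o -> R^o})) k U) => x; apply: cvg_id. Qed.

(** * The implicit function theorem for one scalar equation *)

Section IFT.
Variables (R : realType) (Phi : R^o * R^o -> R^o) (U : set (R^o * R^o)) (k : nat).
Hypothesis (oU : open U) (U0 : U 0) (CPhi : Ck_on k.+1 U Phi).
Hypothesis (Phi0 : Phi 0 = 0) (dPhi0 : 0 < 'D_(1, 0) Phi 0).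

(** On a small box [Phi] increases in its first variable, so its sign is that of [x - g y]. This
    gives existence, uniqueness and continuity of [g], and it is the form in which the fold
    criterion uses the curve. *)
Lemma implicit_function : exists (b : R) (g : R^o -> R^o), [/\ 0 < b, g 0 = 0,
  Ck_on k.+1 [set y | `|y| < b] g,
  \forall p \near (0 : R^o * R^o), Num.sg (Phi p : R) = Num.sg (p.1 - g p.2 : R) &
  'D_1 g 0 = - ('D_(0, 1) Phi 0 / 'D_(1, 0) Phi 0)].
Proof.
have [dPhi DPhi] := CPhi.
have nU : \forall p \near (0 : R^o * R^o), U p /\ 0 < 'D_(1, 0) Phi p.
  have c0 : {for 0, continuous ('D_(1, 0) Phi)}.
    exact: Ck_on_continuous (DPhi _) U0.
  have nU' : nbhs (0 : R^o * R^o) U by apply: open_nbhs_nbhs.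
  by apply: filterS2 nU' (near_gt0 c0 dPhi0).
have [a a0 box] := near0_box nU.
have mvt (x1 x2 y : R) : `|x1| <= a -> `|x2| <= a -> `|y| <= a ->
    exists xi : R, [/\ `|xi| <= a, `|xi - x1| <= `|x2 - x1| &
    Phi (x2, y) - Phi (x1, y) = 'D_(1, 0) Phi (xi, y) * (x2 - x1)].
  move=> x1a x2a ya; apply: mvt_slice1 x1a x2a => x xa.
  by apply: dPhi; have [] := box x y xa ya.
have sgPhi (x1 x2 y : R) : `|x1| <= a -> `|x2| <= a -> `|y| <= a ->
    Num.sg (Phi (x2, y) - Phi (x1, y) : R) = Num.sg (x2 - x1).
  move=> x1a x2a ya; have [xi [xia _ ->]] := mvt x1 x2 y x1a x2a ya.
  by rewrite sgrM gtr0_sg ?mul1r //; have [] := box xi y xia ya.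
have contPhi (x y : R^o) : `|x| <= a -> `|y| <= a -> {for (x, y), continuous Phi}.
  by move=> xa ya; apply: differentiable_continuous; apply: dPhi; have [] := box x y xa ya.
have pair_cont2 (x y : R^o) : {for y, continuous (fun t : R^o => (x, t) : R^o * R^o)}.
  by apply: (continuous_pair (g1 := fun=> x) (g2 := id)); [apply: cst_continuous|].
have contx (x y : R^o) : `|x| <= a -> `|y| <= a -> {for y, continuous (fun t : R^o => Phi (x, t))}.
  move=> xa ya; apply: (@continuous_comp _ _ _ (fun t : R^o => (x, t) : R^o * R^o) Phi).
    exact: pair_cont2.
  exact: contPhi.
have norm_a : `|a| <= a by rewrite ger0_norm // ltW.
have norm_Na : `|- a| <= a by rewrite normrN.
have norm_0 : `|0 : R| <= a by rewrite normr0 ltW.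
have Phia : 0 < Phi (a, 0).
  have := sgPhi 0 a 0 norm_0 norm_a norm_0.
  by rewrite Phi0 !subr0 (gtr0_sg a0) => /eqP; rewrite sgr_cp0.
have PhiNa : Phi (- a, 0) < 0.
  have := sgPhi 0 (- a) 0 norm_0 norm_Na norm_0.
  by rewrite Phi0 !subr0 sgrN (gtr0_sg a0) => /eqP; rewrite sgr_cp0.
(* For [|y| < b] the signs at [- a] and [a] persist, so the intermediate value theorem finds a zero
   strictly between them. *)
have [b [b0 ba Phib]] : exists b : R, [/\ 0 < b, b <= a & forall y : R^o, `|y| < b ->
    Phi (- a, y) < 0 /\ 0 < Phi (a, y)].
  have : \forall y \near (0 : R^o), Phi (- a, y) < 0 /\ 0 < Phi (a, y).
    have n1 : \forall y \near (0 : R^o), Phi (- a, y) < 0.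
      exact: near_lt0 (contx (- a) 0 norm_Na norm_0) PhiNa.
    have n2 : \forall y \near (0 : R^o), 0 < Phi (a, y).
      exact: near_gt0 (contx a 0 norm_a norm_0) Phia.
    by apply: filterS2 n1 n2.
  move=> /nbhs_norm0P[e /= e0 he]; exists (Num.min e a); split.
  - by rewrite lt_min e0.
  - by rewrite ge_min lexx orbT.
  - by move=> y; rewrite lt_min => /andP[ye _]; apply: he.
have ya (y : R) : `|y| < b -> `|y| <= a by move=> /ltW/le_trans; apply.
have root (y : R^o) : `|y| < b -> exists x : R^o, `|x| < a /\ Phi (x, y) = 0.
  move=> yb; have [Phl Phr] := Phib y yb.
  have [|||c] := @IVT R (fun x => Phi (x, y)) (- a) a 0.
  - by apply: le_trans (ltW a0); rewrite oppr_le0 ltW.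
  - apply: derivable_within_continuous => x; rewrite in_itv /= => xa.
    have xna : `|x| <= a by rewrite ler_norml.
    have dp : differentiable Phi (x, y) by apply: dPhi; have [] := box x y xna (ya y yb).
    exact: (@ex_derive _ _ _ _ _ _ _ (is_derive_slice1 dp)).
  - by rewrite ge_min (ltW Phl) le_max (ltW Phr) orbT.
  rewrite in_itv /= => /andP[ac ca] Phc; exists c; split=> //.
  rewrite ltr_norml !lt_neqAle ac ca !andbT; apply/andP; split.
    by apply: contraTneq Phl => ->; rewrite Phc ltxx.
  by apply: contraTneq Phr => <-; rewrite Phc ltxx.
pose g (y : R^o) : R^o := xget 0 [set x : R^o | `|x| < a /\ Phi (x, y) = 0].
have gP (y : R^o) : `|y| < b -> `|g y| < a /\ Phi (g y, y) = 0.
  by move=> yb; have [x xP] := root y yb; rewrite /g; case: xgetP => // /(_ x).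
have sgg (x y : R^o) : `|x| <= a -> `|y| < b -> Num.sg (Phi (x, y) : R) = Num.sg (x - g y).
  move=> xa yb; have [gya gy0] := gP y yb.
  by have := sgPhi (g y) x y (ltW gya) xa (ya y yb); rewrite gy0 subr0.
have g0 : g 0 = 0.
  have yb : `|0 : R^o| < b by rewrite normr0.
  have := sgg 0 0 norm_0 yb; rewrite Phi0 sgr0 sub0r => /esym/eqP.
  by rewrite sgr_eq0 oppr_eq0 => /eqP.
have nearb (y0 : R^o) : `|y0| < b -> \forall y \near y0, `|y| < b.
  move=> y0b; apply: (@open_nbhs_nbhs _ y0 [set y : R^o | `|y| < b]); split=> //.
  by apply: (@open_comp _ _ (fun y : R^o => `|y|) [set z : R | z < b]);
    [move=> x _; apply: norm_continuous | apply: open_lt].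
have gcont (y0 : R^o) : `|y0| < b -> {for y0, continuous g}.
  move=> y0b; apply/cvgrPdist_lt => e e0.
  have [g0a _] := gP y0 y0b.
  pose d := Num.min (e / 2) (a - `|g y0|).
  have d0 : 0 < d by rewrite lt_min divr_gt0 // subr_gt0.
  have de : d < e.
    by rewrite gt_min gtr_pMr // invf_lt1 // ltr1n.
  have da : d <= a - `|g y0| by rewrite ge_min lexx orbT.
  have g1 : `|g y0 - d| <= a.
    by rewrite (le_trans (ler_normB _ _)) // (gtr0_norm d0) addrC -lerBrDr.
  have g2 : `|g y0 + d| <= a.
    by rewrite (le_trans (ler_normD _ _)) // (gtr0_norm d0) addrC -lerBrDr.
  have P1 : Phi (g y0 - d, y0) < 0.
    by rewrite -sgr_lt0 sgg // sgr_lt0 addrAC subrr sub0r oppr_lt0.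
  have P2 : 0 < Phi (g y0 + d, y0).
    by rewrite -sgr_gt0 sgg // sgr_gt0 addrAC subrr add0r.
  have n1 : \forall y \near y0, Phi (g y0 - d, y) < 0.
    exact: near_lt0 (contx _ y0 g1 (ya _ y0b)) P1.
  have n2 : \forall y \near y0, 0 < Phi (g y0 + d, y).
    exact: near_gt0 (contx _ y0 g2 (ya _ y0b)) P2.
  apply: filterS3 n1 n2 (nearb y0 y0b) => y y1 y2 yb.
  move: y1 y2; rewrite -sgr_lt0 -[0 < Phi _]sgr_gt0 !sgg // sgr_lt0 sgr_gt0.
  by rewrite ltr_norml; move: de; clear; lra.
have contD (x y : R^o) : `|x| <= a -> `|y| <= a -> {for (x, y), continuous ('D_(1, 0) Phi)}.
  by move=> xa yya; apply: Ck_on_continuous (DPhi _) _; have [] := box x y xa yya.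
have gder (y0 : R^o) : `|y0| < b -> is_derive y0 1 g
    (- ('D_(0, 1) Phi (g y0, y0) / 'D_(1, 0) Phi (g y0, y0))).
  move=> y0b; have [gya gy0] := gP y0 y0b; set x0 := g y0.
  have x0a : `|x0| <= a := ltW gya.
  (* Mean value points, with an irrelevant value outside the domain. However they are chosen, they
     tend to [x0] as [g y] does. *)
  have exi (y : R^o) : exists z : R^o, `|y| < b -> [/\ `|z| <= a,
      `|z - x0| <= `|g y - x0| & Phi (g y, y) - Phi (x0, y) =
      'D_(1, 0) Phi (z, y) * (g y - x0)].
    have [yb|yb] := boolP (`|y| < b); last by exists 0.
    have [gyy _] := gP y yb; have [z zP] := mvt _ _ y x0a (ltW gyy) (ya y yb).
    by exists z.
  have [xi xiP] := choice exi.
  have xi_cvg : {for y0, continuous (fun y => xi y - x0)}.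
    rewrite /prop_for /continuous_at.
    have -> : xi y0 - x0 = 0.
      have [_ + _] := xiP y0 y0b; rewrite -/x0 subrr normr0 normr_le0.
      by move=> /eqP.
    apply/cvgr0Pnorm_lt => e e0.
    have /cvgrPdist_lt/(_ e e0) := gcont y0 y0b; apply: filterS2 (nearb y0 y0b).
    by move=> y yb; have [_ xiy _] := xiP y yb; rewrite distrC; apply: le_lt_trans.
  have xi0 : xi y0 = x0.
    have [_ + _] := xiP y0 y0b; rewrite -/x0 subrr normr0 normr_le0 subr_eq0.
    by move=> /eqP.
  have xic : {for y0, continuous xi}.
    have -> : xi = fun y => (xi y - x0) + x0 by apply/funext => y; rewrite subrK.
    by apply: cvgD => //; apply: cvg_cst.
  have Kc : {for y0, continuous (fun y : R^o => 'D_(1, 0) Phi (xi y, y))}.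
    apply: (@continuous_comp _ _ _ (fun y : R^o => (xi y, y)) ('D_(1, 0) Phi)).
      exact: continuous_pair.
    by rewrite /= xi0; apply: contD => //; apply: ya.
  have A0 : 'D_(1, 0) Phi (x0, y0) != 0.
    by rewrite gt_eqF //; have [] := box x0 y0 x0a (ya _ y0b).
  have [dB vB] := is_derive_slice2 (dPhi (x0, y0) (box x0 y0 x0a (ya _ y0b)).1).
  have shift_cvg : (h : R^o) + y0 @[h --> 0^'] --> y0.
    have : (h : R^o) + y0 @[h --> (0 : R^o)] --> (0 : R^o) + y0.
      by apply: cvgD; [apply: cvg_id | apply: cvg_cst].
    by rewrite add0r; apply: cvg_trans; apply: cvg_app; apply: cvg_within.
  have quot : h^-1 *: ((g \o shift y0) (h *: (1 : R^o)) - g y0) @[h --> 0^'] -->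
      (- ('D_(0, 1) Phi (x0, y0) / 'D_(1, 0) Phi (x0, y0)) : R^o).
    (* Since [Phi] vanishes on the graph, the difference quotient of [g] is minus that of [Phi] in
       [y], divided by the slope in [x] at the mean value point. *)
    have q1 : - (h^-1 *: (((fun t : R^o => Phi (x0, t)) \o shift y0) (h *: (1 : R^o))
         - Phi (x0, y0)) / 'D_(1, 0) Phi (xi (h + y0), h + y0)) @[h --> 0^'] -->
      (- ('D_(0, 1) Phi (x0, y0) / 'D_(1, 0) Phi (x0, y0)) : R^o).
      apply: cvgN; apply: cvgM.
        by rewrite -vB; exact: dB.
      apply: cvgV; first exact: A0.
      rewrite -[X in 'D_(1, 0) Phi (X, _)]xi0.
      exact: (cvg_comp _ _ shift_cvg Kc).
    apply: cvg_trans q1; apply: near_eq_cvg.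
    have nb : \forall h \near 0^', `|(h : R^o) + y0| < b.
      exact: shift_cvg (nearb y0 y0b).
    apply: filterS nb => h hb.
    have [xia _] := xiP _ hb; have [gh ghy] := gP _ hb.
    rewrite ghy sub0r => eqh; rewrite /= [h *: 1]mulr1 -/x0.
    have K0 : 'D_(1, 0) Phi (xi (h + y0), h + y0) != 0.
      by rewrite gt_eqF //; have [] := box _ _ xia (ya _ hb).
    rewrite [Phi (x0, y0)]gy0 subr0 -[Phi (x0, h + y0)]opprK eqh.
    rewrite -[X in - X]scalerAl -scalerN; congr (_ *: _).
    by rewrite mulNr opprK mulrAC mulfV // mul1r.
  by split; [apply/cvg_ex; eexists; exact: quot | apply: cvg_lim => //].
have oB : open [set y : R^o | `|y| < b].
  by apply: (@open_comp _ _ (fun y : R^o => `|y|) [set z : R | z < b]);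
    [move=> x _; apply: norm_continuous | apply: open_lt].
(* Bootstrap: if [g] is of class C^j, then so is the quotient of partial derivatives along the graph
   that equals its derivative. *)
have Cg j : (j <= k.+1)%N -> Ck_on j [set y | `|y| < b] g.
  elim: j => [_ y /= yb|j IH jk]; first exact: gcont.
  have Cj := IH (ltnW jk).
  have Cid : Ck_on j [set y : R^o | `|y| < b] (fun y : R^o => y) by apply: Ck_on_id.
  split=> [y /= yb|v].
    by apply/derivable1_diffP; exact: (@ex_derive _ _ _ _ _ _ _ (gder y yb)).
  have C1 u : Ck_on j [set y : R^o | `|y| < b] (fun y => 'D_u Phi (g y, y)).
    have Dj : Ck_on j U ('D_u Phi) by apply: (@Ck_on_le _ _ j k) => //; apply: DPhi.
    apply: (Ck_on_comp2 oB Cj Cid Dj).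
    move=> y /= yb; have [gya _] := gP y yb.
    by have [] := box (g y) y (ltW gya) (ya y yb).
  have CV : Ck_on j [set y : R^o | `|y| < b] (fun y => ('D_(1, 0) Phi (g y, y))^-1).
    apply: Ck_onV => // y /= yb; have [gya _] := gP y yb.
    by rewrite gt_eqF //; have [] := box (g y) y (ltW gya) (ya y yb).
  apply: (Ck_on_eq oB _ (Ck_onM oB (Ck_on_cst j _ v)
            (Ck_onN oB (Ck_onM oB (C1 (0, 1)) CV)))) => y; rewrite inE /= => yb.
  have gd := gder y yb.
  rewrite derive_line; last exact: (@ex_derive _ _ _ _ _ _ _ gd).
  by rewrite (@derive_val _ _ _ _ _ _ _ gd).
exists b, g; split=> //.
- exact: Cg.
- apply/nbhs_norm0P; exists b => // -[x y] /=.
  rewrite prod_normE /= gt_max => /andP[xb yb].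
  by apply: sgg => //; apply: ya.
- by have := @derive_val _ _ _ _ _ _ _ (gder 0 _); rewrite normr0 g0 => ->.
Qed.

End IFT.

(** * Extension of a germ to the line, and its second derivative *)

Section Extension.
Variable R : realType.

Lemma Ck_on_comp1 (V : normedModType R) (U : set V) k (f : V -> R^o) (W : set R^o)
    (h : R^o -> R^o) : open U ->
  Ck_on k U f -> Ck_on k W h -> (forall p, U p -> W (f p)) ->
  Ck_on k U (fun p => h (f p)).
Proof.
move=> oU + + UW; elim: k f h UW => [|k IH] f h UW /=.
  by move=> cf ch p Up; apply: (@continuous_comp _ _ _ f h); [apply: cf|apply: ch; apply: UW].
move=> Cf Ch; have [df Df] := Cf; have [dh Dh] := Ch; split=> [p Up|v].
  by apply: (@differentiable_comp _ _ _ _ f h); [apply: df|apply: dh; apply: UW].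
apply: (Ck_on_eq oU _ (Ck_onM oU (Df v) (IH f _ UW (Ck_onW Cf) (Dh 1)))) => p.
rewrite inE => Up; have dfp := df p Up; have dhp := dh _ (UW p Up).
have dc : differentiable (h \o f) p by apply: differentiable_comp.
rewrite [RHS](@deriveE _ _ _ (h \o f)) // diff_comp //= -[in RHS]deriveE //.
by rewrite -[in RHS]deriveE // [RHS]derive_line //; apply: diff_derivable.
Qed.

(** A cutoff of finite smoothness is enough, and powers of the positive part provide one:
    [ramp k.+1] is of class C^k. *)
Definition ramp k (x : R^o) : R^o := (Num.max x 0 : R) ^+ k.

Lemma is_derive_ramp k (x : R^o) : is_derive x 1 (ramp k.+2) (ramp k.+1 x *+ k.+2).
Proof.
have [x0|x0|->] := ltgtP x 0.
- rewrite /ramp max_r ?ltW // expr0n /= mul0rn.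
  apply: (@near_eq_is_derive _ _ _ (fun=> 0)) => //.
    have : \forall y \near x, y < 0 by apply: near_lt0 => //; apply: cvg_id.
    by apply: filterS => y y0; rewrite /ramp max_r ?ltW // expr0n.
- rewrite /ramp max_l ?ltW //.
  apply: (@near_eq_is_derive _ _ _ (fun y : R^o => (y : R) ^+ k.+2)) => //.
    have : \forall y \near x, 0 < y by apply: near_gt0 => //; apply: cvg_id.
    by apply: filterS => y y0; rewrite /ramp max_l ?ltW.
  apply: DeriveDef; first exact: exprn_derivable.
  by rewrite exp_derive /GRing.scale /= mulr1 mulr_natl.
- rewrite /ramp maxxx expr0n /= mul0rn.
  have quot : h^-1 *: ((ramp k.+2 \o shift 0) (h *: (1 : R^o)) - ramp k.+2 0)
      @[h --> 0^'] --> (0 : R^o).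
    apply/cvgr0Pnorm_lt => e e0.
    have nh : \forall h \near (0 : R^o)^', `|h : R| < Num.min e 1.
      by apply: dnbhs0_lt; rewrite lt_min e0 ltr01.
    have nz : \forall h \near (0 : R^o)^', h != 0 by apply: nbhs_dnbhs_neq.
    apply: filterS2 nh nz => h; rewrite lt_min => /andP[he h1] h0.
    rewrite /ramp /= addr0 [h *: 1]mulr1 maxxx expr0n subr0 normrM normfV.
    rewrite normrX mulrC ltr_pdivrMr ?normr_gt0 //.
    have le1 : `|Num.max h 0 : R| <= `|h|.
      have [hn|hp] := @lerP R h 0; [by rewrite normr0 normr_ge0|by []].
    apply: le_lt_trans (_ : `|h| ^+ k.+2 < _).
      by apply: lerXn2r; rewrite ?nnegrE.
    rewrite exprS mulrC ltr_pM2r ?normr_gt0 // exprS.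
    apply: le_lt_trans he; rewrite ger_pMr ?normr_gt0 //.
    by apply: exprn_ile1 => //; apply: ltW.
  by split; [apply/cvg_ex; eexists; exact: quot | apply: cvg_lim => //].
Qed.

Lemma Ck_on_ramp k (U : set R^o) : Ck_on k U (ramp k.+1).
Proof.
apply: (@Ck_on_sub _ _ _ setT) => //.
elim: k => [|k IH] /=.
  move=> x _; rewrite /ramp (_ : (fun _ => _) = fun y : R^o => Num.max y 0 : R^o).
    by apply: continuous_max; [apply: cvg_id|apply: cvg_cst].
  by apply/funext => y; rewrite expr1.
split=> [x _|v].
  by apply/derivable1_diffP; exact: (@ex_derive _ _ _ _ _ _ _ (is_derive_ramp k x)).
apply: (Ck_on_eq openT _ (Ck_onM openT (Ck_on_cst k setT (v *+ k.+2)) IH)) => x _.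
rewrite derive_line; last exact: (@ex_derive _ _ _ _ _ _ _ (is_derive_ramp k x)).
by rewrite (@derive_val _ _ _ _ _ _ _ (is_derive_ramp k x)) mulrnAr mulrnAl.
Qed.

(* With [u] and [w] the ramps of [b^2/2 - y^2] and [y^2 - b^2/4], the cutoff
   [u / (u + w)] is 1 near 0 and vanishes before [|y|] reaches [b]. *)
Lemma Ck_on_extension k (b : R) (g : R^o -> R^o) : 0 < b ->
  Ck_on k [set y | `|y| < b] g ->
  exists2 G : R^o -> R^o, Ck_on k setT G & \forall y \near (0 : R^o), G y = g y.
Proof.
move=> b0 Cg; pose c2 : R := b ^+ 2 / 2; pose c1 : R := b ^+ 2 / 4.
have b20 : 0 < b ^+ 2 by rewrite exprn_gt0.
have c10 : 0 < c1 by rewrite divr_gt0.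
have c12 : c1 < c2 by rewrite ltr_pM2l // ltf_pV2 ?posrE // ltr_nat.
have c2b : c2 < b ^+ 2 by rewrite gtr_pMr // invf_lt1 // ltr1n.
have rge (x : R) : 0 <= ramp k.+1 x by rewrite exprn_ge0 // le_max lexx orbT.
have rgt (x : R) : 0 < x -> 0 < ramp k.+1 x.
  by move=> x0; rewrite exprn_gt0 // lt_max x0.
have r0 (x : R) : x <= 0 -> ramp k.+1 x = 0.
  by move=> x0; rewrite /ramp max_r // expr0n.
pose u (y : R^o) : R^o := ramp k.+1 (c2 - (y * y : R)).
pose w (y : R^o) : R^o := ramp k.+1 ((y * y : R) - c1).
have uw y : u y + w y != 0.
  rewrite gt_eqF //; have [yc|yc] := ltP ((y : R) * y) c2.
    by rewrite ltr_pwDl ?rge // rgt // subr_gt0.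
  by rewrite ltr_wpDl ?rge // rgt // subr_gt0 (lt_le_trans c12).
have Cu : Ck_on k setT u.
  apply: (@Ck_on_comp1 _ _ _ _ setT) => //; first exact: openT.
    apply: Ck_onD; [exact: openT|exact: Ck_on_cst|apply: Ck_onN; first exact: openT].
    by apply: Ck_onM; [exact: openT|apply: Ck_on_id..].
  exact: Ck_on_ramp.
have Cw : Ck_on k setT w.
  apply: (@Ck_on_comp1 _ _ _ _ setT) => //; first exact: openT.
    apply: Ck_onD; [exact: openT| |exact: Ck_on_cst].
    by apply: Ck_onM; [exact: openT|apply: Ck_on_id..].
  exact: Ck_on_ramp.
have Cbump : Ck_on k setT (fun y => u y * (u y + w y)^-1).
  apply: Ck_onM => //; first exact: openT.
  apply: Ck_onV => //; first exact: openT.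
  by apply: Ck_onD => //; exact: openT.
have oB : open [set y : R^o | `|y| < b].
  by apply: (@open_comp _ _ (fun y : R^o => `|y|) [set z : R | z < b]);
    [move=> x _; apply: norm_continuous | apply: open_lt].
pose W : set R^o := [set y : R^o | c2 < (y : R) * y].
have oW : open W.
  apply: (@open_comp _ _ (fun y : R^o => (y : R) * y) [set z : R | c2 < z]).
    by move=> x _; apply: cvgM; apply: cvg_id.
  exact: open_gt.
exists (fun y => g y * (u y * (u y + w y)^-1)).
  (* These two open sets cover the line because [c2 < b ^ 2]; on [W] the factor [u] vanishes,
     whatever [g] is there. *)
  have -> : [set: R^o] = [set y : R^o | `|y| < b] `|` W.
    apply/seteqP; split=> // y _; have [yb|yb] := ltP `|y : R| b; [by left|right].
    rewrite /W /= (lt_le_trans c2b) // -[leRHS]ger0_norm ?sqr_ge0 -?expr2 ?sqr_ge0 //.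
    by rewrite normrX; apply: lerXn2r; rewrite ?nnegrE // ltW.
  apply: Ck_onU.
    by apply: Ck_onM => //; apply: Ck_on_sub Cbump.
  apply: (Ck_on_eq oW _ (Ck_on_cst k W 0)) => y; rewrite inE /W /= => yc.
  by rewrite /u r0 ?mul0r ?mulr0 // subr_le0 ltW.
have ny : \forall y \near (0 : R^o), (y : R) * y < c1.
  have c : {for (0 : R^o), continuous (fun y : R^o => (y : R) * y - c1 : R^o)}.
    by apply: cvgB; [apply: cvgM; apply: cvg_id|apply: cvg_cst].
  by apply: filterS (near_lt0 c _) => [y|]; rewrite ?mul0r ?subr_lt0 // sub0r oppr_lt0.
apply: filterS ny => y yc.
have w0 : w y = 0 by rewrite /w r0 // subr_le0 ltW.
by move: (uw y); rewrite w0 addr0 => u0; rewrite mulfV // mulr1.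
Qed.

(** The mean value theorem for [g t - s / 2 * t ^ 2] on [[0, y]] bounds [g y / y ^ 2 - s / 2] by the
    error of the difference quotient of the derivative at an intermediate point. One [y > 0] for
    each [e] suffices. *)
Lemma derive1n2_quot (g : R^o -> R^o) (c : R) : Ck_on 2 setT g ->
  g 0 = 0 -> 'D_1 g 0 = 0 ->
  (g y / (y : R) ^+ 2 @[y --> (0 : R^o)^'] --> (c : R^o)) ->
  derive1n 2 g 0 = 2 * c.
Proof.
move=> [dg Dg] g0 g'0 gc; have [dg' _] := Dg 1.
pose s : R := derive1n 2 g 0; rewrite -/s.
have sE : s = 'D_(1 : R^o) ('D_(1 : R^o) g) 0.
  rewrite /s derive1nS derive1n1 derive1E; congr ('D_(1 : R^o) _ 0).
  by apply/funext => y; rewrite derive1E.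
clearbody s.
suff : forall e : R, 0 < e -> `|c - s / 2| <= e.
  move=> h; have : `|c - s / 2| <= 0.
    by apply/ler_addgt0Pl => e e0; rewrite addr0; apply: h.
  by rewrite normr_le0 subr_eq0 => /eqP ->; rewrite mulrC divfK.
move=> e e0; have e2 : 0 < e / 2 by rewrite divr_gt0.
have n1 : \forall y \near (0 : R^o)^', `|c - g y / (y : R) ^+ 2 : R| < e / 2.
  by move/cvgrPdist_lt: gc; apply.
have n2 : \forall y \near (0 : R^o)^', `|s - (y : R)^-1 * 'D_1 g y| < e / 2.
  have := @diff_derivable _ _ _ ('D_(1 : R^o) g) 0 1 (dg' 0 I).
  move=> /cvg_ex[l lP]; have ls : l = s.
    by rewrite sE; apply/esym/cvg_lim.
  move: lP; rewrite ls => /cvgrPdist_lt /(_ _ e2); apply: filterS => h.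
  by rewrite /= addr0 [h *: 1]mulr1 g'0 subr0.
have [d /= d0 hd] : exists2 d : R, 0 < d & forall y : R, 0 < y -> y < d ->
   `|c - g y / (y : R) ^+ 2| < e / 2 /\ `|s - (y : R)^-1 * 'D_1 g y| < e / 2.
  move: n1 n2; rewrite !near_withinE => /nbhs_norm0P[d1 /= d10 h1] /nbhs_norm0P[d2 /= d20 h2].
  exists (Num.min d1 d2) => [|y y0]; first by rewrite lt_min d10.
  rewrite lt_min => /andP[y1 y2]; split; [apply: h1|apply: h2];
    by rewrite /= ?gtr0_norm // gt_eqF.
pose y := d / 2; have y0 : 0 < y by rewrite divr_gt0.
have yd : y < d by rewrite gtr_pMr // invf_lt1 // ltr1n.
pose G (t : R^o) : R^o := g t - (s / 2) * ((t : R) * t).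
have dG (t : R^o) : is_derive t 1 G ('D_1 g t - s * t).
  have dsq : is_derive t (1 : R^o) ((id : R^o -> R) * (id : R^o -> R)) (t + t).
    apply: (is_derive_eq (is_deriveM (is_derive_id t (1 : R^o)) (is_derive_id t (1 : R^o)))).
    by rewrite /GRing.scale /= mulr1.
  have dgt : is_derive t (1 : R^o) g ('D_1 g t).
    by apply/derivableP; apply: diff_derivable; apply: dg.
  apply: (is_derive_eq (is_deriveB dgt (is_deriveZ (s / 2) dsq))).
  by congr (_ - _); rewrite /GRing.scale /=; field.
have [|t] := @MVT R G (fun t => 'D_1 g t - s * t) 0 y y0 (fun t _ => dG t).
- by apply: derivable_within_continuous => t _; exact: (@ex_derive _ _ _ _ _ _ _ (dG t)).
rewrite in_itv /= => /andP[t0 ty].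
rewrite /G g0 !mulr0 !subr0 => eqG.
have [+ _] := hd y y0 yd; have [_ +] := hd t t0 (lt_trans ty yd).
have -> : s - t^-1 * 'D_1 g t = - ('D_1 g t - s * t) / t.
  by field; rewrite gt_eqF.
rewrite normrM normrN normfV (gtr0_norm t0) ltr_pdivrMr // => h1.
have : `|g y / y ^+ 2 - s / 2| <= e / 2.
  have -> : g y / y ^+ 2 - s / 2 = ('D_1 g t - s * t) / y.
    have y0' : y != 0 by rewrite gt_eqF.
    have -> : g y = ('D_1 g t - s * t) * y + s / 2 * (y * y) by rewrite -eqG subrK.
    by field.
  rewrite normrM normfV (gtr0_norm y0) ler_pdivrMr // (le_trans (ltW h1)) //.
  by rewrite ler_pM2l // ltW.
move=> h2 h3; have -> : c - s / 2 = (c - g y / y ^+ 2) + (g y / y ^+ 2 - s / 2) by rewrite addrA subrK.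
by apply: le_trans (ler_normD _ _) _; rewrite [leRHS]splitr lerD // ltW.
Qed.

End Extension.

(** * Boundary curves *)

Section Axes.
Variable R : realType.
Implicit Types f : R^o * R^o -> R^o.

Lemma continuous_fst (p : R^o * R^o) : {for p, continuous (fun q : R^o * R^o => q.1)}.
Proof. exact: (@cvg_fst _ _ (nbhs p.1) (nbhs p.2) _). Qed.

Lemma continuous_snd (p : R^o * R^o) : {for p, continuous (fun q : R^o * R^o => q.2)}.
Proof. exact: (@cvg_snd _ _ (nbhs p.1) (nbhs p.2) _). Qed.

Lemma cvg_dnbhs_unique (u v : R^o -> R^o) (a b : R^o) :
  u y @[y --> (0 : R^o)^'] --> a -> v y @[y --> (0 : R^o)^'] --> b ->
  (\forall y \near (0 : R^o)^', u y = v y) -> a = b.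
Proof.
move=> ua vb uv; apply: (@cvg_unique _ _ (u @ (0 : R^o)^')) => //.
by apply: cvg_trans vb; apply: near_eq_cvg; apply: filterS uv => y ->.
Qed.

Lemma cvg_nbhs_dnbhs (u : R^o -> R^o) (l : R^o) :
  u y @[y --> (0 : R^o)] --> l -> u y @[y --> (0 : R^o)^'] --> l.
Proof. by move=> ul A /ul; apply: nbhs_dnbhs. Qed.

Lemma cvg_axis1 f : {for 0, continuous f} -> f (x, 0) @[x --> (0 : R^o)^'] --> f 0.
Proof.
move=> cf; apply: cvg_nbhs_dnbhs.
have c := @continuous_pair _ _ id (fun=> 0) (0 : R^o) cvg_id (@cst_continuous R^o R^o 0 0).
have : {for (0 : R^o), continuous (fun x : R^o => f (x, 0))}.
  exact: (@continuous_comp _ _ _ (fun x : R^o => (x, 0) : R^o * R^o) f 0 c cf).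
by apply.
Qed.

Lemma cvg_axis2 f : {for 0, continuous f} -> f (0, y) @[y --> (0 : R^o)^'] --> f 0.
Proof.
move=> cf; apply: cvg_nbhs_dnbhs.
have c := @continuous_pair _ _ (fun=> 0) id (0 : R^o) (@cst_continuous R^o R^o 0 0) cvg_id.
have : {for (0 : R^o), continuous (fun y : R^o => f (0, y))}.
  exact: (@continuous_comp _ _ _ (fun y : R^o => (0, y) : R^o * R^o) f 0 c cf).
by apply.
Qed.

Lemma near_axis1 (P : R^o * R^o -> Prop) : (\forall p \near (0 : R^o * R^o), P p) ->
  \forall x \near (0 : R^o)^', P (x, 0).
Proof.
move=> /near0_box[a a0 box]; have : \forall x \near (0 : R^o)^', `|x| < a by apply: dnbhs0_lt.
by apply: filterS => x xa; apply: box; rewrite ?normr0 ltW.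
Qed.

Lemma near_axis2 (P : R^o * R^o -> Prop) : (\forall p \near (0 : R^o * R^o), P p) ->
  \forall y \near (0 : R^o)^', P (0, y).
Proof.
move=> /near0_box[a a0 box]; have : \forall x \near (0 : R^o)^', `|x| < a by apply: dnbhs0_lt.
by apply: filterS => x xa; apply: box; rewrite ?normr0 ltW.
Qed.

Lemma near_curve (P : R^o * R^o -> Prop) (g : R^o -> R^o) :
  (\forall p \near (0 : R^o * R^o), P p) -> {for 0, continuous g} -> g 0 = 0 ->
  \forall y \near (0 : R^o), P (g y, y).
Proof.
move=> nP cg g0; have /(_ P) := @continuous_pair _ _ g id (0 : R^o) cg cvg_id.
by rewrite g0; apply.
Qed.

Lemma continuous_swap (f : R^o * R^o -> R^o) : {for 0, continuous f} ->
  {for 0, continuous (fun p : R^o * R^o => f (p.2, p.1))}.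
Proof.
move=> cf; have cs := continuous_pair (@continuous_snd 0) (@continuous_fst 0).
exact: (@continuous_comp _ _ _ (fun p : R^o * R^o => (p.2, p.1) : R^o * R^o) f 0 cs cf).
Qed.

Lemma near_swap (P : R^o * R^o -> Prop) : (\forall p \near (0 : R^o * R^o), P p) ->
  \forall p \near (0 : R^o * R^o), P (p.2, p.1).
Proof.
move=> hP; have cs := continuous_pair (@continuous_snd 0) (@continuous_fst 0).
by have := cs _ hP; apply.
Qed.

Lemma Ck_near_swap k (f : R^o * R^o -> R^o) : Ck_near k 0 f -> 
  Ck_near k 0 (fun p : R^o * R^o => f (p.2, p.1)).
Proof.
move=> [U [oU U0] CU]; exists [set p | U (p.2, p.1)]; first split=> //.
  move: oU; apply: open_comp => p _.
  exact: (continuous_pair (@continuous_snd p) (@continuous_fst p)).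
have oV : open [set p : R^o * R^o | U (p.2, p.1)].
  move: oU; apply: open_comp => p _.
  exact: (continuous_pair (@continuous_snd p) (@continuous_fst p)).
apply: (Ck_on_comp2 oV _ _ CU) => //.
  exact: (Ck_on_linear (f := (snd : {linear (R^o * R^o)%type -> R^o})) _ _ (@continuous_snd)).
exact: (Ck_on_linear (f := (fst : {linear (R^o * R^o)%type -> R^o})) _ _ (@continuous_fst)).
Qed.

Section Linearization.
Variables (D : R^o * R^o -> R^o) (k1 k2 C : R).
Hypothesis linD : \forall p \near (0 : R^o * R^o),
  `|D p - (k1 * p.1 + k2 * p.2) : R| <= C * `|p| ^+ 2.

(** Along a curve tangent to the second axis the norm of [(g y, y)] is eventually [|y|], so the
    quadratic remainder divided by [y] tends to 0. *)
Lemma linearized_curve (g : R^o -> R^o) : {for 0, continuous g} -> g 0 = 0 ->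
  (g y / y @[y --> (0 : R^o)^'] --> (0 : R^o)) ->
  D (g y, y) / y @[y --> (0 : R^o)^'] --> (k2 : R^o).
Proof.
move=> cg g0 gy.
have rem : (D (g y, y) - (k1 * g y + k2 * y)) / y @[y --> (0 : R^o)^'] --> (0 : R^o).
  apply/cvgr0Pnorm_lt => e e0.
  have n1 : \forall y \near (0 : R^o)^', `|D (g y, y) - (k1 * g y + k2 * y) : R| <=
       C * `|(g y, y) : R^o * R^o| ^+ 2.
    by apply: nbhs_dnbhs; apply: (near_curve linD cg g0).
  have n2 : \forall y \near (0 : R^o)^', `|g y / y : R| < 1.
    by move/cvgr0Pnorm_lt: gy; apply.
  (* [C] may have either sign, hence the denominator [|C| + 1]. *)
  have n3 : \forall y \near (0 : R^o)^', `|y| < e / (`|C| + 1).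
    by apply: dnbhs0_lt; rewrite divr_gt0 // ltr_wpDl.
  have n4 : \forall y \near (0 : R^o)^', y != 0 by apply: nbhs_dnbhs_neq.
  apply: filterS2 (filterI n1 n2) (filterI n3 n4) => y [y1 y2] [y3 y4].
  have y0 : 0 < `|y : R| by rewrite normr_gt0.
  rewrite normrM normfV ltr_pdivrMr //; apply: le_lt_trans y1 _.
  have gy1 : `|g y : R| < `|y : R|.
    by move: y2; rewrite normrM normfV ltr_pdivrMr ?mul1r.
  have -> : `|(g y, y) : R^o * R^o| = `|y : R|.
    by rewrite prod_normE /= max_r // ltW.
  move: y3; rewrite ltr_pdivlMr ?ltr_wpDl // => y3.
  rewrite expr2 mulrA ltr_pM2r //; apply: le_lt_trans y3.
  apply: le_trans (_ : `|C| * `|y| <= _); first by rewrite ler_wpM2r // ler_norm.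
  by rewrite mulrC ler_wpM2l // lerDl.
have : (D (g y, y) - (k1 * g y + k2 * y)) / y + (k1 * (g y / y) + k2)
    @[y --> (0 : R^o)^'] --> (0 + (k1 * 0 + k2) : R^o).
  by apply: cvgD => //; apply: cvgD; [apply: cvgM => //; apply: cvg_cst|apply: cvg_cst].
rewrite mulr0 !add0r; apply: cvg_trans; apply: near_eq_cvg.
have n4 : \forall y \near (0 : R^o)^', y != 0 by apply: nbhs_dnbhs_neq.
by apply: filterS n4 => y y0; field.
Qed.

Lemma linearized_axis2 : D (0, y) / y @[y --> (0 : R^o)^'] --> (k2 : R^o).
Proof.
apply: (@linearized_curve (fun=> 0)) => //; first exact: cvg_cst.
rewrite (_ : (fun _ => _) = fun=> 0); first exact: cvg_cst.
by apply/funext => y; rewrite mul0r.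
Qed.

End Linearization.

Lemma linearized_swap (D : R^o * R^o -> R^o) (k1 k2 C : R) :
  (\forall p \near (0 : R^o * R^o),
     `|D p - (k1 * p.1 + k2 * p.2) : R| <= C * `|p| ^+ 2) ->
  \forall p \near (0 : R^o * R^o),
     `|D (p.2, p.1) - (k2 * p.1 + k1 * p.2) : R| <= C * `|p| ^+ 2.
Proof.
move=> /near_swap; apply: filterS => -[x y] /=.
by rewrite [k1 * y + _]addrC !prod_normE /= maxC.
Qed.

Lemma linearized_axis1 (D : R^o * R^o -> R^o) (k1 k2 C : R) :
  (\forall p \near (0 : R^o * R^o),
     `|D p - (k1 * p.1 + k2 * p.2) : R| <= C * `|p| ^+ 2) ->
  D (x, 0) / x @[x --> (0 : R^o)^'] --> (k1 : R^o).
Proof. by move=> /linearized_swap/linearized_axis2. Qed.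

End Axes.

Section BoundaryCurve.
Variables (R : realType) (k : nat) (k1 k2 C : R).
Variables (Phi D w h r1 r2 : R^o * R^o -> R^o).
Hypotheses (k_ge2 : (2 <= k)%N) (CPhi : Ck_near k 0 Phi) (Phi0 : Phi 0 = 0).
Hypothesis linD : \forall p \near (0 : R^o * R^o),
  `|D p - (k1 * p.1 + k2 * p.2) : R| <= C * `|p| ^+ 2.
Hypotheses (cw : {for 0, continuous w}) (ch : {for 0, continuous h}).
Hypotheses (cr1 : {for 0, continuous r1}) (cr2 : {for 0, continuous r2}).
Hypotheses (r10 : r1 0 = 0) (r20 : r2 0 = 0) (h0 : h 0 != 0).
Hypotheses (k10 : k1 != 0) (k20 : k2 != 0).
Hypothesis eqPhi : \forall p \near (0 : R^o * R^o), D p != 0 ->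
  h p * Phi p = D p * (p.2 * (1 + r2 p)) + p.1 * (1 + r1 p) * w p.
Hypotheses (hpos : 0 < w 0 / h 0 :> R) (hneg : 0 < k2 * w 0 :> R).

(* On the axis [p.2 = 0] the relation makes [Phi] increasing in [p.1]. On its
   zero set [p.1 = g p.2] it reads [g y * w = - D (g y, y) * y] at leading
   order, and [D (g y, y) ~ k2 * y]; hence [g y ~ - (k2 / w) * y ^ 2]. *)
Lemma boundary_curve : exists g : R^o -> R^o,
  [/\ Ck_on k setT g, [/\ g 0 = 0, derive1 g 0 = 0 & derive1n 2 g 0 < 0],
   \forall p \near (0 : R^o * R^o), Num.sg (Phi p : R) = Num.sg (p.1 - g p.2 : R) &
   \forall y \near (0 : R^o), `|g y| <= `|y| / 2 /\ (y != 0 -> g y < 0)].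
Proof.
have [U [oU U0] CU] := CPhi.
case: k k_ge2 CU => [//|[//|k']] _ CU.
have [dU _] := CU.
have dP0 := dU 0 U0.
have w0 : w 0 != 0.
  by apply: contraTneq hneg => ->; rewrite mulr0 ltxx.
have neq0 : \forall y \near (0 : R^o)^', y != 0 by apply: nbhs_dnbhs_neq.
have PhiE1 : 'D_(1, 0) Phi 0 = w 0 / h 0.
  have [dx <-] := @is_derive_slice1 _ Phi 0 0 dP0.
  have q1 := dx.
  apply: (cvg_dnbhs_unique q1 (v := fun x => (1 + r1 (x, 0)) * w (x, 0) / h (x, 0))).
    rewrite -[w 0]mul1r -[X in X * w 0]addr0 -[X in (_ + X) * _]r10.
    apply: cvgM; last by apply: cvgV => //; apply: cvg_axis1.
    apply: cvgM; last exact: cvg_axis1.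
    by apply: cvgD; [apply: cvg_cst|apply: cvg_axis1].
  have nh : \forall x \near (0 : R^o)^', h (x, 0) != 0.
    by apply: (cvgr_neq0 (h 0)) => //; apply: cvg_axis1.
  have nD : \forall x \near (0 : R^o)^', D (x, 0) / x != 0.
    by apply: (cvgr_neq0 k1) => //; apply: linearized_axis1 linD.
  apply: filterS2 (filterI nh nD) (filterI neq0 (near_axis1 eqPhi)) => x [hx Dx] [x0 eqx].
  have {}Dx : D (x, 0) != 0 by apply: contraNneq Dx => ->; rewrite mul0r.
  have := eqx Dx; rewrite /= mul0r mulr0 add0r => e.
  rewrite [x *: 1]mulr1 addr0 Phi0 subr0 -[Phi _](mulKf hx) e /GRing.scale /=.
  by field; rewrite x0 hx.
have PhiE2 : 'D_(0, 1) Phi 0 = 0.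
  have [dx <-] := @is_derive_slice2 _ Phi 0 0 dP0.
  have q1 := dx; transitivity (k2 * 0 * (1 + r2 0) / h 0 : R^o); last first.
    by rewrite mulr0 !mul0r.
  apply: (cvg_dnbhs_unique q1 (v := fun y => D (0, y) / y * y * (1 + r2 (0, y)) / h (0, y))).
    apply: cvgM; last by apply: cvgV => //; apply: cvg_axis2.
    apply: cvgM; last by apply: cvgD; [apply: cvg_cst|apply: cvg_axis2].
    apply: cvgM; first by apply: linearized_axis2 linD.
    exact: cvg_within.
  have nh : \forall x \near (0 : R^o)^', h (0, x) != 0.
    by apply: (cvgr_neq0 (h 0)) => //; apply: cvg_axis2.
  have nD : \forall x \near (0 : R^o)^', D (0, x) / x != 0.
    by apply: (cvgr_neq0 k2) => //; apply: linearized_axis2 linD.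
  apply: filterS2 (filterI nh nD) (filterI neq0 (near_axis2 eqPhi)) => x [hx Dx] [x0 eqx].
  have {}Dx : D (0, x) != 0 by apply: contraNneq Dx => ->; rewrite mul0r.
  have := eqx Dx; rewrite /= !mul0r addr0 => e.
  rewrite [x *: 1]mulr1 addr0 Phi0 subr0 -[Phi _](mulKf hx) e /GRing.scale /=.
  by field; rewrite x0 hx.
have dpos : 0 < 'D_(1, 0) Phi 0 by rewrite PhiE1.
have [b [g [b0 g0 Cg sgg dg]]] := implicit_function oU U0 CU Phi0 dpos.
have [G CG Gg] := Ck_on_extension b0 Cg.
have G0 : G 0 = 0 by rewrite (nbhs_singleton Gg).
have [dG _] := CG.
have DG : 'D_1 G 0 = 0.
  rewrite (@near_eq_derive _ _ _ G g) ?oner_eq0 // dg PhiE2 mul0r oppr0 //.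
have cG : {for 0, continuous G} by apply: differentiable_continuous; apply: dG.
have Gy : G y / y @[y --> (0 : R^o)^'] --> (0 : R^o).
  have := @diff_derivable _ _ _ G 0 1 (dG 0 I); rewrite /derivable => q.
  have q1 : h^-1 *: ((G \o shift 0) (h *: (1 : R^o)) - G 0) @[h --> (0 : R^o)^'] -->
    ('D_1 G 0 : R^o) := q.
  rewrite DG in q1; apply: cvg_trans q1; apply: near_eq_cvg.
  by apply: filterS neq0 => y y0; rewrite /= [y *: 1]mulr1 addr0 G0 subr0 mulrC.
have sgG : \forall p \near (0 : R^o * R^o), Num.sg (Phi p : R) = Num.sg (p.1 - G p.2 : R).
  have : \forall p \near (0 : R^o * R^o), G p.2 = g p.2.
    exact: (@continuous_snd R 0 _ Gg).
  by apply: filterS2 sgg => p ->  ->.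
have DGy := linearized_curve linD cG G0 Gy.
have curve (f : R^o * R^o -> R^o) : {for 0, continuous f} ->
    f (G y, y) @[y --> (0 : R^o)^'] --> f 0.
  move=> cf; apply: cvg_nbhs_dnbhs.
  have c := @continuous_pair _ _ G id (0 : R^o) cG cvg_id.
  have cf' : {for (G 0, 0 : R^o), continuous f} by rewrite G0.
  have : {for (0 : R^o), continuous (fun y : R^o => f (G y, y))}.
    exact: (@continuous_comp _ _ _ (fun y : R^o => (G y, y) : R^o * R^o) f 0 c cf').
  by rewrite /prop_for /continuous_at G0; apply.
have Gquad : G y / (y : R) ^+ 2 @[y --> (0 : R^o)^'] --> (- (k2 / w 0) : R^o).
  have : - (D (G y, y) / y * (1 + r2 (G y, y)) / ((1 + r1 (G y, y)) * w (G y, y)))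
      @[y --> (0 : R^o)^'] --> (- (k2 * (1 + r2 0) / ((1 + r1 0) * w 0)) : R^o).
    apply: cvgN; apply: cvgM.
      by apply: cvgM => //; apply: cvgD; [apply: cvg_cst|apply: curve].
    apply: cvgV; first by rewrite r10 addr0 mul1r.
    by apply: cvgM; [apply: cvgD; [apply: cvg_cst|apply: curve]|apply: curve].
  rewrite r10 r20 !addr0 mulr1 mul1r; apply: cvg_trans; apply: near_eq_cvg.
  have nD : \forall y \near (0 : R^o)^', D (G y, y) / y != 0 by apply: (cvgr_neq0 k2).
  have nw : \forall y \near (0 : R^o)^', (1 + r1 (G y, y)) * w (G y, y) != 0.
    apply: (cvgr_neq0 ((1 + r1 0) * w 0)); last by rewrite r10 addr0 mul1r.
    by apply: cvgM; [apply: cvgD; [apply: cvg_cst|apply: curve]|apply: curve].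
  have nE : \forall y \near (0 : R^o)^', D (G y, y) != 0 ->
      D (G y, y) * (y * (1 + r2 (G y, y))) + G y * (1 + r1 (G y, y)) * w (G y, y) = 0.
    apply: nbhs_dnbhs; apply: filterS2 (near_curve eqPhi cG G0) (near_curve sgG cG G0).
    move=> y /= e s /e <-; move/eqP: s; rewrite subrr sgr0 sgr_eq0 => /eqP ->.
    by rewrite mulr0.
  apply: filterS2 (filterI nD nw) (filterI neq0 nE) => y [Dy wy] [y0 ey].
  have {}Dy : D (G y, y) != 0 by apply: contraNneq Dy => ->; rewrite mul0r.
  have {}ey := ey Dy; move: wy; rewrite mulf_eq0 negb_or => /andP[ry wy].
  move: ey ry wy; move: (D (G y, y)) (r1 (G y, y)) (r2 (G y, y)) (w (G y, y)).
  move=> d a c e; move: (G y) => z ez a0 e0.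
  have -> : z = - (d * (y * (1 + c))) / ((1 + a) * e).
    have ae0 := mulf_neq0 a0 e0; rewrite -[LHS](mulfK ae0); congr (_ / _).
    by rewrite [z * _]mulrA; apply/eqP; rewrite -addr_eq0 addrC ez eqxx.
  by field; rewrite y0 a0 e0.
have k2w : - (k2 / w 0) < 0 :> R.
  rewrite oppr_lt0; have -> : k2 / w 0 = k2 * w 0 / (w 0) ^+ 2 by field.
  by rewrite divr_gt0 // exprn_even_gt0.
exists G; split=> //.
- split=> //; first by rewrite derive1E.
  rewrite (@derive1n2_quot _ G (- (k2 / w 0))) //; last exact: Ck_on_le CG.
  by rewrite pmulr_rlt0.
(* The slope bound [1 / 2], imposed on both boundary curves, will let them meet only at the
   origin. *)
- have n1 : \forall y \near (0 : R^o)^', `|G y / y : R| < 1 / 2.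
    by move/cvgr0Pnorm_lt: Gy; apply; rewrite divr_gt0.
  have n2 : \forall y \near (0 : R^o)^', G y / (y : R) ^+ 2 < 0.
    exact: (Gquad [set z : R | z < 0] (open_nbhs_nbhs (conj (@open_lt _ 0) k2w))).
  have : \forall y \near (0 : R^o)^', `|G y / y : R| < 1 / 2 /\ G y / (y : R) ^+ 2 < 0.
    by apply: filterS2 n1 n2.
  rewrite near_withinE; apply: filterS => y.
  have [->|y0] := eqVneq y 0; first by move=> _; rewrite G0 normr0 mul0r.
  move=> /(_ isT) [y1 y2]; split.
    have : `|y : R| > 0 by rewrite normr_gt0.
    move: y1; rewrite normrM normfV => + yp; rewrite ltr_pdivrMr // => y1.
    by rewrite mulrC; move: y1; rewrite mul1r => /ltW.
  move=> _; have -> : G y = G y / (y : R) ^+ 2 * y ^+ 2 by rewrite divfK // expf_neq0.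
  by rewrite pmulr_llt0 // exprn_even_gt0.
Qed.

End BoundaryCurve.

(** * Regularity of cycles in the parameters *)

Section MatrixCk.
Variables (R : realType) (V : normedModType R) (k : nat) (U : set V).
Hypothesis oU : open U.

Definition Ck_mx m n (X : V -> 'M[R]_(m, n)) : Prop :=
  forall i j, Ck_on k U (fun p => X p i j : R^o).

Lemma Ck_mx_cst m n (A : 'M[R]_(m, n)) : Ck_mx (fun=> A).
Proof. by move=> i j; apply: Ck_on_cst. Qed.

Lemma Ck_mxD m n (X Y : V -> 'M[R]_(m, n)) : Ck_mx X -> Ck_mx Y ->
  Ck_mx (fun p => X p + Y p).
Proof.
move=> CX CY i j; apply: (Ck_on_eq oU _ (Ck_onD oU (CX i j) (CY i j))) => p _.
by rewrite mxE.
Qed.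

Lemma Ck_mxZ m n (a : V -> R^o) (X : V -> 'M[R]_(m, n)) : Ck_on k U a -> Ck_mx X ->
  Ck_mx (fun p => a p *: X p).
Proof.
move=> Ca CX i j; apply: (Ck_on_eq oU _ (Ck_onM oU Ca (CX i j))) => p _.
by rewrite mxE.
Qed.

Lemma Ck_mxB m n (X Y : V -> 'M[R]_(m, n)) : Ck_mx X -> Ck_mx Y ->
  Ck_mx (fun p => X p - Y p).
Proof.
move=> CX CY i j.
apply: (Ck_on_eq oU _ (Ck_onD oU (CX i j) (Ck_onN oU (CY i j)))) => p _.
by rewrite !mxE.
Qed.

Lemma Ck_mxM m n q (X : V -> 'M[R]_(m, n)) (Y : V -> 'M[R]_(n, q)) :
  Ck_mx X -> Ck_mx Y -> Ck_mx (fun p => X p *m Y p).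
Proof.
move=> CX CY i j; apply: (Ck_on_eq oU _ (@Ck_on_sum _ _ _ oU _ _ (index_enum _)
  xpredT (fun l p => X p i l * Y p l j) _)).
  by move=> p _; rewrite mxE.
by move=> l _; apply: Ck_onM.
Qed.

Lemma Ck_on_det n (X : V -> 'M[R]_n) : Ck_mx X -> Ck_on k U (fun p => \det (X p) : R^o).
Proof.
move=> CX; rewrite /determinant; apply: Ck_on_sum => // s _.
by apply: Ck_onM => //; [apply: Ck_on_cst|apply: Ck_on_prod].
Qed.

Lemma Ck_mx_adj n (X : V -> 'M[R]_n) : Ck_mx X -> Ck_mx (fun p => \adj (X p)).
Proof.
move=> CX i j.
have Cd : Ck_on k U (fun p => (-1) ^+ (j + i) * \det (row' j (col' i (X p))) : R^o).
  apply: Ck_onM => //; first exact: Ck_on_cst.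
  apply: Ck_on_det => a b.
  by apply: (Ck_on_eq oU _ (CX (lift j a) (lift i b))) => p _; rewrite !mxE.
by apply: (Ck_on_eq oU _ Cd) => p _; rewrite mxE.
Qed.

(** By Cramer's rule the entries of the inverse are rational functions of those of [X]. *)
Lemma Ck_mx_inv n (X : V -> 'M[R]_n) : (forall p, U p -> \det (X p) != 0) ->
  Ck_mx X -> Ck_mx (fun p => invmx (X p)).
Proof.
move=> X0 CX i j.
have := Ck_mxZ (Ck_onV oU X0 (Ck_on_det CX)) (Ck_mx_adj CX).
move=> /(_ i j); apply: (Ck_on_eq oU) => p; rewrite inE => Up.
by rewrite /invmx unitmxE unitfE X0.
Qed.

Lemma Ck_on_fst_comp n (X : V -> 'cV[R]_n) : Ck_mx X ->
  Ck_on k U (fun p => fst_comp (X p) : R^o).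
Proof. by move=> CX; exact: (Ck_mxM (@Ck_mx_cst 1 n (e1 R n)^T) CX 0 0). Qed.

Lemma Ck_mx_sum m n (I : Type) (r : seq I) (P : pred I) (X : I -> V -> 'M[R]_(m, n)) :
  (forall i, P i -> Ck_mx (X i)) -> Ck_mx (fun p => \sum_(i <- r | P i) X i p).
Proof.
move=> CX; elim: r => [|i r IH].
  by under eq_fun do rewrite big_nil; apply: Ck_mx_cst.
have [Pi|/negbTE Pi] := boolP (P i); last by under eq_fun do rewrite big_cons Pi.
under eq_fun do rewrite big_cons Pi.
by apply: Ck_mxD => //; apply: CX.
Qed.

Section Family.
Variables (N : nat) (F : V -> pwl_map R N) (mu : R) (n : nat).
Hypotheses (Cb : Ck_mx (fun p => coef_b (F p))) (CL : Ck_mx (fun p => coef_L (F p))).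
Hypothesis (CR : Ck_mx (fun p => coef_R (F p))).
Implicit Type T : n.-tuple symbol.

Lemma Ck_mx_coef a : Ck_mx (fun p => coef (F p) a).
Proof. by case: a. Qed.

Lemma Ck_mx_prod_coef T a b : Ck_mx (fun p => prod_coef (F p) T a b).
Proof.
rewrite /prod_coef; elim: (rev _) => [|i r IH].
  by under eq_fun do rewrite big_nil; apply: Ck_mx_cst.
under eq_fun do rewrite big_cons.
by apply: Ck_mxM => //; apply: Ck_mx_coef.
Qed.

Lemma Ck_mx_I_M T : Ck_mx (fun p => 1%:M - M_ (F p) T).
Proof. by apply: Ck_mxB; [apply: Ck_mx_cst|apply: Ck_mx_prod_coef]. Qed.

Lemma Ck_mx_forced T (g : nat -> V -> 'cV[R]_N) (y : V -> 'cV[R]_N) i :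
  (forall j, Ck_mx (g j)) -> Ck_mx y ->
  Ck_mx (fun p => forced (F p) T (fun j => g j p) (y p) i).
Proof.
move=> Cg Cy; elim: i => //= i IH.
by apply: Ck_mxD => //; apply: Ck_mxM => //; apply: Ck_mx_coef.
Qed.

Lemma Ck_mx_impulse T j i : Ck_mx (fun p => impulse (F p) T j i).
Proof.
rewrite /impulse; case: (i == j %[mod n])%N; last exact: Ck_mx_cst.
apply: Ck_mxZ; first exact: Ck_on_cst.
by apply: Ck_mxM; [apply: Ck_mxB|apply: Ck_mx_cst].
Qed.

Lemma Ck_on_det_I_M T : Ck_on k U (fun p => \det (1%:M - M_ (F p) T) : R^o).
Proof. exact: Ck_on_det (Ck_mx_I_M T). Qed.

Variable T : n.-tuple symbol.
Hypothesis nsT : forall p, U p -> \det (1%:M - M_ (F p) T) != 0.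

Lemma Ck_on_cycle_s i : Ck_on k U (fun p => cycle_s (F p) mu T i : R^o).
Proof.
apply: Ck_on_fst_comp.
under eq_fun do rewrite iterate_forced.
have CP : Ck_mx (fun p => P_ (F p) T).
  by apply: Ck_mx_sum => j _; apply: Ck_mx_prod_coef.
apply: (@Ck_mx_forced T (fun _ p => mu *: coef_b (F p)) _ i).
  by move=> _; apply: Ck_mxZ => //; apply: Ck_on_cst.
apply: Ck_mxZ; first exact: Ck_on_cst.
apply: Ck_mxM; first by apply: Ck_mx_inv => //; apply: Ck_mx_I_M.
exact: Ck_mxM.
Qed.

Lemma Ck_on_resp j i : Ck_on k U (fun p => resp (F p) T j i : R^o).
Proof.
apply: Ck_on_fst_comp; apply: (@Ck_mx_forced T (fun l p => impulse (F p) T j l)).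
  by move=> l; apply: Ck_mx_impulse.
apply: Ck_mxM; first by apply: Ck_mx_inv => //; apply: Ck_mx_I_M.
apply: (@Ck_mx_forced T (fun l p => impulse (F p) T j l)); last exact: Ck_mx_cst.
by move=> l; apply: Ck_mx_impulse.
Qed.

End Family.

End MatrixCk.

(** Each coefficient comes with its own neighbourhood; finitely many of them can be intersected. *)
Lemma Ck_near_family (R : realType) (V : normedModType R) k (p : V) (I : finType)
    (f : I -> V -> R^o) : (forall i, Ck_near k p (f i)) ->
  exists2 U : set V, open_nbhs p U & forall i, Ck_on k U (f i).
Proof.
move=> Cf; suff [U oU CU] : exists2 U : set V, open_nbhs p U &
    forall i, i \in enum I -> Ck_on k U (f i).
  by exists U => // i; apply: CU; rewrite mem_enum.
elim: (enum I) => [|i r [U [oU Up] CU]].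
  by exists setT => //; split=> //; apply: openT.
have [W [oW Wp] CW] := Cf i; exists (U `&` W).
  by split=> //; apply: openI.
move=> j; rewrite inE => /predU1P[->|/CU]; first by apply: Ck_on_sub CW => x [].
by apply: Ck_on_sub => x [].
Qed.

Section SmoothFamily.
Variables (R : realType) (N k : nat) (F : R^o * R^o -> pwl_map R N) (mu : R) (n : nat).
Hypothesis smoothF : smooth_family k F.

Lemma smooth_family_nbhs : exists2 U : set (R^o * R^o), open_nbhs (0 : R^o * R^o) U &
  [/\ Ck_mx k U (fun p => coef_b (F p)), Ck_mx k U (fun p => coef_L (F p)) &
      Ck_mx k U (fun p => coef_R (F p))].
Proof.
have [U1 [op1 z1] C1] : exists2 U : set (R^o * R^o), open_nbhs (0 : R^o * R^o) U &
    forall ij : 'I_N * 'I_N, Ck_on k U (fun p => coef_L (F p) ij.1 ij.2 : R^o).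
  by apply: Ck_near_family => ij; have [] := smoothF ij.1 ij.2.
have [U2 [op2 z2] C2] : exists2 U : set (R^o * R^o), open_nbhs (0 : R^o * R^o) U &
    forall ij : 'I_N * 'I_N, Ck_on k U (fun p => coef_R (F p) ij.1 ij.2 : R^o).
  by apply: Ck_near_family => ij; have [] := smoothF ij.1 ij.2.
have [U3 [op3 z3] C3] : exists2 U : set (R^o * R^o), open_nbhs (0 : R^o * R^o) U &
    forall i : 'I_N, Ck_on k U (fun p => coef_b (F p) i 0 : R^o).
  by apply: Ck_near_family => i; have [] := smoothF i i.
exists (U1 `&` U2 `&` U3).
  by split=> //; apply: openI => //; apply: openI.
split=> i j.
- by rewrite ord1; apply: Ck_on_sub (C3 i) => x [].
- by apply: Ck_on_sub (C1 (i, j)) => x [] [].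

- by apply: Ck_on_sub (C2 (i, j)) => x [] [].
Qed.

Lemma Ck_near_det (T : n.-tuple symbol) :
  Ck_near k 0 (fun p => \det (1%:M - M_ (F p) T) : R^o).
Proof.
have [U oU [Cb CL CR]] := smooth_family_nbhs; exists U => //.
by case: oU => oU _; apply: Ck_on_det_I_M.
Qed.

Lemma nonsingular_nbhs (T : n.-tuple symbol) : nonsingular_cycle (F 0) T ->
  exists2 U : set (R^o * R^o), open_nbhs (0 : R^o * R^o) U &
  [/\ forall p, U p -> \det (1%:M - M_ (F p) T) != 0,
      forall i, Ck_on k U (fun p => cycle_s (F p) mu T i : R^o) &
      forall j i, Ck_on k U (fun p => resp (F p) T j i : R^o)].
Proof.
have [U [oU U0] [Cb CL CR]] := smooth_family_nbhs => /nonsingular_det ns0.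
have CD := Ck_on_det_I_M oU CL CR T.
have : nbhs (0 : R^o * R^o) [set p | U p /\ \det (1%:M - M_ (F p) T) != 0].
  have c0 := Ck_on_continuous CD U0.
  have nU : nbhs (0 : R^o * R^o) U by apply: open_nbhs_nbhs.
  have nD : nbhs (0 : R^o * R^o) [set p | \det (1%:M - M_ (F p) T) != 0].
    exact: (cvgr_neq0 (_ : R^o) c0 ns0).
  exact: filterI nU nD.
rewrite nbhsE => -[W [oW W0] WU]; exists W => //.
have WU' : W `<=` U by move=> p /WU[].
have sub m q (X : R^o * R^o -> 'M[R]_(m, q)) : Ck_mx k U X -> Ck_mx k W X.
  by move=> CX i j; apply: Ck_on_sub (CX i j).
split=> [p /WU[]//|i|j i].
  by apply: Ck_on_cycle_s => //; [apply: sub..|move=> p /WU[]].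
by apply: Ck_on_resp => //; [apply: sub..|move=> p /WU[]].
Qed.

End SmoothFamily.

(** * Terminating shrinking points *)

Section RotationEigenvalue.
Variables (R : realType) (N : nat) (A : 'M[R]_N).

(** [eigenvalue] concerns row vectors. The real and imaginary parts of such a vector lie in the left
    kernel of [A ^ 2 - 2 c A + 1], and its vanishing determinant then supplies a column in the right
    kernel. *)
Lemma complex_eigenvalue_annihilator (c s : R) : c ^+ 2 + s ^+ 2 = 1 ->
  eigenvalue (map_mx (real_complex R) A) (Complex c s) ->
  exists2 w : 'cV[R]_N, w != 0 & A *m (A *m w) = (2 * c) *: (A *m w) - w.
Proof.
move=> cs1 /eigenvalueP[v vA v0].
pose a : 'rV[R]_N := \row_j complex.Re (v 0 j).
pose b : 'rV[R]_N := \row_j complex.Im (v 0 j).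
have ReIm (x : 'I_N -> complex R) (r : seq 'I_N) : \sum_(i <- r) x i =
    Complex (\sum_(i <- r) complex.Re (x i)) (\sum_(i <- r) complex.Im (x i)).
  elim: r => [|i r IH]; first by rewrite !big_nil.
  by rewrite !big_cons IH; case: (x i).
have vAj j : (a *m A) 0 j = c * a 0 j - s * b 0 j /\
             (b *m A) 0 j = c * b 0 j + s * a 0 j.
  have := congr1 (fun u : 'rV_N => u 0 j) vA; rewrite !mxE ReIm.
  case: (v 0 j) => x y /=.
  rewrite /GRing.mul /= => -[e1 e2]; split.
    rewrite -e1; apply: eq_bigr => i _; rewrite !mxE.
    by case: (v 0 i) => x' y' /=; rewrite mulr0 subr0.
  rewrite -[RHS]e2; apply: eq_bigr => i _; rewrite !mxE.
  by case: (v 0 i) => x' y' /=; rewrite mulr0 add0r.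
have aA : a *m A = c *: a - s *: b.
  by apply/rowP => j; have [-> _] := vAj j; rewrite !mxE.
have bA : b *m A = c *: b + s *: a.
  by apply/rowP => j; have [_ ->] := vAj j; rewrite !mxE.
pose B : 'M[R]_N := A *m A - (2 * c) *: A + 1%:M.
have aB : a *m B = 0.
  rewrite mulmxDr mulmxBr mulmx1 mulmxA -scalemxAr aA mulmxBl -!scalemxAl aA bA.
  apply/rowP => j; rewrite !mxE.
  move: (complex.Re _) (complex.Im _) => x y.
  have -> : c * (c * x - s * y) - s * (c * y + s * x) - 2 * c * (c * x - s * y) + x =
    x * (1 - (c ^+ 2 + s ^+ 2)) by ring.
  by rewrite cs1 subrr mulr0.
have bB : b *m B = 0.
  rewrite mulmxDr mulmxBr mulmx1 mulmxA -scalemxAr bA mulmxDl -!scalemxAl aA bA.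
  apply/rowP => j; rewrite !mxE.
  move: (complex.Re _) (complex.Im _) => x y.
  have -> : c * (c * y + s * x) + s * (c * x - s * y) - 2 * c * (c * y + s * x) + y =
    y * (1 - (c ^+ 2 + s ^+ 2)) by ring.
  by rewrite cs1 subrr mulr0.
have detB : \det B^T == 0.
  rewrite det_tr; apply/det0P.
  have [a0|a0] := eqVneq a 0; last by exists a.
  exists b => //; apply: contraNneq v0 => b0; apply/eqP/rowP => j.
  move/rowP/(_ j): a0; move/rowP/(_ j): b0; rewrite !mxE.
  by case: (v 0 j) => x y /= -> ->.
have /det0P[u u0 uB] := detB; exists u^T.
  by apply: contraNneq u0 => u0; rewrite -[u]trmxK u0 trmx0.
have : B *m u^T = 0 by apply: trmx_inj; rewrite trmx_mul trmxK uB trmx0.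
rewrite mulmxDl mulmxBl mul1mx -scalemxAl mulmxA => /eqP.
by rewrite addr_eq0 subr_eq => /eqP ->; rewrite addrC.
Qed.

Section Powers.
Variables (w : 'cV[R]_N) (phi : R).
Hypothesis ann : A *m (A *m w) = (2 * cos phi) *: (A *m w) - w.
Let U i := iter i (mulmx A) w.

(** The iterates obey the three-term recursion of [sin (i phi)]; the factor [sin phi] avoids a
    division. *)
Lemma rotation_iter i :
  sin phi *: U i.+1 = sin (i.+1%:R * phi) *: U 1 - sin (i%:R * phi) *: U 0.
Proof.
have step j : U j.+2 = (2 * cos phi) *: U j.+1 - U j.
  elim: j => [|j IH] //.
  by move: (congr1 (mulmx A) IH); rewrite mulmxBr -scalemxAr.
suff : sin phi *: U i.+1 = sin (i.+1%:R * phi) *: U 1 - sin (i%:R * phi) *: U 0 /\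
  sin phi *: U i.+2 = sin (i.+2%:R * phi) *: U 1 - sin (i.+1%:R * phi) *: U 0 by case.
elim: i => [|i [IH1 IH2]].
  split; first by rewrite mul0r sin0 scale0r subr0 mul1r.
  rewrite step scalerBr scalerA mul1r; congr (_ *: _ - _).
  by rewrite [in RHS]mulr_natl sin_mulr2n; ring.
split=> //; rewrite step scalerBr scalerA mulrC -scalerA IH2 IH1.
have trig (j : nat) : sin (j.+2%:R * phi) = 2 * cos phi * sin (j.+1%:R * phi) - sin (j%:R * phi).
  have -> : j.+2%:R * phi = j.+1%:R * phi + phi by rewrite -natr1 mulrDl mul1r.
  have -> : j%:R * phi = j.+1%:R * phi - phi by rewrite -natr1 mulrDl mul1r addrK.
  by rewrite sinD sinB; ring.
rewrite (trig i.+1) (trig i); move: (U 1) (U 0) => X Y.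
by apply/matrixP => a b; rewrite !mxE; ring.
Qed.

(** Sampled every [d] steps, the iterates obey the same recursion with angle [d phi]. The index
    [i.+1] is inherited from [rotation_iter]. *)
Lemma rotation_iter_add i d : sin phi != 0 ->
  U (i.+1 + d + d) = (2 * cos (d%:R * phi)) *: U (i.+1 + d) - U i.+1.
Proof.
move=> sphi; apply: (scalerI sphi).
rewrite scalerBr scalerA mulrC -scalerA !addSn !rotation_iter.
have trig (x : R) : sin (x + d%:R * phi + d%:R * phi) =
    2 * cos (d%:R * phi) * sin (x + d%:R * phi) - sin x.
  by rewrite -[in sin x](addrK (d%:R * phi) x) sinD sinB; ring.
rewrite -!addSn !natrD !mulrDl !trig; move: (U 1) (U 0) => X Y.
by apply/matrixP => a b; rewrite !mxE; ring.
Qed.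

End Powers.

End RotationEigenvalue.

Section FixedPoint.
Variables (R : realType) (N : nat) (f : pwl_map R N) (mu : R).

Definition fixL : 'cV[R]_N := mu *: (invmx (1%:M - coef_L f) *m coef_b f).

Hypothesis uA : 1%:M - coef_L f \in unitmx.

Lemma fst_fixL : fst_comp fixL = mu * rho_b f / \det (1%:M - coef_L f).
Proof.
rewrite /fixL fst_compZ /invmx uA -scalemxAl fst_compZ.
have -> : fst_comp (\adj (1%:M - coef_L f) *m coef_b f) = rho_b f.
  by rewrite /rho_b /rho /fst_comp mulmxA.
by rewrite [X in mu * X]mulrC mulrA.
Qed.

Lemma piece_fixL : piece f mu symL fixL = fixL.
Proof.
have : (1%:M - coef_L f) *m fixL = mu *: coef_b f by rewrite /fixL -scalemxAr mulKVmx.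
by rewrite /piece mulmxBl mul1mx => <-; rewrite subrK.
Qed.

End FixedPoint.

Section Terminating.
Variables (R : realType) (N n : nat) (f : pwl_map R N) (mu : R) (S : n.-tuple symbol).
Variables (l m d : nat).
Hypothesis term : terminating_shrinking_point f mu S l m d.
Let T := flip_at S 0.
Hypotheses (s0 : cycle_s f mu T 0 = 0) (sl : cycle_s f mu T (l * d) = 0).
Let A := coef_L f.
Let phi : R := 2 * pi * m%:R / n%:R.
Let theta : R := pi / n%:R.

Let n_ge3 : (3 <= n)%N. Proof. by have [_ []] := term. Qed.
Let n_gt0 : (0 < n)%N. Proof. exact: leq_trans n_ge3. Qed.
Let rotS : is_rotational S l m d. Proof. by have [_ []] := term. Qed.
Let lE : l = n.-1. Proof. by have [_ []] := term. Qed.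
Let nsT : nonsingular_cycle f T. Proof. by have [_ _ _ ns _] := term. Qed.
Let nR0 : n%:R != 0 :> R. Proof. by rewrite pnatr_eq0 -lt0n. Qed.

(** As [l = n - 1], the only letters of [T] that can be R are at the two hits of the switching
    manifold, where the pieces agree. The whole orbit is therefore one of the left piece. *)
Let symbT i : symb T i = symL \/ cycle_s f mu T i = 0 /\
  ((i = 0 %[mod n])%N \/ (i = l * d %[mod n])%N).
Proof.
have [j lt_jn ij] := rot_index rotS i.
have [j0|j0] := eqVneq j 0%N.
  move: ij; rewrite j0 mul0n => i0; right; split; last by left.
  by rewrite (cycle_s_eq mu nsT i0).
have [jl|jl] := eqVneq j l.
  right; move: ij; rewrite jl => il; split; last by right.
  by rewrite (cycle_s_eq mu nsT il).
left; rewrite (symb_eq T ij) symb_flip // -[0%N](mul0n d) (rot_eq_lt rotS) // (negbTE j0).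
rewrite (symb_rot rotS) // ifT //; move: jl lt_jn; rewrite lE; lia.
Qed.

Let y0 := cycle_point f mu T - fixL f mu.

Let orbitE i : iterate f mu T (cycle_point f mu T) i = fixL f mu + iter i (mulmx A) y0.
Proof.
have [_ _ [uA _] _ _] := term; have xE := piece_fixL mu uA.
elim: i => [|i IH] /=; first by rewrite addrC subrK.
transitivity (piece f mu symL (iterate f mu T (cycle_point f mu T) i)).
  have [->|[si _]] := symbT i; first by [].
  by case: (symb T i) => //; rewrite piece_eq_on_switching.
by rewrite /piece IH mulmxDr addrA -[X in X + _]/(piece f mu symL (fixL f mu)) xE.
Qed.

(** A periodic orbit of the left matrix with zero first component at both exceptional indices does
    not distinguish the two matrices there. It is thus a periodic linear orbit along [T], and [nsT]
    leaves only zero. *)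
Let kernel_unique v : iter n (mulmx A) v = v -> fst_comp v = 0 ->
  fst_comp (iter ((l * d) %% n) (mulmx A) v) = 0 -> v = 0.
Proof.
move=> vn v0 vl; apply: (forced_unique (g := fun=> 0) nsT).
  rewrite -[RHS]vn; suff E i : (i <= n)%N -> forced f T (fun=> 0) v i = iter i (mulmx A) v.
    exact: E.
  elim: i => //= i IH lt_in; rewrite IH 1?ltnW // add0r.
  have [->//|[_ il]] := symbT i.
  have si : fst_comp (iter i (mulmx A) v) = 0.
    case: il; rewrite (modn_small lt_in) ?mod0n => ->; first by [].
    exact: vl.
  case: (symb T i) => //=; apply/eqP; rewrite -subr_eq0 -mulmxBl jumpE mul_jump_e1 si.
  by rewrite scale0r.
by rewrite forcedE mulmx0 add0r big1 // => i _; rewrite mulmx0.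
Qed.

(** Since [d m = 1] modulo [n], a step of [d] turns by [2 pi / n] up to full turns. *)
Let phi_d : exists q, d%:R * phi = theta *+ 2 + pi *+ 2 *+ q.
Proof.
exists ((d * m) %/ n)%N; have := divn_eq (d * m) n.
rewrite (rot_inv rotS) modn_small ?(leq_trans _ n_ge3) // => e.
have : (d * m)%:R = ((d * m) %/ n)%:R * n%:R + 1 :> R by rewrite -natrM natr1 -addn1 -e.
rewrite natrM /phi /theta => eR.
have -> : d%:R * (2 * pi * m%:R / n%:R) = 2 * pi * (d%:R * m%:R) / n%:R :> R by field.
by rewrite eR -[(_ / _) *+ 2]mulr_natl -[pi *+ 2 *+ _]mulr_natl -[pi *+ 2]mulr_natl; field.
Qed.

Let theta_bnd : 0 < theta /\ theta <= pi / 3.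
Proof.
split; first by rewrite divr_gt0 ?pi_gt0 // ltr0n.
by rewrite ler_pM2l ?pi_gt0 // lef_pV2 ?posrE ?ltr0n // ler_nat.
Qed.

Let sin2_gt0 : 0 < sin (theta *+ 2).
Proof.
have [h1 h2] := theta_bnd; apply: sin_gt0_pi; have := pi_gt0 R.
by move: h1 h2; lra.
Qed.

Let sin_phi : sin phi != 0.
Proof.
apply/eqP => sphi; have sd i : sin (i%:R * phi) = 0.
  elim: i => [|i IH]; first by rewrite mul0r sin0.
  by rewrite -natr1 mulrDl mul1r sinD IH sphi mul0r mulr0 addr0.
have [q dE] := phi_d; have := sd d; rewrite dE (periodicn (@sinD2pi R)).
by move=> h; move: sin2_gt0; rewrite h ltxx.
Qed.

Let cos_d : cos (d%:R * phi) = cos (theta *+ 2).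
Proof. by have [q ->] := phi_d; rewrite (periodicn (@cosD2pi R)). Qed.

Lemma iter_period (v : 'cV[R]_N) k : iter n (mulmx A) v = v ->
  iter (k + n) (mulmx A) v = iter k (mulmx A) v.
Proof. by move=> vn; rewrite iterD vn. Qed.

Lemma iter_modn (v : 'cV[R]_N) k : iter n (mulmx A) v = v ->
  iter (k %% n) (mulmx A) v = iter k (mulmx A) v.
Proof.
move=> vn; rewrite [in RHS](divn_eq k n) addnC.
elim: (k %/ n)%N => [|q IH]; first by rewrite mul0n addn0.
by rewrite mulSn addnCA addnC iter_period.
Qed.

(* The orbit is that of the left piece about its fixed point. It lies in the
   plane on which [coef_L] is a rotation, so its first component along the
   indices [j * d] satisfies [z (j + 2) = 2 cos (2 theta) z (j + 1) - z j], with
   initial values given by the two hits of the switching manifold. *)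
Lemma terminating_cycle_s j : cycle_s f mu T (j * d) * cos theta =
  2 * fst_comp (fixL f mu) * (sin (j.+1%:R * theta) * sin (j%:R * theta)).
Proof.
have [_ _ _ _ /= [eig _]] := term.
have [w w0 annw] := complex_eigenvalue_annihilator (cos2Dsin2 _) eig.
rewrite -/A -/phi in annw; pose U i := iter i (mulmx A) w.
have Un : U n = U 0%N.
  apply: (scalerI sin_phi); have := rotation_iter annw n.-1.
  rewrite prednK // -/(U _) -/(U _) -/(U _) => ->.
  have nphi : n%:R * phi = 0 + pi *+ 2 *+ m.
    by rewrite /phi add0r -[pi *+ 2 *+ _]mulr_natl -[pi *+ 2]mulr_natl; field.
  have -> : n.-1%:R * phi = - phi + pi *+ 2 *+ m.
    have -> : pi *+ 2 *+ m = n%:R * phi by rewrite nphi add0r.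
    have -> : n%:R = n.-1%:R + 1 :> R by rewrite natr1 prednK.
    by rewrite mulrDl mul1r addrCA addNr addr0.
  rewrite nphi !(periodicn (@sinD2pi R)) sin0 scale0r sub0r sinN scaleNr opprK //.
have Uper k : U (k + n)%N = U k by rewrite /U iter_period.
have Umod k : U (k %% n)%N = U k by rewrite /U iter_modn.
have Urec i : U (i + d + d)%N = (2 * cos (theta *+ 2)) *: U (i + d)%N - U i.
  (* Starting one period later, at [i + n], meets the requirement of a positive index; periodicity
     brings it back to [i]. *)
  have := rotation_iter_add annw (i + n.-1) d sin_phi.
  rewrite -addnS prednK // -!/(U _) cos_d.
  have -> : (i + n + d + d = i + d + d + n)%N by lia.
  have -> : (i + n + d = i + d + n)%N by lia.
  by rewrite -/(U (i + d + d + n)) -/(U (i + d + n)) -/(U (i + n)) !Uper.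
set c := cos (theta *+ 2) in Urec.
have c2 : 0 < 1 - c ^+ 2 by rewrite -sin2cos2 exprn_gt0.
pose q := ((l * d) %% n)%N.
pose u0 := fst_comp (U 0%N); pose u1 := fst_comp (U q).
pose u2 := fst_comp (U (q + q)%N).
have qd : (q + d = 0 %[mod n])%N.
  by rewrite /q modnDml lE -mulSnr prednK // modnMr mod0n.
have u2E : u2 = 2 * c * u1 - u0.
  have := Urec (q + q)%N.
  have e1 : (q + q + d = q %[mod n])%N by rewrite -addnA -modnDmr qd mod0n addn0.
  have e2 : (q + q + d + d = 0 %[mod n])%N by rewrite -modnDml e1 modnDml qd.
  rewrite -(Umod (q + q + d + d)%N) e2 -(Umod (q + q + d)%N) e1 !Umod => h.
  by rewrite /u0 h fst_compB fst_compZ -(Umod (l * d)%N) -/q -/u1 -/u2; ring.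
(* In [u0] and [u1] this is minus a definite quadratic form, as [c ^ 2 < 1]; if both vanished,
   [kernel_unique] would give [w = 0]. *)
have detu : u0 * u2 - u1 ^+ 2 != 0.
  rewrite u2E; have -> : u0 * (2 * c * u1 - u0) - u1 ^+ 2 =
     - ((u0 - c * u1) ^+ 2 + (1 - c ^+ 2) * u1 ^+ 2) by ring.
  rewrite oppr_eq0; apply/negP => /eqP h; move/negP: w0; apply.
  have u10 : u1 = 0.
    apply/eqP; rewrite -sqrf_eq0 eq_le sqr_ge0 andbT -(pmulr_rle0 _ c2).
    by rewrite -[leRHS]h lerDr sqr_ge0.
  have u00 : u0 = 0.
    move: h; rewrite u10 mulr0 subr0 expr0n mulr0 addr0 => /eqP.
    by rewrite sqrf_eq0 => /eqP.
  by apply/eqP/kernel_unique.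
have yn : iter n (mulmx A) y0 = y0.
  have := cycle_point_iterate mu nsT; rewrite orbitE => h.
  by apply: (addrI (fixL f mu)); rewrite h /y0 addrC subrK.
pose g := - fst_comp (fixL f mu).
have y00 : fst_comp y0 = g.
  have p0 : fst_comp (cycle_point f mu T) = 0 := s0.
  by rewrite /y0 fst_compB p0 sub0r.
have yq : fst_comp (iter q (mulmx A) y0) = g.
  have := sl; rewrite -(cycle_s_mod mu _ nsT) /cycle_s orbitE fst_compD => /eqP.
  by rewrite addr_eq0 => /eqP h; rewrite /g h opprK.
(* Cramer's rule for the combination of [U 0] and [U q] whose first components at both hits equal
   [g], those of [y0]. *)
pose al := (g * u2 - g * u1) / (u0 * u2 - u1 ^+ 2).
pose be := (g * u0 - g * u1) / (u0 * u2 - u1 ^+ 2).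
have iter_lin a b (v v' : 'cV[R]_N) k : iter k (mulmx A) (a *: v + b *: v') =
    a *: iter k (mulmx A) v + b *: iter k (mulmx A) v'.
  by elim: k => //= k ->; rewrite mulmxDr -!scalemxAr.
have iterU k i : iter k (mulmx A) (U i) = U (k + i)%N by rewrite /U iterD.
have y0E : y0 = al *: U 0%N + be *: U q.
  apply/eqP; rewrite -subr_eq0; apply/eqP.
  have sub_iter k : iter k (mulmx A) (y0 - (al *: U 0%N + be *: U q)) =
      iter k (mulmx A) y0 - (al *: U k + be *: U (k + q)%N).
    rewrite -[in LHS](scaleN1r (_ + _)) -{1}[y0]scale1r iter_lin.
    by rewrite scale1r scaleN1r iter_lin !iterU addn0.
  apply: kernel_unique.
  - by rewrite sub_iter yn Un addnC Uper.
  - rewrite fst_compB y00 fst_compD !fst_compZ -/u0 -/u1 /al /be.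
    by field.
  - rewrite sub_iter fst_compB yq fst_compD !fst_compZ -/u1 -/u2 /al /be.
    by field.
pose z i := fst_comp (iter i (mulmx A) y0).
have zE i : z i = al * fst_comp (U i) + be * fst_comp (U (i + q)%N).
  by rewrite /z {1}y0E iter_lin !iterU addn0 fst_compD !fst_compZ.
have zrec i : z (i + d + d)%N = 2 * c * z (i + d)%N - z i.
  rewrite !zE Urec; have -> : (i + d + d + q = i + q + d + d)%N.
    by rewrite addnAC (addnAC i d q).
  rewrite Urec (addnAC i d q).
  by rewrite !fst_compB !fst_compZ; ring.
have zmod i : z (i %% n)%N = z i by rewrite /z iter_modn.
have zcos i : z (q + i * d)%N * cos theta = g * cos (i.*2%:R * theta - theta) /\
              z (q + i.+1 * d)%N * cos theta = g * cos (i.+1.*2%:R * theta - theta).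
  elim: i => [|i [IH1 IH2]].
    split; first by rewrite mul0r sub0r cosN mul0n addn0 /z yq.
    rewrite mul1n -zmod qd mod0n [z _]y00; congr (_ * cos _).
    by rewrite -mul2n; ring.
  split=> //; rewrite (_ : (q + i.+2 * d)%N = (q + i * d + d + d)%N); last first.
    by rewrite !mulSnr !addnA.
  rewrite zrec (_ : (q + i * d + d)%N = (q + i.+1 * d)%N); last by rewrite mulSnr addnA.
  rewrite mulrBl -[_ * z _ * _]mulrA IH1 IH2.
  have d2 k : k.*2%:R = k%:R * 2 :> R by rewrite -muln2 natrM.
  have i2 : i.+2%:R = i%:R + 2 :> R by rewrite -addn2 natrD.
  have i1 : i.+1%:R = i%:R + 1 :> R by rewrite natr1.
  have e1 : i.+2.*2%:R * theta - theta = (i.+1.*2%:R * theta - theta) + theta *+ 2.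
    by rewrite !d2 i2 i1; ring.
  have e2 : i.*2%:R * theta - theta = (i.+1.*2%:R * theta - theta) - theta *+ 2.
    by rewrite !d2 i1; ring.
  by rewrite e1 e2; move: (i.+1.*2%:R * theta - theta) => x; rewrite (cosB x) (cosD x) /c; ring.
have -> : cycle_s f mu T (j * d) = - g + z (j * d)%N.
  by rewrite /cycle_s orbitE fst_compD /g opprK.
have -> : z (j * d)%N = z (q + j.+1 * d)%N.
  rewrite -[LHS]zmod -[RHS]zmod; congr z.
  by rewrite mulSn addnA -modnDml qd mod0n add0n.
have [_ zj] := zcos j; rewrite mulrDl zj.
have -> : cos theta = cos (j.+1%:R * theta - j%:R * theta).
  by congr cos; rewrite -natr1; ring.
have -> : j.+1.*2%:R * theta - theta = j.+1%:R * theta + j%:R * theta.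
  by rewrite -mul2n -natr1; rewrite natrM -natr1; ring.
by rewrite (cosB (j.+1%:R * theta)) (cosD (j.+1%:R * theta)) /g; ring.
Qed.

Let cos_theta : 0 < cos theta.
Proof.
have [h1 h2] := theta_bnd; apply: cos_gt0_pihalf; have := pi_gt0 R.
by move: h1 h2; lra.
Qed.

Let fix_lt0 : fst_comp (fixL f mu) < 0.
Proof. by have [_ _ [uA fp] _ _] := term; rewrite fst_fixL. Qed.

Lemma terminating_cycle_s_lt0 j : (0 < j < n.-1)%N -> cycle_s f mu T (j * d) < 0.
Proof.
have sin0 i : (0 < i < n)%N -> 0 < sin (i%:R * theta).
  move=> /andP[i0 lt_in]; apply: sin_gt0_pi; have [h _] := theta_bnd.
  rewrite mulr_gt0 ?ltr0n //= /theta mulrCA gtr_pMr ?pi_gt0 //.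
  by rewrite ltr_pdivrMr ?mul1r ?ltr_nat // ltr0n.
move=> /andP[j0 jn]; rewrite -(pmulr_llt0 _ cos_theta) terminating_cycle_s.
rewrite pmulr_llt0 ?mulr_gt0 ?sin0 ?j0 //=; first by rewrite pmulr_rlt0.
  by move: jn; rewrite -ltnS prednK.
by rewrite (ltn_trans jn) // ltn_predL.
Qed.

Lemma terminating_cycle_s1 :
  cycle_s f mu T d = 4 * sin theta ^+ 2 * fst_comp (fixL f mu).
Proof.
apply: (mulIf (lt0r_neq0 cos_theta)); have := terminating_cycle_s 1.
rewrite !mul1n mul1r => ->; have -> : 2%:R * theta = theta *+ 2 by rewrite mulr_natl.
by rewrite sin_mulr2n; ring.
Qed.

(** The explicit formula is symmetric under [sin (i theta) = sin ((n - i) theta)]; with [k1_t] and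
    [k2_t] this yields [k1 = k2]. *)
Lemma terminating_cycle_s_pred : cycle_s f mu T (l.-1 * d) = cycle_s f mu T d.
Proof.
apply: (mulIf (lt0r_neq0 cos_theta)).
rewrite terminating_cycle_s -[X in cycle_s _ _ _ X * _]mul1n terminating_cycle_s.
congr (_ * _); have l0 : (0 < l)%N by rewrite lE -ltnS prednK // ltnW.
rewrite prednK // [RHS]mulrC.
have sinE i : (i <= n)%N -> sin (i%:R * theta) = sin ((n - i)%:R * theta).
  move=> le_in; rewrite natrB // mulrBl.
  have -> : n%:R * theta = pi by rewrite /theta; field.
  by rewrite sinB sinpi cospi mul0r sub0r mulN1r opprK.
rewrite (sinE l) ?(sinE l.-1) ?lE //; last 2 first.
- by rewrite (leq_trans (leq_pred _)) ?leq_pred.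
- by rewrite leq_pred.
by congr (sin (_%:R * _) * sin (_%:R * _)); move: n_ge3; clear; lia.
Qed.

Lemma terminating_sin2_lt1 : sin theta ^+ 2 < 1.
Proof. by rewrite sin2cos2 gtrBl exprn_gt0. Qed.

End Terminating.

(** * Unfolding of a shrinking point *)

Section FirstOrder.
Variable R : realType.
Local Notation E := (R^o * R^o)%type.
Implicit Types N f : E -> R^o.

(** Differentiability at the origin with value 0. In this form it survives multiplication by a
    function merely continuous at 0, which is all that is asked of [r1] and [r2]. *)
Definition first_order N (a b : R) : Prop := forall e : R, 0 < e ->
  \forall p \near (0 : E), `|N p - (a * p.1 + b * p.2) : R| <= e * `|p|.

Lemma norm_quadrant (p : E) : `|p.1 : R| <= `|p| /\ `|p.2 : R| <= `|p|.
Proof. by case: p => x y; rewrite prod_normE /= !le_max !lexx orbT. Qed.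

(** On these quadrants the two linear terms cannot cancel: their sum is at least [2 c |p|] in
    absolute value, which absorbs an error of [c |p|]. *)
Lemma first_order_quadrant N a b : 0 < a -> 0 < b -> first_order N a b ->
  \forall p \near (0 : E), p != 0 ->
  (0 <= p.1 :> R -> 0 <= p.2 :> R -> 0 < N p :> R) /\
  (p.1 <= 0 :> R -> p.2 <= 0 :> R -> N p < 0 :> R).
Proof.
move=> a0 b0 Nab; pose c := Num.min a b / 2.
have c0 : 0 < c by rewrite divr_gt0 // lt_min a0.
have ca : c * 2 <= a by rewrite /c divfK // ge_min lexx.
have cb : c * 2 <= b by rewrite /c divfK // ge_min lexx orbT.
apply: filterS (Nab c c0) => -[x y] /= + p0.
have n0 : 0 < `|(x, y) : E| by rewrite normr_gt0.
have nE : `|(x, y) : E| = Num.max `|x : R| `|y : R| by [].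
rewrite ler_norml => /andP[h1 h2].
split=> x0 y0.
  have le : `|(x, y) : E| <= (x : R) + y.
    by rewrite nE ge_max !ger0_norm // lerDl lerDr x0 y0.
  have := ler_wpM2r x0 ca; have := ler_wpM2r y0 cb.
  have := ler_wpM2l (ltW c0) le; have := mulr_gt0 c0 n0.
  by move: h1 h2; clear; lra.
have le : `|(x, y) : E| <= - (x : R) - y.
  by rewrite nE ge_max !ler0_norm //; apply/andP; split; move: x0 y0; clear; lra.
have x1 : 0 <= - (x : R) by rewrite oppr_ge0.
have y1 : 0 <= - (y : R) by rewrite oppr_ge0.
have := ler_wpM2r x1 ca; have := ler_wpM2r y1 cb.
have := ler_wpM2l (ltW c0) le; have := mulr_gt0 c0 n0.
by move: h1 h2; clear; lra.
Qed.

Lemma first_orderD N1 N2 a1 b1 a2 b2 : first_order N1 a1 b1 -> first_order N2 a2 b2 ->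
  first_order (fun p => N1 p + N2 p) (a1 + a2) (b1 + b2).
Proof.
move=> h1 h2 e e0; have e2 : 0 < e / 2 by rewrite divr_gt0.
apply: filterS2 (h1 _ e2) (h2 _ e2) => p p1 p2.
have -> : N1 p + N2 p - ((a1 + a2) * p.1 + (b1 + b2) * p.2) =
  (N1 p - (a1 * p.1 + b1 * p.2)) + (N2 p - (a2 * p.1 + b2 * p.2)) by ring.
apply: le_trans (ler_normD _ _) _.
by rewrite (splitr e) mulrDl; apply: lerD.
Qed.

Lemma first_orderM N f a b : first_order N a b -> {for 0, continuous f} ->
  first_order (fun p => N p * f p) (a * f 0) (b * f 0).
Proof.
move=> Nab cf e e0.
(* [K] bounds the linear form by [K * |p|], and [L] bounds [f] near the origin; each of the two
   error terms gets half of [e]. *)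
pose K := `|a| + `|b| + 1; pose L := `|f 0 : R| + 1.
have K0 : 0 < K by rewrite ltr_wpDl ?addr_ge0.
have L0 : 0 < L by rewrite ltr_wpDl.
pose e1 := Num.min 1 (e / (2 * K)); pose e2 := e / (2 * L).
have e10 : 0 < e1 by rewrite lt_min ltr01 divr_gt0 // mulr_gt0.
have e20 : 0 < e2 by rewrite divr_gt0 // mulr_gt0.
have nf : \forall p \near (0 : E), `|f 0 - f p : R| < e1.
  by move/cvgrPdist_lt: cf; apply.
apply: filterS2 (Nab _ e20) nf => p pN pf.
have -> : N p * f p - (a * f 0 * p.1 + b * f 0 * p.2) =
  (N p - (a * p.1 + b * p.2)) * f p + (a * p.1 + b * p.2) * (f p - f 0) by ring.
have [n1 n2] := norm_quadrant p.
have fp : `|f p : R| <= L.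
  have -> : f p = f 0 - (f 0 - f p) by rewrite subKr.
  apply: le_trans (ler_normB _ _) _; rewrite lerD2l (le_trans (ltW pf)) //.
  by rewrite ge_min lexx.
have ab : `|a * p.1 + b * p.2 : R| <= K * `|p|.
  apply: le_trans (ler_normD _ _) _; rewrite !normrM.
  rewrite /K !mulrDl -[X in X <= _]addr0 lerD ?mul1r //.
  by rewrite lerD // ler_wpM2l.
apply: le_trans (ler_normD _ _) _; rewrite !normrM.
have -> : e * `|p| = e2 * `|p| * L + K * `|p| * (e / (2 * K)).
  by rewrite /e2; field; rewrite !gt_eqF.
apply: lerD; first by apply: ler_pM.
apply: ler_pM => //; rewrite distrC (le_trans (ltW pf)) //.
by rewrite ge_min lexx orbT.
Qed.

Lemma first_order_fst : first_order (fun p => p.1) 1 0.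
Proof.
move=> e e0; near=> p; rewrite mul1r mul0r addr0 subrr normr0.
by rewrite mulr_ge0 // ltW.
Unshelve. all: by end_near.
Qed.

Lemma first_order_snd : first_order (fun p => p.2) 0 1.
Proof.
move=> e e0; near=> p; rewrite mul1r mul0r add0r subrr normr0.
by rewrite mulr_ge0 // ltW.
Unshelve. all: by end_near.
Qed.

Lemma first_orderZ N a b c : first_order N a b ->
  first_order (fun p => c * N p) (c * a) (c * b).
Proof.
move=> /first_orderM/(_ (@cst_continuous E R^o c 0)) /=.
rewrite [a * c]mulrC [b * c]mulrC => h e /h.
by apply: filterS => p; rewrite [N p * c]mulrC.
Qed.

Lemma eq_first_order N N' a b : (\forall p \near (0 : E), N p = N' p) ->
  first_order N a b -> first_order N' a b.
Proof.
by move=> NN' h e /h; apply: filterS2 NN' => p ->.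
Qed.

Lemma first_order_linearized N a b C : (\forall p \near (0 : E),
    `|N p - (a * p.1 + b * p.2) : R| <= C * `|p| ^+ 2) -> first_order N a b.
Proof.
move=> h e e0.
have nb : \forall p \near (0 : E), `|p| < e / (`|C| + 1).
  by apply: nbhs0_lt; rewrite divr_gt0 // ltr_wpDl.
apply: filterS2 h nb => p hp; rewrite ltr_pdivlMr ?ltr_wpDl // => pe.
apply: le_trans hp _; rewrite expr2 mulrA ler_wpM2r //.
apply: le_trans (ltW pe); apply: le_trans (_ : `|C| * `|p| <= _).
  by rewrite ler_wpM2r // ler_norm.
by rewrite mulrC ler_wpM2l // lerDl.
Qed.

Lemma bigO_norm_cvg0 (r : E -> R^o) :
  r =O_ (0 : E) (fun p : E => (`|p| : R^o)) ->
  r 0 = 0 /\ {for 0, continuous r}.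
Proof.
move=> /eqO_exP[C C0 hC].
have r0 : r 0 = 0.
  by have := nbhs_singleton hC; rewrite /= !normr0 mulr0 normr_le0 => /eqP.
split=> //; rewrite /prop_for /continuous_at r0.
apply/cvgr0Pnorm_lt => e e0.
have nb : \forall p \near (0 : E), `|p| < e / C by apply: nbhs0_lt; rewrite divr_gt0.
apply: filterS2 hC nb => p /= hp pe; apply: le_lt_trans hp _.
by rewrite normr_id mulrC -ltr_pdivlMr.
Qed.

Lemma bigO_norm2 (r : E -> R^o) :
  r =O_ (0 : E) (fun p : E => (`|p| ^+ 2 : R^o)) ->
  exists C : R, \forall p \near (0 : E), `|r p : R| <= C * `|p| ^+ 2.
Proof.
move=> /eqO_exP[C C0 hC]; exists C; apply: filterS hC => p /=.
by rewrite normrX normr_id.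
Qed.

End FirstOrder.

Lemma mutual_half_le0 (R : realType) (x y : R) : x <= y / 2 -> y <= x / 2 -> x <= 0.
Proof. lra. Qed.

(** The identity [c (a + b) ^ 2 - K a b = c (a - b) ^ 2 + (4 c - K) a b] reduces the claim to
    [A > c (a + b)] and [4 c > K]. *)
Lemma quadratic_margin (R : realType) (c a b A K : R) : 0 <= c -> 0 <= a -> 0 <= b ->
  0 < a \/ 0 < b -> 0 < A + - c * (a + b) -> 0 < 4 * c - K ->
  0 < A * (a + b) - K * (a * b).
Proof.
move=> c0 a0 b0 ab hA hK; have ab0 : 0 < a + b.
  by case: ab => h; [apply: ltr_pwDl|apply: ltr_wpDl].
have -> : A * (a + b) - K * (a * b) =
  (A + - c * (a + b)) * (a + b) + (c * (a - b) ^+ 2 + (4 * c - K) * (a * b)) by ring.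
apply: ltr_pwDl; first exact: mulr_gt0.
by apply: addr_ge0; apply: mulr_ge0; rewrite ?sqr_ge0 ?mulr_ge0 ?(ltW hK).
Qed.

Lemma cyclic_shift_flip (n : nat) (V : n.-tuple symbol) d i : (0 < n)%N ->
  cyclic_shift (flip_at V (d + i)) d = flip_at (cyclic_shift V d) i.
Proof.
move=> n0; apply: (symb_inj n0) => j.
rewrite symb_shift // !symb_flip // symb_shift //.
by rewrite eqn_modDl.
Qed.

Section Unfolding.
Variables (R : realType) (N n k : nat).
Local Notation E := (R^o * R^o)%type.
Implicit Type T : n.-tuple symbol.
Variables (F : E -> pwl_map R N) (mu : R) (S : n.-tuple symbol) (l m d : nat).
Hypotheses (smoothF : smooth_family k F) (rotS : is_rotational S l m d) (l_gt1 : (1 < l)%N).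
Let chk := flip_at S 0.
Hypothesis nsC : nonsingular_cycle (F 0) chk.
Let D (T : n.-tuple symbol) (p : E) : R^o := \det (1%:M - M_ (F p) T).
Let t (i : nat) (p : E) : R^o := cycle_s (F p) mu chk i.
Let s (i : nat) (p : E) : R^o := cycle_s (F p) mu S i.
Variables (r1 r2 : E -> R^o).
Hypotheses (cr1 : {for 0, continuous r1}) (cr2 : {for 0, continuous r2}).
Hypotheses (r10 : r1 0 = 0) (r20 : r2 0 = 0).
Hypothesis t_0 : \forall p \near (0 : E), t 0 p = p.1 * (1 + r1 p).
Hypothesis t_l : \forall p \near (0 : E), t (l * d) p = p.2 * (1 + r2 p).
Variables k1 k2 C : R.
Hypotheses (k10 : k1 != 0) (k20 : k2 != 0).
Hypothesis linD : \forall p \near (0 : E),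
  `|D S p - (k1 * p.1 + k2 * p.2) : R| <= C * `|p| ^+ 2.
Hypothesis signs : forall j, (j < n)%N -> j != 0%N -> j != l ->
  0 < sgn_symb R (symb chk (j * d)) * t (j * d) 0.

Let lt_ln : (l < n)%N. Proof. by case: rotS. Qed.
Let n_gt0 : (0 < n)%N. Proof. exact: rot_gt0 rotS. Qed.
Let chk' := flip_at S (l.-1 * d).
Let chk'E : chk' = cyclic_shift chk d. Proof. exact: (flip_rot_shift0 rotS). Qed.
Let nsC' : nonsingular_cycle (F 0) chk'.
Proof. by rewrite chk'E; apply/nonsingular_shift. Qed.
Let dl : (d + l.-1 * d = l * d)%N. Proof. by rewrite -mulSn prednK // ltnW. Qed.

(* The responses of the S-cycle to each of the two ways of reaching it by a
   flip from the same cycle, up to a shift. *)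
Let chi i (p : E) : R^o := resp (F p) chk 0 i.
Let chi' i (p : E) : R^o := resp (F p) chk' (l.-1 * d) i.

Lemma near_nonsingular T : nonsingular_cycle (F 0) T -> \forall p \near (0 : E), D T p != 0.
Proof.
move=> ns; have [U oU [hU _ _]] := nonsingular_nbhs mu smoothF ns.
by apply: filterS (open_nbhs_nbhs oU) => p; apply: hU.
Qed.

Lemma continuous_cycle_s T i : nonsingular_cycle (F 0) T ->
  {for 0, continuous (fun p => cycle_s (F p) mu T i : R^o)}.
Proof.
move=> ns; have [U [oU U0] [_ hU _]] := nonsingular_nbhs mu smoothF ns.
exact: Ck_on_continuous (hU i) U0.
Qed.

Lemma continuous_resp T j i : nonsingular_cycle (F 0) T ->
  {for 0, continuous (fun p => resp (F p) T j i : R^o)}.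
Proof.
move=> ns; have [U [oU U0] [_ _ hU]] := nonsingular_nbhs mu smoothF ns.
exact: Ck_on_continuous (hU j i) U0.
Qed.

Lemma continuous_det_near T : \forall p \near (0 : E), {for p, continuous (D T)}.
Proof.
have [U [oU U0] hU] := Ck_near_det smoothF T.
apply: filterS (open_nbhs_nbhs (conj oU U0)) => p Up.
exact: Ck_on_continuous hU Up.
Qed.

Lemma continuous_det T : {for 0, continuous (D T)}.
Proof. exact: nbhs_singleton (continuous_det_near T). Qed.

Let ct i : {for 0, continuous (t i)}. Proof. exact: continuous_cycle_s. Qed.
Let cchi i : {for 0, continuous (chi i)}. Proof. exact: continuous_resp. Qed.
Let cchi' i : {for 0, continuous (chi' i)}. Proof. exact: continuous_resp. Qed.

Let flip_chk : flip_at chk 0 = S. Proof. exact: flip_atK. Qed.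
Let flip_chk' : flip_at chk' (l.-1 * d) = S. Proof. exact: flip_atK. Qed.
Let D_chk' p : D chk' p = D chk p. Proof. by rewrite /D chk'E det_M_shift. Qed.

Lemma near_repA : \forall p \near (0 : E), forall i, D S p != 0 ->
  D S p * s i p = D S p * t i p + D chk p * t 0 p * chi i p.
Proof.
apply: filterS (near_nonsingular nsC) => p Dc i DS.
have nc : nonsingular_cycle (F p) chk by apply/nonsingular_det.
have nS : nonsingular_cycle (F p) (flip_at chk 0) by rewrite flip_chk; apply/nonsingular_det.
have := det_cycle_s_flip n_gt0 mu nc nS; have := cycle_s_flip n_gt0 mu i nc nS.
rewrite flip_chk -/(D _ _) -/(D _ _) => e1 e2.
by rewrite /s e1 mulrDr mulrA e2.
Qed.

(** The cycle of [chk'] is that of [chk] entered at index [d]; this accounts for [d + i] and turns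
    the collision index [l.-1 * d] into [l * d]. *)
Lemma near_repB : \forall p \near (0 : E), forall i, D S p != 0 ->
  D S p * s i p = D S p * t (d + i) p + D chk p * t (l * d) p * chi' i p.
Proof.
apply: filterS (near_nonsingular nsC) => p Dc i DS.
have nc : nonsingular_cycle (F p) chk by apply/nonsingular_det.
have nc' : nonsingular_cycle (F p) chk' by rewrite chk'E; apply/nonsingular_shift.
have nS : nonsingular_cycle (F p) (flip_at chk' (l.-1 * d)).
  by rewrite flip_chk'; apply/nonsingular_det.
have := det_cycle_s_flip n_gt0 mu nc' nS; have := cycle_s_flip n_gt0 mu i nc' nS.
rewrite flip_chk' -/(D _ _) -/(D _ _) => e1 e2.
rewrite /s e1 mulrDr mulrA e2 D_chk'.
have cs j : cycle_s (F p) mu chk' j = t (d + j) p by rewrite chk'E cycle_s_shift.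
by rewrite !cs dl.
Qed.

Lemma near_repAB0 : \forall p \near (0 : E), D S p != 0 ->
  D S p * s 0 p = D chk p * t 0 p /\ D S p * s (l.-1 * d) p = D chk p * t (l * d) p.
Proof.
apply: filterS (near_nonsingular nsC) => p Dc DS.
have nc : nonsingular_cycle (F p) chk by apply/nonsingular_det.
have nc' : nonsingular_cycle (F p) chk' by rewrite chk'E; apply/nonsingular_shift.
have nS : nonsingular_cycle (F p) S by apply/nonsingular_det.
have := det_cycle_s_flip n_gt0 mu (j := 0) nc.
have := det_cycle_s_flip n_gt0 mu (j := l.-1 * d) nc'.
rewrite flip_chk flip_chk' => /(_ nS) e2 /(_ nS) e1; split=> //.
by rewrite /s [LHS]e2 -/(D _ _) D_chk' chk'E cycle_s_shift // dl.
Qed.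

Let nD1 : \forall x \near (0 : R^o)^', D S (x, 0) != 0.
Proof.
have := linearized_axis1 linD; move=> /cvgr_neq0/(_ k10).
by apply: filterS => x; apply: contra_neq => ->; rewrite mul0r.
Qed.

Let nD2 : \forall y \near (0 : R^o)^', D S (0, y) != 0.
Proof.
have := linearized_axis2 linD; move=> /cvgr_neq0/(_ k20).
by apply: filterS => x; apply: contra_neq => ->; rewrite mul0r.
Qed.

Let neq0 : \forall y \near (0 : R^o)^', y != 0. Proof. exact: nbhs_dnbhs_neq. Qed.

(* On the axis [p.2 = 0], [near_repB] reduces to [s i = t (d + i)]. *)
Lemma D_chk_chi i : D chk 0 * chi i 0 = k1 * (t (d + i) 0 - t i 0).
Proof.
apply: (cvg_dnbhs_unique (u := fun x => D chk (x, 0) * (1 + r1 (x, 0)) * chi i (x, 0))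
  (v := fun x => D S (x, 0) / x * (t (d + i) (x, 0) - t i (x, 0)))).
- rewrite -[X in X * _]mulr1 -{2}(addr0 1) -[X in 1 + X]r10.
  apply: cvgM; last exact: cvg_axis1.
  apply: cvgM; first by apply: cvg_axis1; apply: continuous_det.
  by apply: cvgD; [apply: cvg_cst|apply: cvg_axis1].
- apply: cvgM; first exact: linearized_axis1 linD.
  by apply: cvgB; apply: cvg_axis1.
apply: filterS3 (filterI (near_axis1 t_0) (near_axis1 t_l))
  (filterI (near_axis1 near_repA) (near_axis1 near_repB)) (filterI neq0 nD1).
move=> x [] /= e0 el [] /(_ i) eA /(_ i) eB [x0 DS].
move: (eA DS); rewrite (eB DS) el mul0r mulr0 mul0r addr0 e0 => e.
rewrite mulrBr; apply/eqP; rewrite -subr_eq0; apply/eqP.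
have -> : D S (x, 0) / x * t (d + i) (x, 0) = (D S (x, 0) * t (d + i) (x, 0)) / x by field.
by rewrite e; field.
Qed.

Lemma D_chk_chi' i : D chk 0 * chi' i 0 = k2 * (t i 0 - t (d + i) 0).
Proof.
apply: (cvg_dnbhs_unique (u := fun x => D chk (0, x) * (1 + r2 (0, x)) * chi' i (0, x))
  (v := fun x => D S (0, x) / x * (t i (0, x) - t (d + i) (0, x)))).
- rewrite -[X in X * _]mulr1 -{2}(addr0 1) -[X in 1 + X]r20.
  apply: cvgM; last exact: cvg_axis2.
  apply: cvgM; first by apply: cvg_axis2; apply: continuous_det.
  by apply: cvgD; [apply: cvg_cst|apply: cvg_axis2].
- apply: cvgM; first exact: linearized_axis2 linD.
  by apply: cvgB; apply: cvg_axis2.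
apply: filterS3 (filterI (near_axis2 t_0) (near_axis2 t_l))
  (filterI (near_axis2 near_repA) (near_axis2 near_repB)) (filterI neq0 nD2).
move=> x [] /= e0 el [] /(_ i) eA /(_ i) eB [x0 DS].
move: (eB DS); rewrite (eA DS) e0 mul0r mulr0 mul0r addr0 el => e.
rewrite mulrBr; apply/eqP; rewrite -subr_eq0; apply/eqP.
have -> : D S (0, x) / x * t i (0, x) = (D S (0, x) * t i (0, x)) / x by field.
by rewrite e; field.
Qed.

Let DS0 : D S 0 = 0.
Proof.
have := nbhs_singleton linD; rewrite (@normr0 R E) expr0n /= !mulr0 addr0 subr0.
by rewrite normr_le0 => /eqP.
Qed.

Let t00 : t 0 0 = 0. Proof. by have := nbhs_singleton t_0; rewrite mul0r. Qed.
Let tl0 : t (l * d) 0 = 0. Proof. by have := nbhs_singleton t_l; rewrite mul0r. Qed.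
Let Dc0 : D chk 0 != 0. Proof. exact/nonsingular_det. Qed.

(** [D S 0 = 0] forces the response of [chk] at its own flip to equal 1 at the origin, by
    [det_flip]; [D_chk_chi] evaluates it otherwise. *)
Lemma k1_t : k1 * t d 0 = D chk 0.
Proof.
have := det_flip n_gt0 0 nsC; rewrite flip_chk -/(D _ _) -/(D _ _) DS0 => /esym/eqP.
rewrite mulf_eq0 (negbTE Dc0) subr_eq0 /= => /eqP chi00.
have := D_chk_chi 0; rewrite addn0 t00 subr0 => <-.
by rewrite /chi -chi00 mulr1.
Qed.

Lemma k2_t : k2 * t (l.-1 * d) 0 = D chk 0.
Proof.
have := det_flip n_gt0 (l.-1 * d) nsC'.
rewrite flip_chk' -/(D _ _) -/(D _ _) DS0 D_chk' => /esym/eqP.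
rewrite mulf_eq0 (negbTE Dc0) subr_eq0 /= => /eqP chi00.
have := D_chk_chi' (l.-1 * d); rewrite dl tl0 subr0 => <-.
by rewrite /chi' -chi00 mulr1.
Qed.

Let symb_chk j : (j < n)%N -> symb chk (j * d) =
  if (0 < j < l)%N then symL else symR.
Proof.
move=> jn; rewrite symb_flip // (symb_rot rotS) // -[0%N](mul0n d) (rot_eq_lt rotS) //.
by case: j jn => [|j] jn //=; rewrite (ltn_trans _ l_gt1).
Qed.

Let symb_S j : (j < n)%N -> symb S (j * d) = if (j < l)%N then symL else symR.
Proof. by move=> jn; rewrite (symb_rot rotS). Qed.

Lemma t_L j : (0 < j < l)%N -> t (j * d) 0 < 0.
Proof.
move=> /andP[j0 jl]; have jn := ltn_trans jl lt_ln.
have := signs jn; rewrite -lt0n j0 (ltn_eqF jl) symb_chk // j0 jl /= => /(_ isT isT).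
by rewrite mulN1r oppr_gt0.
Qed.

Lemma t_R j : (l < j < n)%N -> 0 < t (j * d) 0.
Proof.
move=> /andP[lj jn].
have := signs jn; rewrite -lt0n (leq_ltn_trans _ lj) // (gtn_eqF lj) symb_chk //.
by rewrite [(j < l)%N]ltnNge (ltnW lj) andbF /= mul1r; apply.
Qed.

Let td_lt0 : t d 0 < 0. Proof. by have := @t_L 1; rewrite mul1n l_gt1; apply. Qed.
Let tl1_lt0 : t (l.-1 * d) 0 < 0.
Proof. by apply: t_L; case: l l_gt1 => [|[|l']] //= _; rewrite leqnn. Qed.

(** [k1 * t d 0] and [k2 * t (l.-1 * d) 0] are the same nonzero number, and both factors [t] are
    negative. *)
Lemma k1_k2 : 0 < k1 * k2.
Proof.
have : 0 < (k1 * t d 0) * (k2 * t (l.-1 * d) 0) :> R.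
  by rewrite k1_t k2_t -expr2 exprn_even_gt0.
rewrite mulrACA pmulr_lgt0 // nmulr_rgt0 //.
Qed.

Lemma k1_D : k1 * D chk 0 < 0 :> R.
Proof. by rewrite -k1_t mulrA -expr2 pmulr_rlt0 // exprn_even_gt0. Qed.

Lemma first_order_D : first_order (D S) k1 k2.
Proof. exact: first_order_linearized linD. Qed.

(** The factor [k1] makes both coefficients positive, which spares a case distinction on its
    sign. *)
Lemma D_quadrant : \forall p \near (0 : E), p != 0 ->
  (0 <= p.1 :> R -> 0 <= p.2 :> R -> 0 < k1 * D S p :> R) /\
  (p.1 <= 0 :> R -> p.2 <= 0 :> R -> k1 * D S p < 0 :> R).
Proof.
apply: (first_order_quadrant _ k1_k2); last exact: first_orderZ first_order_D.
by rewrite -expr2 exprn_even_gt0.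
Qed.

Lemma r_gt0 : \forall p \near (0 : E), 0 < 1 + r1 p :> R /\ 0 < 1 + r2 p :> R.
Proof.
have h1 : \forall p \near (0 : E), 0 < (1 + r1 p : R^o).
  by apply: near_gt0; [apply: cvgD => //; apply: cvg_cst|rewrite r10 addr0].
have h2 : \forall p \near (0 : E), 0 < (1 + r2 p : R^o).
  by apply: near_gt0; [apply: cvgD => //; apply: cvg_cst|rewrite r20 addr0].
by apply: filterS2 h1 h2.
Qed.

(* Away from the four indices where a first component vanishes at the origin,
   [D S p * s i p] is to first order a positive combination of the two
   neighbouring values. *)
Lemma strict_generic j : (j < n)%N -> j != 0%N -> j != l.-1 -> j != l -> j != n.-1 ->
  \forall p \near (0 : E), p != 0 ->
  (0 <= p.1 :> R -> 0 <= p.2 :> R -> 0 < sgn_symb R (symb S (j * d)) * s (j * d) p) /\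
  (p.1 <= 0 :> R -> p.2 <= 0 :> R -> 0 < sgn_symb R (symb S (j * d)) * s (j * d) p).
Proof.
move=> jn j0 jl1 jl jn1; have j1n : (j.+1 < n)%N by lia.
set sg := sgn_symb R _.
have u0 : 0 < sg * t (j * d) 0.
  have := signs jn j0 jl; rewrite symb_chk // /sg symb_S //.
  by rewrite lt0n j0.
have v0 : 0 < sg * t (d + j * d) 0.
  have := signs j1n; rewrite -mulSn symb_chk // /sg symb_S //.
  have -> : (0 < j.+1 < l)%N = (j < l)%N by apply/idP/idP; lia.
  by apply; [|lia].
pose B p : R^o := D chk p * (1 + r1 p) * chi (j * d) p.
have cB : {for 0, continuous B}.
  apply: cvgM => //; last exact: cchi.
  by apply: cvgM; [apply: continuous_det|apply: cvgD => //; apply: cvg_cst].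
have B0 : B 0 = k1 * (t (d + j * d) 0 - t (j * d) 0).
  by rewrite /B r10 addr0 mulr1 D_chk_chi.
have fo : first_order (fun p => k1 * sg * (D S p * t (j * d) p + p.1 * B p))
   (k1 ^+ 2 * (sg * t (d + j * d) 0)) (k1 * k2 * (sg * t (j * d) 0)).
  have h := first_orderZ (k1 * sg) (first_orderD (first_orderM first_order_D (@ct (j * d)%N))
    (first_orderM (@first_order_fst R) cB)).
  have -> : k1 ^+ 2 * (sg * t (d + j * d) 0) = k1 * sg * (k1 * t (j * d) 0 + 1 * B 0).
    by rewrite B0; ring.
  by have -> : k1 * k2 * (sg * t (j * d) 0) = k1 * sg * (k2 * t (j * d) 0 + 0 * B 0) by ring.
have a0 : 0 < k1 ^+ 2 * (sg * t (d + j * d) 0) by rewrite mulr_gt0 // exprn_even_gt0.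
have b0 : 0 < k1 * k2 * (sg * t (j * d) 0) by rewrite mulr_gt0 // k1_k2.
apply: filterS3 (filterI (first_order_quadrant a0 b0 fo) D_quadrant) near_repA t_0.
move=> p [hN hD] eA et0 p0; have [Np Nn] := hN p0; have [Dp Dn] := hD p0.
have key : k1 * D S p != 0 -> k1 * sg * (D S p * t (j * d) p + p.1 * B p) =
    k1 * D S p * (sg * s (j * d) p).
  rewrite mulf_eq0 negb_or => /andP[_ /(eA (j * d)%N) e].
  have -> : k1 * D S p * (sg * s (j * d) p) = k1 * sg * (D S p * s (j * d) p) by ring.
  by rewrite e et0 /B; ring.
split=> p1 p2.
  have Dpp := Dp p1 p2; have := Np p1 p2.
  by rewrite key ?(gt_eqF Dpp) // pmulr_rgt0.
have Dpp := Dn p1 p2; have := Nn p1 p2.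
by rewrite key ?(lt_eqF Dpp) // nmulr_rlt0.
Qed.

Lemma strict_chk : \forall p \near (0 : E),
  forall j, (j < n)%N -> j != 0%N -> j != l ->
  0 < sgn_symb R (symb chk (j * d)) * t (j * d) p.
Proof.
pose P (j : 'I_n) (p : E) := (j : nat) != 0%N -> (j : nat) != l ->
    0 < sgn_symb R (symb chk (j * d)) * t (j * d) p.
suff h j : \forall p \near (0 : E), P j p.
  have hP : \forall p \near (0 : E), forall j, P j p.
    exact: (@filter_forall _ _ P (nbhs (0 : E)) _ h).
  by apply: filterS hP => p hp j jn; apply: (hp (Ordinal jn)).
rewrite /P.
have [j0|j0] := eqVneq (j : nat) 0%N; first by near=> p.
have [jl|jl] := eqVneq (j : nat) l; first by near=> p.
have := signs (ltn_ord j) j0 jl => sj.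
have c : {for 0, continuous (fun p => sgn_symb R (symb chk (j * d)) * t (j * d) p : R^o)}.
  by apply: cvgM; [apply: cvg_cst|apply: ct].
by apply: filterS (near_gt0 c sj).
Unshelve. all: by end_near.
Qed.

Lemma near_lt_n (P : nat -> E -> Prop) :
  (forall j, (j < n)%N -> \forall p \near (0 : E), P j p) ->
  \forall p \near (0 : E), forall j, (j < n)%N -> P j p.
Proof.
move=> h; pose Q (j : 'I_n) p := P j p.
have hQ : \forall p \near (0 : E), forall j, Q j p.
  by apply: (@filter_forall _ _ Q (nbhs (0 : E)) _) => j; apply: h.
by apply: filterS hQ => p hp j jn; apply: (hp (Ordinal jn)).
Qed.

Let near_chk : \forall p \near (0 : E), nonsingular_cycle (F p) chk.
Proof. by apply: filterS (near_nonsingular nsC) => p Dp; apply/nonsingular_det. Qed.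

Let idx0 : (0 = 0 * d)%N. Proof. by []. Qed.

(** Of the exceptional indices, [0] and [l.-1] carry the two collisions, so [l] and [n.-1] remain.
    They coincide when [l = n - 1], which is where the terminating case needs its own argument. *)
Lemma edge_fold : (forall j, (j == l) || (j == n.-1) ->
  \forall p \near (0 : E), p != 0 -> 0 <= p.1 :> R -> 0 <= p.2 :> R ->
     0 < k1 * (D S p * s (j * d) p) :> R) ->
  admissible_with_folds F mu S chk (fun p => p.1) (fun p => p.2).
Proof.
move=> edge; have l1n : (l.-1 < n)%N by apply: leq_ltn_trans lt_ln; apply: leq_pred.
apply: (admissible_with_folds_of_signs n_gt0 (j := 0) (d := d) (b := l.-1 * d)) => //.
- apply: filterS2 (continuous_det_near S) (continuous_det_near chk) => p c1 c2.
  by split; [exact: c1|exact: c2|exact: continuous_fst|exact: continuous_snd].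
- exact: near_nonsingular.
- have cDc : {for 0, continuous (fun p => k1 * D chk p : R^o)}.
    by apply: cvgM; [apply: cvg_cst|apply: continuous_det].
  have gen : \forall p \near (0 : E), forall j, (j < n)%N -> j != 0%N -> j != l.-1 ->
      p != 0 -> 0 <= p.1 :> R -> 0 <= p.2 :> R -> 0 < k1 * D S p :> R ->
      0 < sgn_symb R (symb S (j * d)) * s (j * d) p.
    apply: near_lt_n => j jn.
    have [->|j0] := eqVneq j 0%N; first by near=> p.
    have [->|jl1] := eqVneq j l.-1; first by near=> p.
    have [jl|] := boolP ((j == l) || (j == n.-1)).
      have lj : (l <= j)%N by case/orP: jl => /eqP -> //; rewrite -ltnS prednK.
      apply: filterS (edge j jl) => p h _ _ p0 p1 p2 Dp.
      have := h p0 p1 p2; rewrite mulrA pmulr_rgt0 // => sp.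
      rewrite (symb_S jn) ltnNge lj /=.
      by rewrite mul1r.
    rewrite negb_or => /andP[jl jn1].
    apply: filterS (strict_generic jn j0 jl1 jl jn1) => p h _ _ p0 p1 p2 _.
    by apply: (h p0).1.
  apply: filterS3 gen D_quadrant (near_lt0 cDc k1_D) => p hg hD hc p1 p2 p0.
  have DSp := (hD p0).1 p1 p2; split.
    have : (k1 * D S p) * (k1 * D chk p) < 0 :> R by rewrite pmulr_rlt0.
    by rewrite mulrACA -expr2 pmulr_rlt0 // exprn_even_gt0.
  move=> i i0 il; have [j jn ij] := rot_index rotS i.
  have nS : nonsingular_cycle (F p) S.
    by apply/nonsingular_det; apply: contraTneq DSp; rewrite /D => ->; rewrite mulr0 ltxx.
  rewrite (symb_eq S ij) (cycle_s_eq mu nS ij); apply: hg => //.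
    by apply: contraNneq i0 => j0; rewrite ij j0.
  by apply: contraNneq il => j0; rewrite ij j0.
- apply: filterS2 strict_chk near_chk => p h nc i i0 il.
  have [j jn ij] := rot_index rotS i.
  rewrite (symb_eq chk ij) (cycle_s_eq mu nc ij); apply: h => //.
    by apply: contraNneq i0 => j0; rewrite ij j0.
  by apply: contraNneq il => j0; rewrite dl ij j0.
- have s0 : symb chk 0 = symR by rewrite idx0 symb_chk.
  have sl : symb chk (l * d) = symR by rewrite symb_chk // ltnn andbF.
  apply: filterS3 t_0 t_l r_gt0 => p e0 el [r1p r2p]; rewrite dl s0 sl /= !mul1r.
  by rewrite [cycle_s _ _ _ 0]e0 [cycle_s _ _ _ (l * d)]el !sgrM (gtr0_sg r1p) (gtr0_sg r2p) !mulr1.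
- suff corner (p : E) : p != 0 -> (p.1 = 0 -> 0 <= p.2 :> R -> 0 < p.2 :> R) /\
      (p.2 = 0 -> 0 <= p.1 :> R -> 0 < p.1 :> R) by near=> p; exact: corner.
  case: p => x y /= p0; split=> x0 y0; rewrite lt_neqAle y0 andbT eq_sym;
    by apply: contraNneq p0 => y0'; rewrite x0 y0'.
Unshelve. all: by end_near.
Qed.

Let t_last : \forall p \near (0 : E), t (d + n.-1 * d) p = t 0 p.
Proof. by apply: filterS near_chk => p nc; apply: (cycle_s_eq mu nc (rot_last rotS)). Qed.

(** On the closed quadrant both terms of the representation, multiplied by [k1], are nonnegative,
    and [X] and [Y] do not vanish together. *)
Lemma edge_pos i (X Y W : E -> R^o) : {for 0, continuous W} -> 0 < k1 * W 0 :> R ->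
  (\forall p \near (0 : E), D S p != 0 -> D S p * s i p = D S p * X p + Y p * W p) ->
  (\forall p \near (0 : E), 0 <= p.1 :> R -> 0 <= p.2 :> R -> p != 0 ->
     [/\ 0 <= X p :> R, 0 <= Y p :> R & 0 < X p :> R \/ 0 < Y p :> R]) ->
  \forall p \near (0 : E), p != 0 -> 0 <= p.1 :> R -> 0 <= p.2 :> R ->
     0 < k1 * (D S p * s i p) :> R.
Proof.
move=> cW W0 eqs XY.
have cW' : {for 0, continuous (fun p => k1 * W p : R^o)} by apply: cvgM => //; apply: cvg_cst.
apply: filterS2 (filterI eqs XY) (filterI D_quadrant (near_gt0 cW' W0)) => p.
move=> [e xy] [hD Wp] p0 p1 p2; have Dp := (hD p0).1 p1 p2.
have [X0 Y0 XY0] := xy p1 p2 p0.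
have DS : D S p != 0 by apply: contraTneq Dp => ->; rewrite mulr0 ltxx.
rewrite (e DS).
have -> : k1 * (D S p * X p + Y p * W p) = (k1 * D S p) * X p + Y p * (k1 * W p) :> R by ring.
have X2 : 0 <= k1 * D S p * X p :> R by apply: mulr_ge0 => //; apply: ltW.
have Y2 : 0 <= Y p * (k1 * W p) :> R by apply: mulr_ge0 => //; apply: ltW.
case: XY0 => [X1|Y1]; first exact: ltr_pwDl (mulr_gt0 Dp X1) Y2.
exact: ltr_wpDl X2 (mulr_gt0 Y1 Wp).
Qed.

Let quadrant_t : \forall p \near (0 : E), 0 <= p.1 :> R -> 0 <= p.2 :> R -> p != 0 ->
  [/\ 0 <= t 0 p :> R, 0 <= t (l * d) p :> R & 0 < t 0 p :> R \/ 0 < t (l * d) p :> R].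
Proof.
apply: filterS3 t_0 t_l r_gt0 => -[x y] /= -> -> [r1p r2p] x0 y0 p0.
split; rewrite ?mulr_ge0 ?(ltW r1p) ?(ltW r2p) // !pmulr_lgt0 //.
rewrite !lt_neqAle x0 y0 !andbT ![0 == _]eq_sym.
have [x1|] := eqVneq x 0; last by left.
by right; apply: contraNneq p0 => ->; rewrite x1.
Qed.

(** * Non-terminating shrinking points *)

Section NonTerminating.
Hypothesis l_lt : (l < n.-1)%N.
Let hat := flip_at S (l * d).
Hypothesis nsH : nonsingular_cycle (F 0) hat.

Let tR1 : 0 < t (d + l * d) 0.
Proof. by rewrite -mulSn; apply: t_R; rewrite ltnSn /=; lia. Qed.
Let tRn : 0 < t (n.-1 * d) 0. Proof. by apply: t_R; rewrite l_lt ltn_predL. Qed.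
Let tn0 : t (d + n.-1 * d) 0 = 0. Proof. by rewrite (nbhs_singleton t_last). Qed.

Lemma nonterminating_fold1 :
  admissible_with_folds F mu S chk (fun p => p.1) (fun p => p.2).
Proof.
apply: edge_fold => j /orP[/eqP ->|/eqP ->].
(* At [l * d] the flip at [0] is used, at [n.-1 * d] the one at [l.-1 * d]: in this way the two
   terms always involve [t 0] and [t (l * d)]. *)
- apply: (edge_pos (X := t (l * d)) (Y := t 0) (W := fun p => D chk p * chi (l * d) p)).
  + by apply: cvgM; [apply: continuous_det|apply: cchi].
  + by rewrite D_chk_chi tl0 subr0 mulrA mulr_gt0 // -expr2 exprn_even_gt0.
  + by apply: filterS near_repA => p h /(h (l * d)%N) ->; congr (_ + _); ring.
  + apply: filterS quadrant_t => p h p1 p2 p0; have [a b c] := h p1 p2 p0.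
    by split=> //; case: c; [right|left].
- apply: (edge_pos (X := t 0) (Y := t (l * d)) (W := fun p => D chk p * chi' (n.-1 * d) p)).
  + by apply: cvgM; [apply: continuous_det|apply: cchi'].
  + by rewrite D_chk_chi' tn0 subr0 mulrA mulr_gt0 // k1_k2.
  + apply: filterS2 t_last near_repB => p e h /(h (n.-1 * d)%N) ->.
    by rewrite e; congr (_ + _); ring.
  + exact: quadrant_t.
Qed.

Let h (i : nat) (p : E) : R^o := cycle_s (F p) mu hat i.
Let chat i (p : E) : R^o := resp (F p) hat (l * d) i.

Let flip_hat : flip_at hat (l * d) = S. Proof. exact: flip_atK. Qed.
Let hat' := flip_at S (n.-1 * d).
Let hat'E : hat' = cyclic_shift hat d. Proof. exact: (flip_rot_shiftl rotS). Qed.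
Let flip_hat' : flip_at hat' (n.-1 * d) = S. Proof. exact: flip_atK. Qed.

(** At the origin the cycle of [chk] meets the switching manifold at [0] and [l * d], exactly where
    [hat] differs from [chk]. *)
Lemma hat_chk0 i : h i 0 = t i 0.
Proof.
pose x := cycle_point (F 0) mu chk; pose q := ((l * d) %% n)%N.
have itS j : (j <= n)%N -> iterate (F 0) mu S x j = iterate (F 0) mu chk x j.
  by move=> jn; rewrite -flip_chk iterate_flip0 // mod0n; apply: t00.
have qn : (q < n)%N by rewrite ltn_mod.
have itH j : (j <= n)%N -> iterate (F 0) mu hat x j = iterate (F 0) mu chk x j.
  move=> jn; rewrite /hat iterate_flip0 ?itS // 1?ltnW //.
  by rewrite -[LHS]/(cycle_s (F 0) mu chk q) /q cycle_s_mod.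
have xH : x = cycle_point (F 0) mu hat.
  by apply: cycle_point_unique => //; apply/is_cycleE; rewrite itH // cycle_point_iterate.
have lt_in : (i %% n < n)%N by rewrite ltn_mod.
rewrite /h /t -(cycle_s_mod mu i nsH) -(cycle_s_mod mu i nsC) /cycle_s -xH.
by rewrite itH // ltnW.
Qed.

Lemma near_repC : \forall p \near (0 : E), D S p != 0 ->
  [/\ forall i, D S p * s i p = D S p * h i p + D hat p * h (l * d) p * chat i p,
      D S p * s (l * d) p = D hat p * h (l * d) p &
      D S p * s (n.-1 * d) p = D hat p * h 0 p].
Proof.
apply: filterS (near_nonsingular nsH) => p Dh DS.
have nh : nonsingular_cycle (F p) hat by apply/nonsingular_det.
have nh' : nonsingular_cycle (F p) hat' by rewrite hat'E; apply/nonsingular_shift.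
have nS : nonsingular_cycle (F p) S by apply/nonsingular_det.
have := det_cycle_s_flip n_gt0 mu (j := l * d) nh.
have := det_cycle_s_flip n_gt0 mu (j := n.-1 * d) nh'.
rewrite flip_hat flip_hat' => /(_ nS) e2 /(_ nS) e1; split=> //.
  move=> i; have := cycle_s_flip n_gt0 mu (j := l * d) i nh.
  by rewrite flip_hat => /(_ nS) e; rewrite /s e mulrDr mulrA [D S p * cycle_s _ _ S _]e1.
rewrite /s [LHS]e2 hat'E det_M_shift // cycle_s_shift //.
by rewrite (cycle_s_eq mu nh (rot_last rotS)).
Qed.

Let ch i : {for 0, continuous (h i)}. Proof. exact: continuous_cycle_s. Qed.
Let cchat i : {for 0, continuous (chat i)}. Proof. exact: continuous_resp. Qed.

(** On the axis [p.1 = 0], [near_repA] gives [s i = t i], hence [s 0 = 0]. Multiplying the first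
    identity of [near_repC] at [0] by [D hat] and substituting the other two removes all components
    of the [hat]-cycle. *)
Lemma D_hat_chat : D hat 0 * chat 0 0 = - (k2 * t (n.-1 * d) 0).
Proof.
apply: (cvg_dnbhs_unique (u := fun y => D hat (0, y) * (1 + r2 (0, y)) * chat 0 (0, y))
  (v := fun y => - (D S (0, y) / y * t (n.-1 * d) (0, y)))).
- rewrite -[X in X * _]mulr1 -{2}(addr0 1) -[X in 1 + X]r20.
  apply: cvgM; last exact: cvg_axis2.
  apply: cvgM; first by apply: cvg_axis2; apply: continuous_det.
  by apply: cvgD; [apply: cvg_cst|apply: cvg_axis2].
- apply: cvgN; apply: cvgM; first exact: linearized_axis2 linD.
  exact: cvg_axis2.
apply: filterS3 (filterI (near_axis2 t_0) (near_axis2 t_l))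
  (filterI (near_axis2 near_repA) (near_axis2 near_repC)) (filterI neq0 nD2).
move=> y [] /= e0 el [] eA eC [y0 DS]; have {}eA i := eA i DS.
have [eC0 eCl eCn] := eC DS; have {eC0} := eC0 0%N.
have := eA 0%N; have := eA (l * d)%N; have := eA (n.-1 * d)%N.
rewrite e0 el mul0r mulr0 !mul0r !addr0 eCl eCn => en ell -> e.
have : D S (0, y) * (D S (0, y) * t (n.-1 * d) (0, y) +
    D hat (0, y) * chat 0 (0, y) * (y * (1 + r2 (0, y)))) = 0.
  have -> : D S (0, y) * (D S (0, y) * t (n.-1 * d) (0, y) +
      D hat (0, y) * chat 0 (0, y) * (y * (1 + r2 (0, y)))) =
    D S (0, y) * (D S (0, y) * t (n.-1 * d) (0, y)) +
      D hat (0, y) * chat 0 (0, y) * (D S (0, y) * (y * (1 + r2 (0, y)))) by ring.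
  rewrite -en -ell.
  have -> : D S (0, y) * (D hat (0, y) * h 0 (0, y)) +
     D hat (0, y) * chat 0 (0, y) * (D hat (0, y) * h (l * d) (0, y)) =
     D hat (0, y) * (D S (0, y) * h 0 (0, y) + D hat (0, y) * h (l * d) (0, y) * chat 0 (0, y)).
    by ring.
  by rewrite -e !mulr0.
move/eqP; rewrite mulf_eq0 (negbTE DS) addrC addr_eq0 /= => /eqP e'.
apply: (mulIf y0); rewrite mulNr.
have -> : D S (0, y) / y * t (n.-1 * d) (0, y) * y = D S (0, y) * t (n.-1 * d) (0, y) by field.
by rewrite -e'; ring.
Qed.

(** The same elimination on the axis [p.2 = 0], where [s i = t (d + i)]. The right-hand side is
    negative, so [D hat] and [D chk] have opposite signs; this places the folds with [hat] on the
    other side of the origin. *)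
Lemma D_hat_D_chk : D hat 0 * D chk 0 = - (k1 * k2 * (t (n.-1 * d) 0 * t (d + l * d) 0)).
Proof.
have -> : - (k1 * k2 * (t (n.-1 * d) 0 * t (d + l * d) 0)) =
   D S 0 * D S 0 * (1 + r1 0) + D hat 0 * chat 0 0 * k1 * t (d + l * d) 0.
  by rewrite D_hat_chat DS0 !mul0r add0r; ring.
apply: (cvg_dnbhs_unique (u := fun x => D hat (x, 0) * (D chk (x, 0) * (1 + r1 (x, 0))))
  (v := fun x => D S (x, 0) * D S (x, 0) * (1 + r1 (x, 0)) +
    D hat (x, 0) * chat 0 (x, 0) * (D S (x, 0) / x) * t (d + l * d) (x, 0))).
- rewrite -[X in _ * X]mulr1 -{2}(addr0 1) -[X in 1 + X]r10.
  apply: cvgM; first by apply: cvg_axis1; apply: continuous_det.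
  apply: cvgM; first by apply: cvg_axis1; apply: continuous_det.
  by apply: cvgD; [apply: cvg_cst|apply: cvg_axis1].
- have cS := @continuous_det S; have cH := @continuous_det hat.
  apply: cvgD; first apply: cvgM.
  + by apply: cvgM; apply: cvg_axis1.
  + by apply: cvgD; [apply: cvg_cst|apply: cvg_axis1].
  + apply: cvgM; last exact: cvg_axis1.
    apply: cvgM; last exact: linearized_axis1 linD.
    by apply: cvgM; apply: cvg_axis1.
apply: filterS3 (filterI (near_axis1 t_0) (filterI (near_axis1 t_l) (near_axis1 t_last)))
  (filterI (filterI (near_axis1 near_repAB0) (near_axis1 near_repB)) (near_axis1 near_repC))
  (filterI neq0 nD1).
move=> x [] /= e0 [el et] [[eA eB] eC] [x0 DS]; have {}eB i := eB i DS.
have [eC0 eCl eCn] := eC DS; have {eC0} := eC0 0%N.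
have [-> _] := eA DS; have := eB (l * d)%N; have := eB (n.-1 * d)%N.
rewrite et el mul0r mulr0 !mul0r !addr0 eCl eCn e0 => en ell e.
apply: (mulIf x0).
have -> : D hat (x, 0) * (D chk (x, 0) * (1 + r1 (x, 0))) * x =
  D hat (x, 0) * (D chk (x, 0) * (x * (1 + r1 (x, 0)))) by ring.
rewrite e.
have -> : D hat (x, 0) * (D S (x, 0) * h 0 (x, 0) + D hat (x, 0) * h (l * d) (x, 0) * chat 0 (x, 0)) =
  D S (x, 0) * (D hat (x, 0) * h 0 (x, 0)) +
  D hat (x, 0) * chat 0 (x, 0) * (D hat (x, 0) * h (l * d) (x, 0)) by ring.
by rewrite en ell; field.
Qed.

Let Dc_hat : 0 < k1 * D hat 0 :> R.
Proof.
have : (k1 * D hat 0) * (k1 * D chk 0) < 0 :> R.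
  rewrite mulrACA D_hat_D_chk mulrN oppr_lt0 -expr2 pmulr_lgt0 ?exprn_even_gt0 //.
  by rewrite mulr_gt0 ?k1_k2 // mulr_gt0.
by rewrite nmulr_llt0 // k1_D.
Qed.

Let Dh0 : D hat 0 != 0. Proof. exact/nonsingular_det. Qed.

Let Ch i : Ck_near k 0 (h i).
Proof. by have [U oU [_ hU _]] := nonsingular_nbhs mu smoothF nsH; exists U; [exact: oU|exact: hU]. Qed.

Let div_D_hat_gt0 (w : R) : 0 < k1 * w -> 0 < w / D hat 0 :> R.
Proof.
move=> w0; have -> : w / D hat 0 = (k1 * w) / (k1 * D hat 0) :> R.
  by field; rewrite k10 Dh0.
exact: divr_gt0.
Qed.

Lemma boundary_curve1 : (2 <= k)%N -> exists g : R^o -> R^o,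
  [/\ Ck_on k setT g, [/\ g 0 = 0, derive1 g 0 = 0 & derive1n 2 g 0 < 0],
   \forall p \near (0 : E), Num.sg (h (l * d) p : R) = Num.sg (p.1 - g p.2 : R) &
   \forall y \near (0 : R^o), `|g y| <= `|y| / 2 /\ (y != 0 -> g y < 0)].
Proof.
move=> k2_le; have w0 : D chk 0 * chi (l * d) 0 = k1 * t (d + l * d) 0.
  by rewrite D_chk_chi tl0 subr0.
apply: (@boundary_curve R k k1 k2 C (h (l * d)) (D S) (fun p => D chk p * chi (l * d) p)
  (D hat) r1 r2) => //.
- by rewrite hat_chk0.
- by apply: cvgM; [apply: continuous_det|apply: cchi].
- exact: continuous_det.
- apply: filterS3 near_repA near_repC (filterI t_0 t_l) => p eA eC [e0 el] DS.
  by have [_ <- _] := eC DS; rewrite eA // el e0; ring.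
- by apply: div_D_hat_gt0; rewrite w0 mulrA pmulr_rgt0 // -expr2 exprn_even_gt0.
- by rewrite w0 mulrA [k2 * _]mulrC mulr_gt0 // k1_k2.
Qed.

Lemma boundary_curve2 : (2 <= k)%N -> exists g : R^o -> R^o,
  [/\ Ck_on k setT g, [/\ g 0 = 0, derive1 g 0 = 0 & derive1n 2 g 0 < 0],
   \forall p \near (0 : E), Num.sg (h 0 p : R) = Num.sg (p.2 - g p.1 : R) &
   \forall x \near (0 : R^o), `|g x| <= `|x| / 2 /\ (x != 0 -> g x < 0)].
Proof.
move=> k2_le.
have w0 : D chk 0 * chi' (n.-1 * d) 0 = k2 * t (n.-1 * d) 0.
  by rewrite D_chk_chi' tn0 subr0.
(* The previous construction in exchanged coordinates, with the first component at [0] and the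
   representation of [s (n.-1 * d)]. *)
have [||||||||||||||||g [Cg g0 sg gs]] := @boundary_curve R k k2 k1 C
  (fun p => h 0 (p.2, p.1)) (fun p => D S (p.2, p.1))
  (fun p => D chk (p.2, p.1) * chi' (n.-1 * d) (p.2, p.1))
  (fun p => D hat (p.2, p.1)) (fun p => r2 (p.2, p.1)) (fun p => r1 (p.2, p.1)).
- by [].
- exact: Ck_near_swap.
- by rewrite hat_chk0.
- exact: linearized_swap.
- apply: (continuous_swap (f := fun p => D chk p * chi' (n.-1 * d) p)).
  by apply: cvgM; [apply: continuous_det|apply: cchi'].
- exact: continuous_swap (@continuous_det hat).
- exact: continuous_swap.
- exact: continuous_swap.
- by [].
- by [].
- by [].
- by [].
- by [].
- apply: (near_swap (P := fun p => D S p != 0 -> D hat p * h 0 p =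
    D S p * (p.1 * (1 + r1 p)) + p.2 * (1 + r2 p) * (D chk p * chi' (n.-1 * d) p))).
  apply: filterS3 (filterI near_repB t_last) near_repC (filterI t_0 t_l).
  move=> p [eB et] eC [e0 el] DS.
  by have [_ _ <-] := eC DS; rewrite eB // et el e0; ring.
- by apply: div_D_hat_gt0; rewrite w0 mulrA mulr_gt0 // k1_k2.
- by rewrite w0 mulrA mulr_gt0 // k1_k2.
exists g; split=> //.
by apply: filterS (near_swap sg) => -[x y].
Qed.

Lemma nonterminating_fold2 : (2 <= k)%N -> exists g1 g2 : R^o -> R^o,
  [/\ Ck_on k setT g1, Ck_on k setT g2,
      admissible_with_folds F mu S hat (fun p => g1 p.2 - p.1) (fun p => g2 p.1 - p.2),
      [/\ g1 0 = 0, derive1 g1 0 = 0 & derive1n 2 g1 0 < 0] &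
      [/\ g2 0 = 0, derive1 g2 0 = 0 & derive1n 2 g2 0 < 0]].
Proof.
move=> k2_le.
have [g1 [Cg1 g10 sg1 gs1]] := boundary_curve1 k2_le.
have [g2 [Cg2 g20 sg2 gs2]] := boundary_curve2 k2_le.
exists g1, g2; split=> //.
have n1d := rot_last rotS.
have g_le0 (g : R^o -> R^o) : g 0 = 0 -> forall y, (y != 0 -> g y < 0 :> R) -> g y <= 0 :> R.
  by move=> g0 y gy; have [->|/gy/ltW//] := eqVneq y 0; rewrite g0.
have ng1 : \forall p \near (0 : E),
    `|g1 p.2 : R| <= `|p.2 : R| / 2 /\ (p.2 != 0 -> g1 p.2 < 0 :> R).
  exact: (@continuous_snd R 0 _ gs1).
have ng2 : \forall p \near (0 : E),
    `|g2 p.1 : R| <= `|p.1 : R| / 2 /\ (p.1 != 0 -> g2 p.1 < 0 :> R).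
  exact: (@continuous_fst R 0 _ gs2).
apply: (admissible_with_folds_of_signs n_gt0 (j := l * d) (d := d) (b := n.-1 * d)) => //.
- by case: g10 => g0 _ _; rewrite g0 subr0.
- by case: g20 => g0 _ _; rewrite g0 subr0.
- apply: filterS2 (continuous_det_near S) (continuous_det_near hat) => p c1 c2.
  split; [exact: c1|exact: c2| |].
    apply: cvgB; last exact: continuous_fst.
    apply: (@continuous_comp _ _ _ (fun p : E => p.2) g1 p); first exact: continuous_snd.
    exact: Ck_on_continuous Cg1 _.
  apply: cvgB; last exact: continuous_snd.
  apply: (@continuous_comp _ _ _ (fun p : E => p.1) g2 p); first exact: continuous_fst.
  exact: Ck_on_continuous Cg2 _.
- exact: near_nonsingular.
- have cDc : {for 0, continuous (fun p => k1 * D chk p : R^o)}.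
    by apply: cvgM; [apply: cvg_cst|apply: continuous_det].
  have cDh : {for 0, continuous (fun p => k1 * D hat p : R^o)}.
    by apply: cvgM; [apply: cvg_cst|apply: continuous_det].
  have l1n : (l.-1 < n)%N by apply: leq_ltn_trans lt_ln; apply: leq_pred.
  (* The collisions now sit at [l] and [n.-1]. At [0] and [l.-1] the sign follows at once from
     [near_repAB0]; the other indices are generic. *)
  have gen : \forall p \near (0 : E), forall j, (j < n)%N -> j != l -> j != n.-1 ->
      p != 0 -> p.1 < 0 :> R -> p.2 < 0 :> R ->
      0 < sgn_symb R (symb S (j * d)) * s (j * d) p.
    apply: near_lt_n => j jn.
    have neg : \forall p \near (0 : E), p != 0 -> p.1 < 0 :> R -> p.2 < 0 :> R ->
        [/\ k1 * D S p < 0 :> R, k1 * (D chk p * t 0 p) > 0 :> R,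
            k1 * (D chk p * t (l * d) p) > 0 :> R & D S p != 0].
      apply: filterS3 (filterI D_quadrant (near_lt0 cDc k1_D)) r_gt0 (filterI t_0 t_l).
      move=> p [hD Dc] [r1p r2p] [e0 el] p0 p1 p2.
      have Dp := (hD p0).2 (ltW p1) (ltW p2).
      split=> //; last by apply: contraTneq Dp => ->; rewrite mulr0 ltxx.
        by rewrite e0 !mulrA pmulr_lgt0 // nmulr_lgt0.
      by rewrite el !mulrA pmulr_lgt0 // nmulr_lgt0.
    have sneg (X Y : R) : k1 * X < 0 -> 0 < k1 * (X * Y) -> 0 < -1 * Y.
      by move=> X0; rewrite mulrA nmulr_rgt0 // mulN1r oppr_gt0.
    have [->|j0] := eqVneq j 0%N.
      apply: filterS2 neg near_repAB0 => p hp e _ _ p0 p1 p2.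
      have [Dp Yp _ DS] := hp p0 p1 p2; have [e0 _] := e DS.
      rewrite (symb_S n_gt0) (ltnW l_gt1) /=; apply: sneg Dp _.
      by rewrite [D S p * _]e0.
    have [->|jl1] := eqVneq j l.-1.
      apply: filterS2 neg near_repAB0 => p hp e _ _ p0 p1 p2.
      have [Dp _ Yp DS] := hp p0 p1 p2; have [_ el] := e DS.
      rewrite (symb_S l1n) ltn_predL (ltnW l_gt1) /=.
      by apply: sneg Dp _; rewrite [D S p * _]el.
    have [->|jl] := eqVneq j l; first by near=> p.
    have [->|jn1] := eqVneq j n.-1; first by near=> p.
    apply: filterS (strict_generic jn j0 jl1 jl jn1) => p hp _ _ p0 p1 p2.
    by apply: (hp p0).2; apply: ltW.
  apply: filterS3 gen (filterI D_quadrant (near_gt0 cDh Dc_hat)) (filterI ng1 ng2).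
  move=> -[x y] /= hg [hD hh] [[_ a1] [_ a2]]; rewrite !subr_ge0 => xg yg p0.
  have g1y := g_le0 _ (let: And3 e _ _ := g10 in e) y a1.
  have g2x := g_le0 _ (let: And3 e _ _ := g20 in e) x a2.
  (* Both curves are negative away from 0, so the closed region, apart from the origin, lies in the
     open third quadrant. *)
  have x0 : x < 0 :> R.
    rewrite lt_neqAle (le_trans xg g1y) andbT; apply: contraNneq p0 => x0.
    have y0 : y = 0.
      by apply/eqP; apply: contraTT xg => /a1; rewrite x0 -ltNge.
    by rewrite x0 y0.
  have y0 : y < 0 :> R.
    rewrite lt_neqAle (le_trans yg g2x) andbT; apply: contraNneq p0 => y0.
    have x0' : x = 0.
      by apply/eqP; apply: contraTT yg => /a2; rewrite y0 -ltNge.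
    by rewrite x0' y0.
  have DSp := (hD p0).2 (ltW x0) (ltW y0); split.
    have : (k1 * D S (x, y)) * (k1 * D hat (x, y)) < 0 :> R by rewrite pmulr_llt0.
    by rewrite mulrACA -expr2 pmulr_rlt0 // exprn_even_gt0.
  move=> i il i0; have [j jn ij] := rot_index rotS i.
  have nS : nonsingular_cycle (F (x, y)) S.
    by apply/nonsingular_det; apply: contraTneq DSp; rewrite /D => ->; rewrite mulr0 ltxx.
  rewrite (symb_eq S ij) (cycle_s_eq mu nS ij); apply: hg => //.
    by apply: contraNneq il => j0; rewrite ij j0.
  by apply: contraNneq i0 => j0; rewrite ij j0.
- have strict_hat : \forall p \near (0 : E), forall j, (j < n)%N -> j != 0%N -> j != l ->
      0 < sgn_symb R (symb hat (j * d)) * h (j * d) p.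
    apply: near_lt_n => j jn.
    have [->|j0] := eqVneq j 0%N; first by near=> p.
    have [->|jl] := eqVneq j l; first by near=> p.
    have c : {for 0, continuous (fun p => sgn_symb R (symb hat (j * d)) * h (j * d) p : R^o)}.
      by apply: cvgM; [apply: cvg_cst|apply: ch].
    have c0 : 0 < sgn_symb R (symb hat (j * d)) * h (j * d) 0.
      have := signs jn j0 jl; rewrite hat_chk0 !symb_flip // -[0%N](mul0n d).
      by rewrite !(rot_eq_lt rotS) // (negbTE j0) (negbTE jl).
    by apply: filterS (near_gt0 c c0).
  apply: filterS2 strict_hat (near_nonsingular nsH) => p hp Dh i il i0.
  have [j jn ij] := rot_index rotS i.
  have nh : nonsingular_cycle (F p) hat by apply/nonsingular_det.
  rewrite (symb_eq hat ij) (cycle_s_eq mu nh ij); apply: hp => //.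
    by apply: contraNneq i0 => j0; rewrite n1d ij j0.
  by apply: contraNneq il => j0; rewrite ij j0.
- apply: filterS3 sg1 sg2 (near_nonsingular nsH) => p e1 e2 Dh.
  have nh : nonsingular_cycle (F p) hat by apply/nonsingular_det.
  have sl : symb hat (l * d) = symL.
    by rewrite symb_flip // eqxx symb_S // ltnn.
  have s0 : symb hat 0 = symL.
    rewrite symb_flip // -[0%N](mul0n d) (rot_eq_lt rotS) // symb_S //.
    by case: l l_gt1.
  rewrite (symb_eq hat n1d) (cycle_s_eq mu nh n1d) sl s0 /= !mulN1r !sgrN.
  by rewrite [Num.sg (cycle_s _ _ _ (l * d))]e1 [Num.sg (cycle_s _ _ _ 0)]e2 -!sgrN !opprB.
- apply: filterS2 ng1 ng2 => -[x y] /= [a1 _] [a2 _] p0.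
  (* A common point of the two curves has each coordinate at most half the other in absolute
     value. *)
  have key : g1 y = x -> g2 x = y -> False.
    move=> ex ey; move/eqP: p0; apply; rewrite ex in a1; rewrite ey in a2.
    by have /eqP-> : x == 0; [rewrite -normr_le0 (mutual_half_le0 a1 a2)|
       have /eqP-> : y == 0; [rewrite -normr_le0 (mutual_half_le0 a2 a1)|]].
  split=> /eqP; rewrite subr_eq0 => /eqP e1; rewrite le_eqVlt => /orP[/eqP/esym/eqP|//].
    by rewrite subr_eq0 => /eqP e2; case: (key e1 e2).
  by rewrite subr_eq0 => /eqP e2; case: (key e2 e1).
Unshelve. all: by end_near.
Qed.

End NonTerminating.

(** * Terminating shrinking points: the remaining sign *)

Section TerminatingFold.
Hypothesis term : terminating_shrinking_point (F 0) mu S l m d.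
Let n_ge3 : (3 <= n)%N. Proof. by have [_ []] := term. Qed.
Let lE : l = n.-1. Proof. by have [_ []] := term. Qed.
Let theta : R := pi / n%:R.
Let sst (p : E) : R^o := mu * rho_b (F p) / \det (1%:M - coef_L (F p)).
Let eta i (p : E) : R^o := resp (F p) chk (l * d) i.

Let sst_lt0 : sst 0 < 0 :> R. Proof. by have [_ _ [_ fp] _ _] := term. Qed.

Let continuous_det_fixL : {for 0, continuous (fun p => \det (1%:M - coef_L (F p)) : R^o)}.
Proof.
have [U [oU U0] [Cb CL CR]] := smooth_family_nbhs smoothF.
by apply: Ck_on_continuous U0; apply: Ck_on_det => //; apply: Ck_mxB => //; apply: Ck_mx_cst.
Qed.

Let det_fixL0 : \det (1%:M - coef_L (F 0)) != 0.
Proof. by have [_ _ [uA _] _ _] := term; rewrite -unitfE -unitmxE. Qed.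

Let continuous_sst : {for 0, continuous sst}.
Proof.
have [U [oU U0] [Cb CL CR]] := smooth_family_nbhs smoothF.
apply: cvgM; last exact: cvgV.
apply: cvgM; first exact: cvg_cst.
have h : Ck_mx k U (fun p => rho (F p) *m coef_b (F p)).
  apply: Ck_mxM => //; apply: Ck_mxM => //; first exact: Ck_mx_cst.
  by apply: Ck_mx_adj => //; apply: Ck_mxB => //; apply: Ck_mx_cst.
exact: Ck_on_continuous (h 0 0) U0.
Qed.

Let near_sst : \forall p \near (0 : E), fst_comp (fixL (F p) mu) = sst p.
Proof.
have : \forall p \near (0 : E), \det (1%:M - coef_L (F p)) != 0.
  exact: (cvgr_neq0 _ continuous_det_fixL det_fixL0).
by apply: filterS => p Dp; apply: fst_fixL; rewrite unitmxE unitfE.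
Qed.

(* For [l = n - 1], flipping both symbols of [chk] that are hit at the origin
   leaves only the letter L, whose cycle is the fixed point of the left piece. *)
Lemma near_fixed_rep : \forall p \near (0 : E),
  sst p = t (l * d) p + sst p * chi (l * d) p + sst p * eta (l * d) p /\
  D S p = D chk p * (1 - eta (l * d) p).
Proof.
have : \forall p \near (0 : E), \det (1%:M - coef_L (F p)) != 0.
  exact: (cvgr_neq0 _ continuous_det_fixL det_fixL0).
apply: filterS3 near_sst (near_nonsingular nsC) => p es Dc Dp.
have nc : nonsingular_cycle (F p) chk by apply/nonsingular_det.
have uL : 1%:M - coef_L (F p) \in unitmx by rewrite unitmxE unitfE.
pose hat := flip_at S (l * d).
have neq0l : (0 != l * d %[mod n])%N.
  by rewrite -[0%N in X in X != _](mul0n d) (rot_eq_lt rotS) // eq_sym -lt0n ltnW.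
have hatE : hat = flip_at (flip_at chk 0) (l * d) by rewrite flip_chk.
have fix_iter i : iterate (F p) mu hat (fixL (F p) mu) i = fixL (F p) mu.
  elim: i => //= i ->; have [j jn ij] := rot_index rotS i.
  rewrite (symb_eq hat ij) symb_flip // symb_S // (rot_eq_lt rotS) //.
  have -> : (j < l)%N = (j != l) by rewrite ltn_neqAle lE -ltnS prednK // jn andbT.
  by case: (j == l); apply: piece_fixL.
have cyc : is_cycle (F p) mu hat (fixL (F p) mu) by apply/is_cycleE; apply: fix_iter.
have lt_qn : ((l * d) %% n < n)%N by rewrite ltn_mod.
split.
  have := flip2_orbit n_gt0 nc neq0l hatE cyc lt_qn.
  rewrite !fix_iter es [cycle_s _ _ _ _](cycle_s_mod mu _ nc).
  by rewrite /chi /eta /resp !modn_mod.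
(* Flipping [chk] at [l * d] gives a shift of [S]: shifted by [d], it is [chk'] flipped back at
   [l.-1 * d]. *)
rewrite -(det_flip n_gt0 (l * d) nc) -(det_M_shift (F p) n_gt0 _ d) -[in RHS]dl.
by rewrite cyclic_shift_flip // -chk'E flip_chk'.
Qed.

Let k12 : k1 = k2.
Proof.
have td := terminating_cycle_s_pred term t00 tl0.
apply: (mulIf (ltr0_neq0 td_lt0)); rewrite k1_t -k2_t; congr (_ * _).
exact: td.
Qed.

Let near_term : \forall p \near (0 : E), p != 0 -> 0 <= p.1 :> R -> 0 <= p.2 :> R ->
  0 < k1 * (D S p * s (l * d) p) :> R.
Proof.
(* [c] must satisfy [c < k1 ^ 2] for the expansion and [4 c > k1 ^ 2 tau] for the quadratic term;
   [(4 + tau) / 8] is the midpoint of [tau / 4] and 1. *)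
pose tau := 4 * sin theta ^+ 2; pose c := k1 ^+ 2 * ((4 + tau) / 8).
have tau4 : tau < 4.
  by have := terminating_sin2_lt1 term; rewrite -/theta /tau; lra.
have k1k : 0 < k1 ^+ 2 :> R by rewrite exprn_even_gt0.
have c_lt : 0 < k1 ^+ 2 - c.
  have -> : k1 ^+ 2 - c = k1 ^+ 2 * ((4 - tau) / 8) by rewrite /c; field.
  by rewrite mulr_gt0 // divr_gt0 // subr_gt0.
have fo : first_order (fun p => k1 * D S p + (- c) * (t 0 p + t (l * d) p))
    (k1 ^+ 2 - c) (k1 ^+ 2 - c).
  have c1 : {for (0 : E), continuous (fun p => 1 + r1 p : R^o)}.
    by apply: cvgD => //; apply: cvg_cst.
  have c2 : {for (0 : E), continuous (fun p => 1 + r2 p : R^o)}.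
    by apply: cvgD => //; apply: cvg_cst.
  have := first_orderD (first_orderZ k1 first_order_D) (first_orderZ (- c)
    (first_orderD (first_orderM (@first_order_fst R) c1)
                  (first_orderM (@first_order_snd R) c2))).
  rewrite r10 r20 -k12 !(mul1r, mul0r, addr0, add0r, mulr1) -expr2 => h.
  apply: eq_first_order h; apply: filterS2 t_0 t_l => p e0 el.
  by rewrite e0 el.
have cK : {for 0, continuous (fun p => 4 * c - k1 * D chk p / sst p : R^o)}.
  apply: cvgB; first exact: cvg_cst.
  apply: cvgM; last by apply: cvgV => //; apply: ltr0_neq0.
  by apply: cvgM; [apply: cvg_cst|apply: continuous_det].
have K0 : 0 < 4 * c - k1 * D chk 0 / sst 0 :> R.
  have e : t d 0 = tau * sst 0.
    by rewrite /t (terminating_cycle_s1 term t00 tl0) fst_fixL //; have [_ _ []] := term.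
  rewrite -k1_t e.
  have -> : 4 * c - k1 * (k1 * (tau * sst 0)) / sst 0 = k1 ^+ 2 * ((4 - tau) / 2).
    by rewrite /c; field; apply: ltr0_neq0.
  by rewrite mulr_gt0 // divr_gt0 // subr_gt0.
apply: filterS3 (filterI (first_order_quadrant c_lt c_lt fo) D_quadrant)
  (filterI (filterI near_fixed_rep quadrant_t) (near_lt0 continuous_sst sst_lt0))
  (filterI near_repA (near_gt0 cK K0)).
move=> p [hfo hD] [[[esst eD] hq] sp] [eA Kp] p0 p1 p2.
have [t0_ge tl_ge t_gt] := hq p1 p2 p0.
have Dp := (hD p0).1 p1 p2; have foP := (hfo p0).1 p1 p2.
have DS : D S p != 0 by apply: contraTneq Dp => ->; rewrite mulr0 ltxx.
have spn : sst p != 0 by apply: ltr0_neq0.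
rewrite eA //.
have -> : k1 * (D S p * t (l * d) p + D chk p * t 0 p * chi (l * d) p) =
    k1 * D S p * (t 0 p + t (l * d) p) - k1 * D chk p / sst p * (t 0 p * t (l * d) p) :> R.
  have -> : chi (l * d) p = 1 - eta (l * d) p - t (l * d) p / sst p.
    have e : sst p * chi (l * d) p = sst p - t (l * d) p - sst p * eta (l * d) p.
      by rewrite {2}esst; ring.
    by apply: (mulfI spn); rewrite e; field.
  by rewrite eD; field.
apply: (quadratic_margin (c := c)) => //.
have tau0 : 0 <= tau by rewrite mulr_ge0 // sqr_ge0.
by rewrite mulr_ge0 ?ltW // divr_gt0 // ltr_wpDr.
Qed.

Lemma terminating_fold1 :
  admissible_with_folds F mu S chk (fun p => p.1) (fun p => p.2).
Proof. by apply: edge_fold => j; rewrite lE orbb => /eqP ->; rewrite -lE; apply: near_term. Qed.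

End TerminatingFold.

End Unfolding.

Theorem theorem9 (R : realType) (N k : nat) (hN : (2 <= N)%N) (hk : (2 <= k)%N)
    (mu : R) (hmu : mu != 0)
    (l m n d : nat) (S : n.-tuple symbol) (hS : is_rotational S l m d)
    (F : R^o * R^o -> pwl_map R N) (hF : smooth_family k F)
    (hsp : nonterminating_shrinking_point (F 0) mu S l m d \/
           terminating_shrinking_point (F 0) mu S l m d)
    (hoff : nonterminating_shrinking_point (F 0) mu S l m d ->
       forall i, (i != 0 %[mod n])%N -> (i != l * d %[mod n])%N ->
         cycle_s (F 0) mu (flip_at S 0) i != 0)
    (r1 r2 : R^o * R^o -> R^o)
    (hr1 : r1 =O_ (0 : R^o * R^o) (fun p : R^o * R^o => (`|p| : R^o)))
    (hr2 : r2 =O_ (0 : R^o * R^o) (fun p : R^o * R^o => (`|p| : R^o)))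
    (hs0 : \forall p \near (0 : R^o * R^o),
       cycle_s (F p) mu (flip_at S 0) 0 = p.1 * (1 + r1 p))
    (hsld : \forall p \near (0 : R^o * R^o),
       cycle_s (F p) mu (flip_at S 0) (l * d) = p.2 * (1 + r2 p))
    (k1 k2 : R) (hk1 : k1 != 0) (hk2 : k2 != 0)
    (hdet : (fun p : R^o * R^o =>
         (\det (1%:M - M_ (F p) S) - (k1 * p.1 + k2 * p.2) : R^o))
       =O_ (0 : R^o * R^o) (fun p : R^o * R^o => (`|p| ^+ 2 : R^o))) :
  admissible_with_folds F mu S (flip_at S 0)
    (fun p => p.1) (fun p => p.2) /\
  (nonterminating_shrinking_point (F 0) mu S l m d ->
   exists g1 g2 : R^o -> R^o,
     [/\ Ck_on k setT g1, Ck_on k setT g2,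
         admissible_with_folds F mu S (flip_at S (l * d))
           (fun p => g1 p.2 - p.1) (fun p => g2 p.1 - p.2),
         [/\ g1 0 = 0, derive1 g1 0 = 0 & derive1n 2 g1 0 < 0] &
         [/\ g2 0 = 0, derive1 g2 0 = 0 & derive1n 2 g2 0 < 0]]).
Proof.
have [r10 cr1] := bigO_norm_cvg0 hr1; have [r20 cr2] := bigO_norm_cvg0 hr2.
have [C linD] := bigO_norm2 hdet.
have n_gt0 : (0 < n)%N := rot_gt0 hS.
have l_gt1 : (1 < l)%N.
  case: hsp => [[_ [_ /andP[]]] //|[_ [_ -> n3] _ _ _]].
  by rewrite -ltnS prednK.
have nsC : nonsingular_cycle (F 0) (flip_at S 0).
  by case: hsp => [[_ _ _ []]|[]].
have t00 : cycle_s (F 0) mu (flip_at S 0) 0 = 0.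
  by have := nbhs_singleton hs0; rewrite mul0r.
have tl0 : cycle_s (F 0) mu (flip_at S 0) (l * d) = 0.
  by have := nbhs_singleton hsld; rewrite mul0r.
have signs j : (j < n)%N -> j != 0%N -> j != l ->
    0 < sgn_symb R (symb (flip_at S 0) (j * d)) * cycle_s (F 0) mu (flip_at S 0) (j * d).
  move=> jn j0 jl; have ln : (l < n)%N by case: hS.
  have jd0 : (j * d != 0 %[mod n])%N by rewrite -[0%N](mul0n d) (rot_eq_lt hS).
  case: hsp => [nt|te].
    have := nt => -[_ _ _ _ /(is_admissible_cycleP n_gt0 mu nsC)/(_ (j * d)%N) ge0].
    (* Admissibility gives only the weak inequality; [hoff] keeps the remaining points off the
       switching manifold. In the terminating case the explicit orbit does so. *)
    rewrite lt_neqAle ge0 andbT eq_sym mulf_neq0 ?hoff ?(rot_eq_lt hS) //.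
    by case: (symb _ _) => /=; rewrite ?oppr_eq0 oner_eq0.
  have lE : l = n.-1 by case: te => _ [].
  have jl' : (j < l)%N by move: jn jl; rewrite lE; lia.
  rewrite symb_flip // (negbTE jd0) (symb_rot hS) // jl' mulN1r oppr_gt0.
  by apply: (terminating_cycle_s_lt0 te t00 tl0); rewrite lt0n j0 -lE.
split; last first.
  move=> nt; have [_ [_ /andP[_ l_lt]] _ [_ nsH] _] := nt.
  exact: (nonterminating_fold2 hF hS l_gt1 nsC cr1 cr2 r10 r20 hs0 hsld hk1 hk2 linD).
case: hsp => [[_ [_ /andP[_ l_lt]] _ [_ nsH] _]|te].
  exact: (nonterminating_fold1 hF hS l_gt1 nsC cr1 cr2 r10 r20 hs0 hsld hk1 hk2 linD).
exact: (terminating_fold1 hF hS l_gt1 nsC cr1 cr2 r10 r20 hs0 hsld hk1 hk2 linD).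
Qed.
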